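(* For every finite connected weighted undirected graph $G=(V,(c_{xy})_{x,y\in V})$ and all positive weights $\alpha=(\alpha_x)_{x\in V}$, the spectral gap $\mathrm{gap}(G,\alpha)$ of the KMP model on $G$ with parameters $\alpha$ satisfies $$\gamma_{\rm KMP}(G,\alpha)\,\mathrm{gap}_1(G,\alpha)\le \mathrm{gap}(G,\alpha)\le \mathrm{gap}_1(G,\alpha),$$ where $$\gamma_{\rm KMP}(G,\alpha)= \frac{\alpha_{2,\min}}{1+\alpha_{2,\min}}\Big(1+\frac1{|\alpha|}\Big),\qquad \alpha_{2,\min}=\min_{x\neq y\,:\, c_{xy}>0}\{\alpha_x+\alpha_y\},\qquad |\alpha|=\sum_{x\in V}\alpha_x .$$
   Context: $V$ is a finite set with $|V|=n\ge 2$; $c_{xy}=c_{yx}\ge 0$ are symmetric edge weights ($c_{xx}=0$), and $G$ is connected through the edges with $c_{xy}>0$. The state space is $\Omega=\{\eta=(\eta_x)_{x\in V}:\eta_x\ge 0,\ \sum_{x\in V}\eta_x=1\}$. KMP model: each unordered pair $\{x,y\}$ of distinct vertices is selected at rate $c_{xy}$; then a random variable $U\sim\mathrm{Beta}(\alpha_x,\alpha_y)$ is sampled, and $(\eta_x,\eta_y)$ is replaced by $(U(\eta_x+\eta_y),(1-U)(\eta_x+\eta_y))$, all other coordinates being unchanged. Its generator is $$\mathcal L f(\eta)=\sum_{\{x,y\}\subset V,\,x\ne y}c_{xy}\int_0^1\frac{\Gamma(\alpha_x+\alpha_y)}{\Gamma(\alpha_x)\Gamma(\alpha_y)}u^{\alpha_x-1}(1-u)^{\alpha_y-1}\{f(\eta^{xy,u})-f(\eta)\}\,\mathrm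 du,$$ where $\eta^{xy,u}$ denotes $\eta$ with $(\eta_x,\eta_y)$ replaced by $(u(\eta_x+\eta_y),(1-u)(\eta_x+\eta_y))$. It is reversible with respect to the Dirichlet distribution $\mu\sim\mathrm{Dir}(\alpha)$ on $\Omega$, i.e. the probability measure with density proportional to $\prod_{x\in V}\eta_x^{\alpha_x-1}$ with respect to the uniform measure on $\Omega$. Write $\mu f=\int f\,\mathrm d\mu$ and $\mathcal D(f)=\langle f,-\mathcal L f\rangle_{L^2(\mu)}$. Define $$\mathrm{gap}(G,\alpha)=\inf\{\mathcal D(f): f\in L^2(\mu),\ \|f-\mu f\|_{L^2(\mu)}=1\},\qquad \mathrm{gap}_1(G,\alpha)=\inf\{\mathcal D(f): f\in \mathscr P_1,\ \|f-\mu f\|_{L^2(\mu)}=1\},$$ where $\mathscr P_1$ is the space of polynomial functions on $\Omega$ of degree at most $1$ in the variables $(\eta_x)_{x\in V}$. *)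

(* Defs.v *)
From HB Require Import structures.
From mathcomp Require Import all_boot all_order all_algebra.
From mathcomp Require Import all_classical all_reals all_analysis.
From mathcomp Require Import measurable_realfun.

Set Implicit Arguments.
Unset Strict Implicit.
Unset Printing Implicit Defensive.

Import Order.TTheory GRing.Theory Num.Theory.
Import numFieldNormedType.Exports.

Local Open Scope classical_set_scope.
Local Open Scope ring_scope.

Section LebesgueTuple.
Context {R : realType}.

Definition cons_pair n (p : R * n.-tuple R) : n.+1.-tuple R :=
  [tuple of p.1 :: p.2].

Lemma measurable_cons_pair n : measurable_fun setT (@cons_pair n).
Proof. exact: (measurable_cons measurable_fst measurable_snd). Qed.

Section Cons.
Context n (m : {sigma_finite_measure set (n.-tuple R) -> \bar R}).

Definition lebesgue_cons : set (n.+1.-tuple R) -> \bar R :=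
  pushforward (@lebesgue_measure R \x m)%E (@cons_pair n).

Lemma lebesgue_cons0 : lebesgue_cons set0 = 0%E.
Proof. have mc := @measurable_cons_pair n. exact: measure0. Qed.

Lemma lebesgue_cons_ge0 A : (0 <= lebesgue_cons A)%E.
Proof. have mc := @measurable_cons_pair n. exact: measure_ge0. Qed.

Lemma lebesgue_cons_sigma_additive : semi_sigma_additive lebesgue_cons.
Proof.
have mc := @measurable_cons_pair n.
exact: measure_semi_sigma_additive.
Qed.

HB.instance Definition _ := isMeasure.Build _ _ _ lebesgue_cons
  lebesgue_cons0 lebesgue_cons_ge0 lebesgue_cons_sigma_additive.

Lemma lebesgue_cons_sigma_finite : sigma_finite setT lebesgue_cons.
Proof.
have /sigma_finiteP[F [TF ndF Foo]] := sigma_finiteT (@lebesgue_measure R).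
have /sigma_finiteP[G [TG ndG Goo]] := sigma_finiteT m.
pose g (t : n.+1.-tuple R) : measurableTypeR R * n.-tuple R :=
  (thead t, [tuple of behead t]).
have mg : measurable_fun setT g.
  apply/measurable_fun_pair; [exact: measurable_tnth|exact: measurable_behead].
have gK : g \o @cons_pair n = id.
  by apply/funext => -[x t]; rewrite /g /cons_pair /=; congr pair;
    exact: val_inj.
exists (fun k => g @^-1` (F k `*` G k)).
  rewrite -preimage_bigcup -(preimage_setT g); congr (g @^-1` _).
  rewrite -setXTT TF TG predeqE => -[x y]; split.
    move=> [/= [i _ Fx] [j _ Gy]]; exists (maxn i j) => //; split.
    - by move: x Fx; exact/subsetPset/ndF/leq_maxl.
    - by move: y Gy; exact/subsetPset/ndG/leq_maxr.
  by move=> [i _ [/= ? ?]]; split; exists i.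
move=> k; have [mF Fk] := Foo k; have [mG Gk] := Goo k; split.
  by rewrite -[X in measurable X]setTI; apply: mg => //; exact: measurableX.
rewrite /lebesgue_cons /pushforward -comp_preimage gK preimage_id.
by rewrite product_measure1E// lte_mul_pinfty// ge0_fin_numE.
Qed.

HB.instance Definition _ := Measure_isSigmaFinite.Build _ _ _ lebesgue_cons
  lebesgue_cons_sigma_finite.

End Cons.

(* Lebesgue measure on R^n; on R^0 it is the unit mass at the empty tuple. *)
Fixpoint lebesgue_tuple n : {sigma_finite_measure set (n.-tuple R) -> \bar R} :=
  match n with
  | 0 => @dirac _ (0.-tuple R) [tuple] R
  | k.+1 => lebesgue_cons (lebesgue_tuple k)
  end.

End LebesgueTuple.

(* A point of R^V is a tuple indexed by the enumeration of V, which carries the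
   Borel sigma-algebra generated by the coordinates. *)
Notation config R V := (#|V|.-tuple (Real.sort R)).

Section Simplex.
Context {R : realType} {V : finType}.
Implicit Types (eta : config R V) (x : V).

Definition coord eta x : R := tnth eta (enum_rank x).

Definition mkconfig (g : V -> R) : config R V :=
  [tuple g (enum_val i) | i < #|V|].

Lemma mkconfigE g x : coord (mkconfig g) x = g x.
Proof. by rewrite /coord tnth_mktuple enum_rankK. Qed.

Lemma measurable_coord x : measurable_fun setT (coord ^~ x).
Proof. exact: measurable_tnth. Qed.

Definition simplex : set (config R V) :=
  [set eta | (forall x, 0 <= coord eta x) /\ \sum_x coord eta x = 1].

Lemma measurable_simplex : measurable simplex.
Proof.
rewrite (_ : simplex = (\bigcap_(x in [set: V]) ((coord ^~ x) @^-1` `[0, +oo[))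
  `&` ((fun eta => \sum_x coord eta x) @^-1` [set 1])); last first.
  apply/seteqP; split => eta /= [eta0 eta1]; split => // x.
    by move=> _; rewrite /= in_itv/= andbT.
  by have := eta0 x Logic.I; rewrite /= in_itv/= andbT.
apply: measurableI.
  apply: fin_bigcap_measurable => // x _.
  by rewrite -[X in measurable X]setTI; exact: measurable_coord.
rewrite -[X in measurable X]setTI.
by apply: measurable_sum => //; exact: measurable_coord.
Qed.

(* Parametrizes the hyperplane sum_x eta_x = 1 by the first |V| - 1
   coordinates. *)
Definition hyperplane_point (t : (#|V|.-1).-tuple R) : config R V :=
  mkconfig (fun x => nth 0 (rcons t (1 - \sum_(s <- t) s)) (enum_rank x)).

Lemma measurable_hyperplane_point : measurable_fun setT hyperplane_point.
Proof.
apply/measurable_fun_tnthP => i.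
rewrite (_ : _ \o _ = fun t : (#|V|.-1).-tuple R =>
    nth 0 (rcons t (1 - \sum_(s <- t) s)) i); last first.
  by apply/funext => t; rewrite /= tnth_mktuple enum_valK.
have [ilt|] := ltnP i #|V|.-1.
  rewrite (_ : (fun _ => _) = (fun t : (#|V|.-1).-tuple R =>
    tnth t (Ordinal ilt))); first exact: measurable_tnth.
  by apply/funext => t; rewrite nth_rcons size_tuple ilt (tnth_nth 0).
move=> ige; rewrite (_ : (fun _ => _) = (fun t : (#|V|.-1).-tuple R =>
    1 - \sum_(j < #|V|.-1) tnth t j)).
  apply: measurable_funB => //; apply: measurable_sum => j.
  exact: measurable_tnth.
apply/funext => t; rewrite nth_rcons size_tuple ltnNge ige /=.
have -> : nat_of_ord i = #|V|.-1.
  apply/eqP; rewrite eqn_leq ige andbT -ltnS prednK//.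
  exact: leq_ltn_trans (leq0n i) (ltn_ord i).
by rewrite eqxx big_tuple.
Qed.

(* Lebesgue measure on the hyperplane sum_x eta_x = 1, up to a constant; its
   restriction to the simplex is a multiple of the uniform measure. *)
Definition hyperplane_measure : set (config R V) -> \bar R :=
  pushforward (lebesgue_tuple #|V|.-1) hyperplane_point.

Lemma hyperplane_measure0 : hyperplane_measure set0 = 0%E.
Proof. have mh := measurable_hyperplane_point. exact: measure0. Qed.

Lemma hyperplane_measure_ge0 A : (0 <= hyperplane_measure A)%E.
Proof. have mh := measurable_hyperplane_point. exact: measure_ge0. Qed.

Lemma hyperplane_measure_sigma_additive :
  semi_sigma_additive hyperplane_measure.
Proof.
have mh := measurable_hyperplane_point.
exact: measure_semi_sigma_additive.
Qed.

HB.instance Definition _ := isMeasure.Build _ _ _ hyperplane_measure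
  hyperplane_measure0 hyperplane_measure_ge0 hyperplane_measure_sigma_additive.

Definition uniform_simplex : {measure set (config R V) -> \bar R} :=
  mrestr hyperplane_measure measurable_simplex.

End Simplex.

Section Dirichlet.
Context {R : realType} {V : finType} (alpha : V -> R).
Implicit Types eta : config R V.

Definition dirichlet_density eta : R :=
  \prod_x coord eta x `^ (alpha x - 1).

Lemma dirichlet_density_ge0 eta : (0 <= (dirichlet_density eta)%:E)%E.
Proof. by rewrite lee_fin prodr_ge0// => x _; exact: powR_ge0. Qed.

Lemma measurable_dirichlet_density : measurable_fun setT dirichlet_density.
Proof.
apply: measurable_prod => x _.
exact: (measurableT_comp (measurable_powR _) (measurable_coord x)).
Qed.

Definition dirichlet_weight (A : set (config R V)) : \bar R :=
  (\int[uniform_simplex]_(eta in A) (dirichlet_density eta)%:E)%E.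

Lemma dirichlet_weight0 : dirichlet_weight set0 = 0%E.
Proof. exact: integral_set0. Qed.

Lemma dirichlet_weight_ge0 A : (0 <= dirichlet_weight A)%E.
Proof. by apply: integral_ge0 => eta _; exact: dirichlet_density_ge0. Qed.

Lemma dirichlet_weight_sigma_additive : semi_sigma_additive dirichlet_weight.
Proof.
apply: semi_sigma_additive_nng_induced => [|eta].
  by apply/measurable_EFinP; exact: measurable_dirichlet_density.
exact: dirichlet_density_ge0.
Qed.

HB.instance Definition _ := isMeasure.Build _ _ _ dirichlet_weight
  dirichlet_weight0 dirichlet_weight_ge0 dirichlet_weight_sigma_additive.

(* The second argument of mnormalize is its value when the total mass of the
   weight is 0 or +oo, which does not occur for V nonempty and alpha > 0. *)
Definition dirichlet : probability (config R V) R :=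
  mnormalize dirichlet_weight \d_(mkconfig (fun=> #|V|%:R^-1)).

End Dirichlet.

Section KMP.
Context {R : realType} {V : finType} (c : V -> V -> R) (alpha : V -> R).
Implicit Types (eta : config R V) (x y : V) (f : config R V -> R).

Local Notation mu := (dirichlet alpha).

Definition Gamma (a : R) : R :=
  \int[lebesgue_measure]_(t in `]0, +oo[) (t `^ (a - 1) * expR (- t)).

Definition beta_density (a b u : R) : R :=
  Gamma (a + b) / (Gamma a * Gamma b) * u `^ (a - 1) * (1 - u) `^ (b - 1).

Definition exchange eta x y (u : R) : config R V :=
  mkconfig (fun z => if z == x then u * (coord eta x + coord eta y)
                     else if z == y then (1 - u) * (coord eta x + coord eta y)
                     else coord eta z).

(* Each unordered pair {x, y} is represented once, ordered along the enumeration
   of V; as c is symmetric, u |-> 1 - u shows that the order is immaterial. *)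
Definition generator f eta : R :=
  \sum_(p : V * V | (enum_rank p.1 < enum_rank p.2)%N)
    c p.1 p.2 * \int[lebesgue_measure]_(u in `[0, 1])
      (beta_density (alpha p.1) (alpha p.2) u *
        (f (exchange eta p.1 p.2 u) - f eta)).

Definition mean f : R := \int[mu]_eta f eta.

Definition dirichlet_form f : \bar R :=
  (\int[mu]_eta (f eta * - generator f eta)%:E)%E.

Definition normalized f : Prop :=
  ('N[mu]_2%:E [EFin \o (f \- cst (mean f))%R] = 1)%E.

(* The Dirichlet distribution is carried by the simplex, so its L^2 space is
   given by functions on R^V; likewise a polynomial function on the simplex is
   given by a polynomial on R^V. *)
Definition gap : \bar R :=
  ereal_inf [set dirichlet_form f | f in
    [set f | f \in Lfun mu 2%:E /\ normalized f]].

Definition poly1 f : Prop :=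
  exists (a : R) (b : V -> R), forall eta, f eta = a + \sum_x b x * coord eta x.

Definition gap1 : \bar R :=
  ereal_inf [set dirichlet_form f | f in [set f | poly1 f /\ normalized f]].

Definition alpha_sum : R := \sum_x alpha x.

Definition alpha2_min : R :=
  inf [set alpha p.1 + alpha p.2 | p in
    [set p : V * V | p.1 != p.2 /\ 0 < c p.1 p.2]].

Definition gamma_KMP : R :=
  alpha2_min / (1 + alpha2_min) * (1 + alpha_sum^-1).

End KMP.

(* Main.v *)
(* Write A = |alpha|, s = alpha_x + alpha_y and P_e for the resampling of an
   edge e = {x, y}. On linear functions lin b = \sum_z b_z eta_z, P_e replaces
   b by its alpha-average over e, and sform b = A^2 (A + 1) Var(lin b) satisfies
     sform (P_e b) + beta_var (b_x - b_y)^2 sform 1_e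
       = sform b - (A + 1) s / (s + 1) alpha_x alpha_y / s (b_x - b_y)^2.
   As s >= alpha_2,min, averaging over the edges of the chain K = \sum_e
   (c_e / \sum c) P_e gives the contraction r = 1 - gamma gap_1 / \sum c.
   The left-hand side is how the quadratic form (lin b)^2 evolves when two
   configurations are coupled through the same Beta variables. Hence, if the
   Jensen defects F(\sum lam_i y_i) - \sum lam_i F(y_i) are bounded by
   \sum lam_i lam_j q(y_i - y_j) for a quadratic form q, then K^t F is at
   distance O(r^t) from an affine function; on centered affine functions K
   contracts L^2(mu) by 1 - gap_1 / \sum c <= r, so ||K^t F|| = O(q^t) for each
   q > r. As K is self-adjoint, t |-> ||K^t F|| is log-convex, and therefore
   ||K F|| <= r ||F||. Functions with C^{1,1} regularity have such Jensen
   defects, and they are dense in L^2(mu). *)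
From HB Require Import structures.
Require Import Defs.
From mathcomp Require Import all_boot all_order all_algebra perm.
From mathcomp Require Import all_classical all_reals all_analysis.
From mathcomp Require Import measurable_realfun.
From mathcomp Require Import ring lra.
Require Import Defs.

Set Implicit Arguments.
Unset Strict Implicit.
Unset Printing Implicit Defensive.

Import Order.TTheory GRing.Theory Num.Theory.
Import numFieldNormedType.Exports HBNNSimple.

Local Open Scope classical_set_scope.
Local Open Scope ring_scope.

(** * Gamma and Beta integrals *)

(** The constant in ||K^t F|| = O(q^t) is crude and depends on F; log-convexity discards it and
    keeps only the rate, so the one-step bound passes to L^2 limits. The Jensen defects are taken
    over |V| points because a configuration is the barycentre of the vertices of the simplex, with
    its own coordinates as weights: the affine function close to K^t F interpolates its vertex
    values. For a fixed value of the Beta variable an exchange is linear, hence commutes with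
    barycentres; this is why the coupling propagates the defects. In gamma, a/(1 + a) with a =
    alpha_2,min is the smallest s/(s + 1) over the edges, and 1 + 1/A is the A + 1 of the displayed
    identity divided by the A that appears when gap_1 is written as an inequality on [sform]. Since
    a <= A, gamma <= 1. Beyond being a probability carried by the simplex, the Dirichlet measure
    enters through its invariance under each P_e, from which self-adjointness and the moments
    follow. For the L^2 limit the Dirichlet form is rewritten through mean squared jumps, which are
    nonnegative and controlled by ||f||^2. *)

Section Affine.
Context {R : realType}.
Local Notation leb := (@lebesgue_measure R).
Local Open Scope ereal_scope.

(** Lebesgue measure is characterized by its values on half-open intervals, on which the rescaled
    image measure is computed directly. *)
Lemma ge0_integral_affine (f : R -> \bar R) (k c : R) : (0 < k)%R ->
  measurable_fun setT f -> (forall x, 0 <= f x) ->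
  \int[leb]_x f x = k%:E * \int[leb]_x f (k * x + c)%R.
Proof.
move=> k0 mf f0.
have mphi : measurable_fun setT (fun x : measurableTypeR R => (k * x + c)%R : measurableTypeR R).
  by apply: measurable_funD => //; exact: measurable_funM.
pose m : {measure set (measurableTypeR R) -> \bar R} :=
  mscale (NngNum (ltW k0)) (@pushforward _ _ _ (measurableTypeR R) R leb (fun x : R => (k * x + c)%R)).
have mE (A : set R) : measurable A -> leb A = m mphi A.
  apply: lebesgue_measure_unique => _ [[a b]] _ <-.
  transitivity (k%:E * leb `]((a - c) / k)%R, ((b - c) / k)%R]%classic); last first.
    congr (_ * leb _); apply/seteqP.
    by split => x /=; rewrite !in_itv/= ltr_pdivrMr// ler_pdivlMr//
      ltrBlDr lerBrDr mulrC.
  rewrite !lebesgue_measure_itv/= !lte_fin.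
  rewrite ltr_pM2r ?invr_gt0// ltrD2r.
  case: ifP => ab; last by rewrite mule0.
  rewrite -!EFinB -EFinM; congr EFin; field; exact: lt0r_neq0.
rewrite [LHS](eq_measure_integral (m mphi)); last by move=> A mA _; exact: mE.
rewrite ge0_integral_mscale//= ge0_integral_pushforward//.
Qed.

Lemma ge0_integral_shift (f : R -> \bar R) (c : R) :
  measurable_fun setT f -> (forall x, 0 <= f x) ->
  \int[leb]_x f x = \int[leb]_x f (x + c)%R.
Proof.
move=> mf f0; rewrite (@ge0_integral_affine f 1 c)// mul1e.
by apply: eq_integral => x _; rewrite mul1r.
Qed.

Lemma ge0_integralN (f : R -> \bar R) :
  measurable_fun setT f -> (forall x, 0 <= f x) ->
  \int[leb]_x f x = \int[leb]_x f (- x)%R.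
Proof.
move=> mf f0.
rewrite [LHS](eq_measure_integral (pushforward leb (-%R : _ -> measurableTypeR R))).
  by rewrite ge0_integral_pushforward.
by move=> A mA _; exact/esym/lebesgue_measureN.
Qed.

Lemma ge0_integral_reflect (f : R -> \bar R) (c : R) :
  measurable_fun setT f -> (forall x, 0 <= f x) ->
  \int[leb]_x f x = \int[leb]_x f (c - x)%R.
Proof.
move=> mf f0; rewrite (@ge0_integral_shift f c)//.
rewrite (@ge0_integralN (fun x => f (x + c)%R))//.
  by apply: eq_integral => x _; rewrite addrC.
by apply: measurableT_comp => //; exact: measurable_funD.
Qed.

End Affine.

Section PowerIntegral.
Context {R : realType}.
Local Notation leb := (@lebesgue_measure R).

(* The power function extended by 0 on the nonpositive half-line; [0 `^ 0 = 1]
   in the library, so the cut-off matters at the origin when [a = 1]. *)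
Definition ppow (a t : R) : R := if 0 < t then t `^ (a - 1) else 0.

Lemma ppow_ge0 a t : 0 <= ppow a t.
Proof. by rewrite /ppow; case: ifP => // _; exact: powR_ge0. Qed.

Lemma measurable_ppow a : measurable_fun setT (ppow a).
Proof.
apply: measurable_fun_if => //.
- apply: (measurable_fun_bool true).
  rewrite setTI (_ : _ @^-1` _ = `]0, +oo[%classic)//.
  by apply/seteqP; split => x /=; rewrite in_itv/= andbT.
- apply: measurable_funTS; exact: measurable_powR.
Qed.

Lemma ppowM a (k t : R) : 0 < k -> ppow a (k * t) = k `^ (a - 1) * ppow a t.
Proof.
move=> k0; rewrite /ppow pmulr_rgt0//.
by case: ifPn => [t0|]; rewrite ?mulr0// powRM// ltW.
Qed.

Lemma integral_ppow (a t : R) : 0 < a -> 0 < t ->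
  (\int[leb]_(s in `]0%R, t]) (ppow a s)%:E = (t `^ a / a)%R%:E)%E.
Proof.
move=> a0 t0.
(* For a < 1 the integrand is singular at 0, so the fundamental theorem is applied on intervals away
   from 0 that exhaust ]0, t]. The divisor n + 2 keeps the left endpoint strictly below t. *)
pose F n := `](t / n.+2%:R), t]%classic : set R.
have FU : \bigcup_n F n = `]0, t]%classic.
  apply/seteqP; split => [x [n _]|x].
    rewrite /F /= !in_itv/= => /andP[xn ->]; rewrite andbT.
    by apply: le_lt_trans xn; rewrite divr_ge0// ltW.
  rewrite /= in_itv/= => /andP[x0 xt].
  exists (Num.bound (t / x)) => //=; rewrite /F/= in_itv/= xt andbT.
  rewrite ltr_pdivrMr// mulrC -ltr_pdivrMr//.
  have := archi_boundP (ltW (divr_gt0 t0 x0)).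
  by move=> xb; rewrite (lt_le_trans xb)// ler_nat -addn2 leq_addr.
have mE (A : set R) : measurable A -> measurable_fun A (EFin \o ppow a).
  by move=> mA; apply/measurable_EFinP/measurable_funTS; exact: measurable_ppow.
have Fn0 n : 0 < t / n.+2%:R by rewrite divr_gt0.
have Fnt n : t / n.+2%:R < t by rewrite ltr_pdivrMr// ltr_pMr// ltr1n.
have := @ge0_nondecreasing_set_cvg_integral _ (measurableTypeR R) R F (EFin \o ppow a) leb.
rewrite FU => cvg1.
have {}cvg1 : (\int[leb]_(x in F i) (EFin \o ppow a) x @[i --> \oo] -->
    \int[leb]_(x in `]0%R, t]) (EFin \o ppow a) x)%E.
  apply: cvg1.
  - apply/nondecreasing_seqP => n; rewrite subsetEset => x.
    rewrite /F/= !in_itv/= => /andP[xn ->]; rewrite andbT.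
    apply: le_lt_trans xn; rewrite ler_pM2l// lef_pV2 ?posrE// ler_nat; exact: leqnSn.
  - by move=> i; exact: measurable_itv.
  - by move=> i; apply: mE; exact: measurable_itv.
  - by move=> i x _; rewrite lee_fin ppow_ge0.
have FE n : (\int[leb]_(x in F n) (EFin \o ppow a) x =
    ((t `^ a - (t / n.+2%:R) `^ a) / a)%R%:E)%E.
  rewrite /F integral_itv_obnd_cbnd; last by apply: mE; exact: measurable_itv.
  rewrite mulrBl EFinB.
  rewrite -(@continuous_FTC2 R (fun x => x `^ (a - 1)) (fun x => x `^ a / a))//.
  - apply: eq_integral => x; rewrite inE/= in_itv/= => /andP[xn _].
    by rewrite /ppow (lt_le_trans _ xn).
  - apply: derivable_within_continuous => x; rewrite in_itv/= => /andP[xn _].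
    apply: derivable_powR; rewrite in_itv/= andbT.
    exact: lt_le_trans xn.
  - have dF x : 0 < x -> derivable (fun x : R => x `^ a / a) x 1.
      move=> x0; apply: derivableM => //.
      by apply: derivable_powR; rewrite in_itv/= andbT.
    have cF x : 0 < x -> {for x, continuous (fun x : R => x `^ a / a)}.
      by move=> x0; apply: differentiable_continuous; apply/derivable1_diffP/dF.
    split.
    + by move=> x; rewrite in_itv/= => /andP[xn _]; apply: dF; exact: lt_trans xn.
    + by apply/cvg_at_right_filter; exact: cF.
    + by apply/cvg_at_left_filter; exact: cF.
  - move=> x; rewrite in_itv/= => /andP[xn _].
    have x0 : 0 < x by exact: lt_trans xn.
    rewrite derive1Mr; last by apply: derivable_powR; rewrite in_itv/= andbT.
    rewrite powR_derive1 ?in_itv/= ?andbT//.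
    by field; exact: lt0r_neq0.
rewrite (_ : (fun i => _) = (fun n => ((t `^ a - (t / n.+2%:R) `^ a) / a)%:E)) in cvg1; last first.
  exact/funext.
apply/esym; apply: (cvg_unique _ _ cvg1) => //=.
apply: cvg_EFin; first exact: nearW.
have -> : t `^ a / a = (t `^ a - 0) / a by rewrite subr0.
apply: cvgM; last exact: cvg_cst.
apply: cvgB; first exact: cvg_cst.
apply: (cvg_at_rightP (fun x : R => x `^ a) 0 0).1; first exact: powR_cvg0.
split=> [n|]; first exact: Fn0.
rewrite -[X in _ --> X](mulr0 t); apply: cvgM; first exact: cvg_cst.
have := @cvg_harmonic R; rewrite -cvg_shiftS; exact.
Qed.

End PowerIntegral.

Section GammaBeta.
Context {R : realType}.
Local Notation leb := (@lebesgue_measure R).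

(** The [Rintegral] defining [Gamma] would hide an infinite value behind 0; the extended-real
    integral is kept until positivity and finiteness are known. *)
Let gint (a : R) : \bar R := (\int[leb]_t (ppow a t * expR (- t))%:E)%E.

Lemma measurable_gamma_integrand (a : R) :
  measurable_fun setT (fun t : R => ppow a t * expR (- t)).
Proof.
apply: measurable_funM; first exact: measurable_ppow.
by apply: measurableT_comp => //; exact: measurable_expR.
Qed.

Let gamma_integrand_ge0 (a t : R) : 0 <= ppow a t * expR (- t).
Proof. by rewrite mulr_ge0 ?ppow_ge0 ?expR_ge0. Qed.

Let gint_gt0 (a : R) : 0 < a -> (0 < gint a)%E.
Proof.
move=> a0.
apply: (@lt_le_trans _ _ (\int[leb]_(t in `]0%R, 1%R]) ((expR (- 1))%:E * (ppow a t)%:E))%E).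
  rewrite ge0_integralZl_EFin//; last 2 first.
  - by move=> x _; rewrite lee_fin ppow_ge0.
  - by apply/measurable_EFinP/measurable_funTS; exact: measurable_ppow.
  by rewrite integral_ppow// -EFinM lte_fin mulr_gt0 ?expR_gt0// divr_gt0 ?powR_gt0.
apply: (@le_trans _ _ (\int[leb]_(t in `]0%R, 1%R]) (ppow a t * expR (- t))%:E)%E).
  apply: ge0_le_integral => //.
  - by move=> x _; rewrite mule_ge0 ?lee_fin ?expR_ge0 ?ppow_ge0.
  - apply/measurable_EFinP/measurable_funTS; apply: measurable_funM => //.
    exact: measurable_ppow.
  - by apply/measurable_EFinP/measurable_funTS; exact: measurable_gamma_integrand.
  - move=> x; rewrite /= in_itv/= => /andP[_ x1].
    by rewrite -EFinM lee_fin mulrC ler_wpM2l ?ppow_ge0// ler_expR lerN2.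
apply: ge0_subset_integral => //.
  by apply/measurable_EFinP; exact: measurable_gamma_integrand.
by move=> x _; rewrite lee_fin.
Qed.

(** A Taylor term of exp(t/2) dominates any power of t, at the cost of half of the decay; the
    remaining factor exp(-t/2) stays integrable. *)
Lemma powR_expR_le (a : R) : 0 < a -> exists2 C : R, 0 <= C &
  forall t, 1 <= t -> t `^ (a - 1) * expR (- t) <= C * expR (- 2^-1 * t).
Proof.
move=> a0; pose n := Num.bound a.
exists (2 ^+ n.+1 * (n.+1)`!%:R) => [|t t1]; first by rewrite mulr_ge0 ?exprn_ge0.
have t0 : 0 <= t by exact: le_trans t1.
have tn : t `^ (a - 1) <= t ^+ n.+1.
  rewrite -(powR_mulrn _ t0); apply: ler_powR => //.
  rewrite lerBlDr -natr1.
  have /ltW an := archi_boundP (ltW a0).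
  by rewrite -addrA (le_trans an)// lerDl.
have te : t ^+ n.+1 <= 2 ^+ n.+1 * (n.+1)`!%:R * expR (2^-1 * t).
  have h1 : 1 + (2^-1 * t) ^+ n.+1 / n.+1`!%:R <= expR (2^-1 * t).
    by apply: expR_ge1Dxn; rewrite mulr_ge0.
  have : (2^-1 * t) ^+ n.+1 / n.+1`!%:R <= expR (2^-1 * t).
    by apply: le_trans h1; rewrite lerDr.
  rewrite ler_pdivrMr ?ltr0n ?fact_gt0// exprMn exprVn ler_pdivrMl ?exprn_gt0//.
  by move=> /le_trans; apply; rewrite [leRHS]mulrAC -mulrA.
apply: (@le_trans _ _ (2 ^+ n.+1 * (n.+1)`!%:R * expR (2^-1 * t) * expR (- t))).
  by rewrite ler_wpM2r ?expR_ge0// (le_trans tn).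
rewrite -mulrA -expRD; apply: ler_wpM2l; first by rewrite mulr_ge0 ?exprn_ge0.
by rewrite ler_expR; lra.
Qed.

Let gint_lty (a : R) : 0 < a -> (gint a < +oo)%E.
Proof.
move=> a0.
have [C C0 CP] := powR_expR_le a0.
(* Up to 1 the power dominates, beyond 1 the exponential does; 2 C undoes the factor 1/2 in the
   exponential density of rate 1/2. *)
pose h (t : R) := (ppow a \_ `]0%R, 1%R]) t + (2 * C) * exponential_pdf (2^-1) t.
have half0 : (0 : R) < 2^-1 by rewrite invr_gt0.
have pdf0 t : 0 <= 2 * C * exponential_pdf (2^-1) t.
  by apply: mulr_ge0; [exact: mulr_ge0|exact/exponential_pdf_ge0/ltW].
have h0 t : 0 <= h t.
  by rewrite addr_ge0// patchE; case: ifP => // _; exact: ppow_ge0.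
have mppow1 : measurable_fun setT (ppow a \_ `]0%R, 1%R]).
  apply/(measurable_restrictT _ _).1 => //.
  by apply: measurable_funTS; exact: measurable_ppow.
apply: (@le_lt_trans _ _ (\int[leb]_t (h t)%:E)%E).
  apply: ge0_le_integral => //.
  - by move=> x _; rewrite lee_fin.
  - by apply/measurable_EFinP; exact: measurable_gamma_integrand.
  - apply/measurable_EFinP; apply: measurable_funD => //.
    by apply: measurable_funM => //; exact: measurable_exponential_pdf.
  - move=> t _; rewrite lee_fin /h.
    have [t0|t0] := ltP 0 t; last first.
      by rewrite {1}/ppow ltNge t0/= mul0r; exact: h0.
    have [t1|t1] := leP t 1.
      rewrite patchE mem_set/=; last by rewrite in_itv/= t0.
      rewrite -[X in X <= _]addr0 lerD//.
        by rewrite ler_piMr ?ppow_ge0// -[leRHS]expR0 ler_expR oppr_le0 ltW.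
    rewrite patchE memNset/=; last by rewrite in_itv/= t0/= leNgt t1.
    rewrite add0r /exponential_pdf patchE mem_set/=; last first.
      by rewrite in_itv/= andbT ltW.
    rewrite [X in _ <= X](_ : _ = C * expR (- 2^-1 * t)); last by field.
    by rewrite /ppow t0; apply: CP; exact: ltW.
rewrite /h; under eq_integral do rewrite EFinD.
rewrite ge0_integralD//; last 4 first.
- by move=> x _; rewrite lee_fin patchE; case: ifP => // _; exact: ppow_ge0.
- exact/measurable_EFinP.
- by move=> x _; rewrite lee_fin pdf0.
- apply/measurable_EFinP; apply: measurable_funM => //.
  exact: measurable_exponential_pdf.
rewrite lte_add_pinfty//.
  rewrite [X in (X < _)%E](_ : _ = \int[leb]_(s in `]0%R, 1%R]) (ppow a s)%:E)%E; last first.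
    rewrite [RHS]integral_mkcond; apply: eq_integral => x _.
    by rewrite restrict_EFin.
  by rewrite integral_ppow// ltry.
under eq_integral do rewrite EFinM.
rewrite ge0_integralZl_EFin//; last 3 first.
- by move=> x _; rewrite lee_fin; exact/exponential_pdf_ge0/ltW.
- by apply/measurable_EFinP; exact: measurable_exponential_pdf.
- by rewrite mulr_ge0.
by rewrite integral_exponential_pdf// mule1 ltry.
Qed.

Lemma integral_gamma (a : R) : 0 < a ->
  (\int[leb]_t (ppow a t * expR (- t))%:E = (Gamma a)%:E)%E.
Proof.
move=> a0; rewrite /Gamma /Rintegral.
have -> : (\int[leb]_(t in `]0%R, +oo[) (t `^ (a - 1) * expR (- t))%:E = gint a)%E.
  rewrite integral_mkcond; apply: eq_integral => t _.
  rewrite patchE /ppow; case: ifPn => [|]; rewrite ?(inE, notin_setE)/= in_itv/= andbT.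
    by move=> ->.
  by move=> /negP/negbTE ->; rewrite mul0r.
by rewrite fineK// ge0_fin_numE ?gint_lty// ltW// gint_gt0.
Qed.

Lemma Gamma_gt0 (a : R) : 0 < a -> 0 < Gamma a.
Proof. by move=> a0; rewrite -lte_fin -integral_gamma// gint_gt0. Qed.

Let bint (a b : R) : \bar R := (\int[leb]_u (ppow a u * ppow b (1 - u))%:E)%E.

Lemma measurable_ppow_sub (a t : R) : measurable_fun setT (fun s : R => ppow a (t - s)).
Proof.
apply: measurableT_comp; first exact: measurable_ppow.
exact: measurable_funB.
Qed.

Lemma measurable_ppow_conv (a b t : R) :
  measurable_fun setT (fun s : R => ppow a s * ppow b (t - s)).
Proof.
apply: measurable_funM; first exact: measurable_ppow.
exact: measurable_ppow_sub.
Qed.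

(** The substitution s = t u pulls out the powers of t, and the exponents (a - 1) + (b - 1) + 1 add
    up to a + b - 1. For t <= 0 no s makes both factors positive. *)
Let integral_ppow_conv0 (a b t : R) :
  (\int[leb]_s (ppow a s * ppow b (t - s))%:E = (ppow (a + b) t)%:E * bint a b)%E.
Proof.
have [t0|t0] := ltP 0 t; last first.
  rewrite /ppow (ltNge 0 t) t0 mul0e; apply: integral0_eq => s _.
  case: ifPn => s0; rewrite ?mul0r// ifF ?mulr0//.
  by apply/negbTE; rewrite -leNgt subr_le0 (le_trans t0)// ltW.
rewrite [LHS](@ge0_integral_affine R _ t 0 t0); last 2 first.
- by apply/measurable_EFinP; exact: measurable_ppow_conv.
- by move=> s; rewrite lee_fin mulr_ge0 ?ppow_ge0.
transitivity (t%:E * \int[leb]_s ((t `^ (a - 1) * t `^ (b - 1))%:E *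
    (ppow a s * ppow b (1 - s))%:E))%E.
  congr (_ * _)%E; apply: eq_integral => s _; rewrite addr0 -EFinM; congr EFin.
  have -> : t - t * s = t * (1 - s) by ring.
  by rewrite !ppowM//; ring.
rewrite ge0_integralZl_EFin//; last 3 first.
- by move=> s _; rewrite lee_fin mulr_ge0 ?ppow_ge0.
- by apply/measurable_EFinP; exact: measurable_ppow_conv.
- by rewrite mulr_ge0 ?powR_ge0.
rewrite muleA -EFinM; congr (_%:E * _)%E.
rewrite /ppow t0 -powRD; last by rewrite (gt_eqF t0) implybT.
rewrite -{1}(powRr1 (ltW t0)) -powRD; last by rewrite (gt_eqF t0) implybT.
by congr (_ `^ _); ring.
Qed.

(** In the product of two Gamma integrals the sum w of both variables replaces the second one; by
    Tonelli the inner integral becomes a convolution of powers, already reduced to a Beta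
    integral. *)
Let gamma_beta (a b : R) : (gint a * gint b = gint (a + b) * bint a b)%E.
Proof.
have g0 (c t : R) : (0 <= (ppow c t * expR (- t))%:E)%E by rewrite lee_fin.
have mg (c : R) : measurable_fun setT (fun t : R => (ppow c t * expR (- t))%:E).
  by apply/measurable_EFinP; exact: measurable_gamma_integrand.
have i0 (c : R) : (0 <= gint c)%E by apply: integral_ge0.
transitivity (\int[leb]_s \int[leb]_w
   (ppow a s * ppow b (w - s) * expR (- w))%:E)%E.
  rewrite {1}/gint -ge0_integralZr//; last exact: mg.
  apply: eq_integral => s _; rewrite /gint.
  rewrite -ge0_integralZl_EFin//; last exact: mg.
  rewrite [LHS](@ge0_integral_shift R _ (- s))//; last 2 first.
  - by apply: measurable_funeM; exact: mg.
  - by move=> t; rewrite mule_ge0 ?lee_fin.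
  apply: eq_integral => w _; rewrite -EFinM; congr EFin.
  have -> : expR (- w) = expR (- s) * expR (- (w - s)).
    by rewrite -expRD; congr expR; ring.
  ring.
rewrite (@fubini_tonelli _ _ _ _ R leb leb (fun z : measurableTypeR R * measurableTypeR R =>
   (ppow a z.1 * ppow b (z.2 - z.1) * expR (- z.2))%:E))/=; last 2 first.
- apply/measurable_EFinP; apply: measurable_funM.
    apply: measurable_funM.
      by apply: measurableT_comp; [exact: measurable_ppow|exact: measurable_fst].
    apply: measurableT_comp; first exact: measurable_ppow.
    by apply: measurable_funB; [exact: measurable_snd|exact: measurable_fst].
  apply: measurableT_comp; first exact: measurable_expR.
  by apply: measurableT_comp; [exact: oppr_measurable|exact: measurable_snd].
- by move=> z; rewrite lee_fin !mulr_ge0 ?ppow_ge0 ?expR_ge0.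
transitivity (\int[leb]_w ((ppow (a + b) w * expR (- w))%:E * bint a b))%E.
  apply: eq_integral => w _.
  rewrite EFinM muleAC -integral_ppow_conv0 muleC -ge0_integralZl_EFin//; last 2 first.
  - by move=> s _; rewrite lee_fin mulr_ge0 ?ppow_ge0.
  - by apply/measurable_EFinP; exact: measurable_ppow_conv.
  by apply: eq_integral => s _; rewrite -EFinM mulrC.
rewrite ge0_integralZr//; first exact: mg.
by apply: integral_ge0 => u _; rewrite lee_fin mulr_ge0 ?ppow_ge0.
Qed.

Lemma integral_beta (a b : R) : 0 < a -> 0 < b ->
  (\int[leb]_u (ppow a u * ppow b (1 - u))%:E =
   (Gamma a * Gamma b / Gamma (a + b))%:E)%E.
Proof.
move=> a0 b0; have := gamma_beta a b.
rewrite /gint !integral_gamma ?addr_gt0// -/(bint a b).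
have b_ge0 : (0 <= bint a b)%E.
  by apply: integral_ge0 => u _; rewrite lee_fin mulr_ge0 ?ppow_ge0.
have G0 : 0 < Gamma (a + b) by rewrite Gamma_gt0 ?addr_gt0.
case: (bint a b) b_ge0 => [x|_|//]; last first.
  by rewrite gt0_muley ?lte_fin.
by move=> _ [] ->; congr EFin; field; exact: lt0r_neq0.
Qed.

Lemma integral_ppow_conv (a b t : R) : 0 < a -> 0 < b ->
  (\int[leb]_s (ppow a s * ppow b (t - s))%:E =
   (ppow (a + b) t * (Gamma a * Gamma b / Gamma (a + b)))%:E)%E.
Proof. by move=> a0 b0; rewrite integral_ppow_conv0 /bint integral_beta. Qed.

(** The recursion is read off from the Beta integral with b = 1, which equals 1/a by direct
    integration, and from Gamma 1 = 1; this replaces an integration by parts. *)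
Lemma GammaS (a : R) : 0 < a -> Gamma (a + 1) = a * Gamma a.
Proof.
move=> a0.
have G1 : Gamma 1 = 1 :> R.
  apply: EFin_inj; rewrite -integral_gamma//.
  rewrite -(@integral_exponential_pdf R 1)//.
  apply: ge0_ae_eq_integral => //.
  - by apply/measurable_EFinP; exact: measurable_gamma_integrand.
  - by apply/measurable_EFinP; exact: measurable_exponential_pdf.
  - by move=> x _; rewrite lee_fin.
  - by move=> x _; rewrite lee_fin exponential_pdf_ge0.
  (* The integrands differ at the origin alone, where [ppow] is cut off and the exponential density
     is 1. *)
  exists [set 0]; split => //; first exact: lebesgue_measure_set1.
  move=> x /=; apply: contra_notP => /eqP x0 _; congr EFin.
  rewrite /ppow /exponential_pdf patchE; case: ifPn => xp.
    by rewrite mem_set/= ?in_itv/= ?andbT ?ltW// subrr powRr0 mulN1r.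
  by rewrite memNset/= ?in_itv/= ?andbT ?mul0r// => x0'; move: xp; rewrite lt_neqAle eq_sym x0 x0'.
have := integral_beta a0 (ltr01 : 0 < 1 :> R).
have -> : (\int[leb]_u (ppow a u * ppow 1 (1 - u))%:E = a^-1%:E)%E.
  transitivity (\int[leb]_(u in `]0%R, 1%R[) (ppow a u)%:E)%E.
    rewrite [RHS]integral_mkcond; apply: eq_integral => u _.
    rewrite patchE; case: ifPn; rewrite ?(inE, notin_setE)/= in_itv/=.
      by move=> /andP[u0 u1]; rewrite /ppow !u0 subr_gt0 u1 subrr powRr0 mulr1.
    move=> /negP; rewrite negb_and /ppow subr_gt0 => /orP[/negbTE ->|/negbTE ->].
      by rewrite mul0r.
    by rewrite mulr0.
  rewrite integral_itv_bndo_bndc; last first.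
    by apply/measurable_EFinP/measurable_funTS; exact: measurable_ppow.
  by rewrite integral_ppow// powR1 div1r.
rewrite G1 mulr1 => -[h].
have Ga := Gamma_gt0 a0; have Ga1 : 0 < Gamma (a + 1) by rewrite Gamma_gt0 ?addr_gt0.
have : a * Gamma (a + 1) * a^-1 = a * Gamma (a + 1) * (Gamma a / Gamma (a + 1)) by rewrite h.
by rewrite mulrAC mulfV ?lt0r_neq0// mul1r => ->; field; exact: lt0r_neq0.
Qed.

End GammaBeta.

Section BetaDensity.
Context {R : realType}.
Local Notation leb := (@lebesgue_measure R).

(* [beta_density] cut off outside the open interval (0, 1), so that it is a
   density on the whole line. *)
Definition bet (a b u : R) : R :=
  Gamma (a + b) / (Gamma a * Gamma b) * (ppow a u * ppow b (1 - u)).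

Lemma beta_densityE (a b u : R) : 0 < u < 1 -> beta_density a b u = bet a b u.
Proof.
move=> /andP[u0 u1]; rewrite /beta_density /bet /ppow u0 subr_gt0 u1.
by rewrite mulrA.
Qed.

Lemma bet_out (a b u : R) : ~~ (0 < u < 1) -> bet a b u = 0.
Proof.
rewrite negb_and /bet /ppow subr_gt0 => /orP[/negbTE->|/negbTE->];
  by rewrite ?(mul0r, mulr0).
Qed.

Lemma measurable_bet (a b : R) : measurable_fun setT (bet a b).
Proof. by apply: measurable_funM => //; exact: measurable_ppow_conv. Qed.

Section gt0.
Variables (a b : R).
Hypotheses (a0 : 0 < a) (b0 : 0 < b).

Lemma bet_ge0 (u : R) : 0 <= bet a b u.
Proof.
by rewrite /bet !mulr_ge0 ?ppow_ge0 ?invr_ge0 ?mulr_ge0// ltW// Gamma_gt0 ?addr_gt0.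
Qed.

Lemma integral_bet : (\int[leb]_u (bet a b u)%:E = 1)%E.
Proof.
have Gab : 0 < Gamma (a + b) by rewrite Gamma_gt0 ?addr_gt0.
have Ga := Gamma_gt0 a0; have Gb := Gamma_gt0 b0.
rewrite /bet; under eq_integral do rewrite EFinM.
rewrite ge0_integralZl_EFin//; last 3 first.
- by move=> u _; rewrite lee_fin mulr_ge0 ?ppow_ge0.
- by apply/measurable_EFinP; exact: measurable_ppow_conv.
- by rewrite divr_ge0// ?mulr_ge0//; exact: ltW.
rewrite integral_beta// -EFinM; congr EFin.
move: (Gamma (a + b)) (Gamma a) (Gamma b) Gab Ga Gb => x y z x0 y0 z0.
by field; rewrite !gt_eqF.
Qed.

(** Size-biasing: weighting by u shifts the first parameter by one. The Beta moments used later come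
    from iterating this identity. *)
Lemma betM (u : R) : bet a b u * u = a / (a + b) * bet (a + 1) b u.
Proof.
rewrite /bet; have -> : a + 1 + b = a + b + 1 by ring.
rewrite !GammaS ?addr_gt0//.
have Gab : 0 < Gamma (a + b) by rewrite Gamma_gt0 ?addr_gt0.
have Ga := Gamma_gt0 a0; have Gb := Gamma_gt0 b0.
have -> : ppow (a + 1) u = u * ppow a u.
  rewrite /ppow; case: ifPn => [u0|]; last by rewrite mulr0.
  by rewrite mulr_powRB1 ?ltW// addrK.
move: (Gamma (a + b)) (Gamma a) (Gamma b) Gab Ga Gb => x y z x0 y0 z0.
by field; rewrite !gt_eqF ?addr_gt0.
Qed.

End gt0.
End BetaDensity.

(** * Integration over the simplex and invariance under resampling *)

Section LebesgueTupleFubini.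
Context {R : realType}.
Local Notation leb := (@lebesgue_measure R).

Definition upd n (i : 'I_n) (v : R) (t : n.-tuple R) : n.-tuple R :=
  [tuple if j == i then v else tnth t j | j < n].

Lemma ge0_integral_lebesgue_cons n (G : n.+1.-tuple R -> \bar R) :
  measurable_fun setT G -> (forall t, 0 <= G t)%E ->
  (\int[lebesgue_tuple n.+1]_t G t =
   \int[(leb \x lebesgue_tuple n)%E]_p G (cons_pair p))%E.
Proof.
move=> mG G0 /=; rewrite /lebesgue_cons.
by rewrite ge0_integral_pushforward//; exact: measurable_cons_pair.
Qed.

Lemma measurable_cons_pair_comp n (G : n.+1.-tuple R -> \bar R) :
  measurable_fun setT G ->
  measurable_fun setT (fun p : measurableTypeR R * n.-tuple R => G (cons_pair p)).
Proof.
by move=> mG; apply: measurableT_comp => //; exact: measurable_cons_pair.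
Qed.

(** Tonelli's theorem with coordinate i integrated first; the induction peels off leading
    coordinates until coordinate i is at the head. *)
Lemma eq_integral_upd n (i : 'I_n) (G H : n.-tuple R -> \bar R) :
  measurable_fun setT G -> measurable_fun setT H ->
  (forall t, 0 <= G t)%E -> (forall t, 0 <= H t)%E ->
  (forall t, \int[leb]_v G (upd i v t) = \int[leb]_v H (upd i v t))%E ->
  (\int[lebesgue_tuple n]_t G t = \int[lebesgue_tuple n]_t H t)%E.
Proof.
elim: n => [|n IHn] in i G H * => mG mH G0 H0 GH; first by case: i GH.
rewrite !ge0_integral_lebesgue_cons//.
have mG' := measurable_cons_pair_comp mG.
have mH' := measurable_cons_pair_comp mH.
case: (unliftP ord0 i) => [j|] ij; subst i.
  rewrite !fubini_tonelli1//; apply: eq_integral => x _.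
  rewrite /fubini_F; apply: (IHn j).
  - exact: (measurableT_comp mG' (measurable_pair1 x)).
  - exact: (measurableT_comp mH' (measurable_pair1 x)).
  - by move=> t; exact: G0.
  - by move=> t; exact: H0.
  move=> t.
  have updE v : cons_pair (x, upd j v t) = upd (lift ord0 j) v (cons_pair (x, t)).
    apply: eq_from_tnth => k; rewrite tnth_mktuple.
    case: (unliftP ord0 k) => [k'|] ->.
      by rewrite /cons_pair/= !tnthS tnth_mktuple (inj_eq lift_inj).
    by rewrite /cons_pair /= tnth0.
  under eq_integral do rewrite updE.
  by under [RHS]eq_integral do rewrite updE.
rewrite !fubini_tonelli2//; apply: eq_integral => t _; rewrite /fubini_G.
have updE v : cons_pair (v, t) = upd ord0 v (cons_pair (0, t)).
  apply: eq_from_tnth => k; rewrite tnth_mktuple.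
  case: (unliftP ord0 k) => [k'|] ->.
    by rewrite /cons_pair/= !tnthS.
  by rewrite /cons_pair /= tnth0.
under eq_integral do rewrite updE.
by under [RHS]eq_integral do rewrite updE.
Qed.

End LebesgueTupleFubini.

(** * Integration against a density *)

Section DensityIntegral.
Context d (T : measurableType d) (R : realType).
Variables (m nu : {measure set T -> \bar R}) (g : T -> R).
Hypotheses (mg : measurable_fun setT g) (g0 : forall x, 0 <= g x).
Hypothesis nuE : forall A, measurable A ->
  (nu A = \int[m]_x ((\1_A x)%:E * (g x)%:E))%E.
Local Open Scope ereal_scope.

(** Simple-function approximation from the setwise formula [nuE]. It serves for the Dirichlet
    density, for the indicator of the simplex and for the normalizing constant. *)
Lemma ge0_integral_density (f : T -> \bar R) :
  measurable_fun setT f -> (forall x, 0 <= f x) ->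
  \int[nu]_x f x = \int[m]_x (f x * (g x)%:E).
Proof.
move=> mf f0.
pose f_ := nnsfun_approx measurableT mf.
transitivity (limn (fun n => \int[nu]_x (f_ n x)%:E)).
  rewrite -monotone_convergence//.
  - apply: eq_integral => y _; apply/esym/cvg_lim => //.
    by apply: cvg_nnsfun_approx => // *; exact: f0.
  - by move=> n; exact/measurable_EFinP.
  - by move=> n y _; rewrite lee_fin.
  - by move=> y _ k n kn; rewrite lee_fin; exact/lefP/nd_nnsfun_approx.
rewrite [X in limn X](_ : _ = (fun n => \int[m]_x ((f_ n x)%:E * (g x)%:E))).
  rewrite -monotone_convergence//; last 3 first.
  - by move=> n; apply: emeasurable_funM => //; exact/measurable_EFinP.
  - by move=> n x _; rewrite mule_ge0 ?lee_fin.
  - move=> x _ k n kn; apply: lee_wpmul2r; first by rewrite lee_fin.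
    by rewrite lee_fin; exact/lefP/nd_nnsfun_approx.
  apply: eq_integral => x _; apply/cvg_lim => //.
  have cf : (f_ n x)%:E @[n --> \oo] --> f x.
    by apply: cvg_nnsfun_approx => // y _; exact: f0.
  exact: cvgeZr.
apply/funext => n.
transitivity (\sum_(k \in range (f_ n)) \int[m]_x ((k * \1_(f_ n @^-1` [set k]) x)%:E * (g x)%:E)).
  under eq_integral do rewrite fimfunE -fsumEFin//.
  rewrite ge0_integral_fsum//; last 2 first.
  - by move=> y; exact/measurable_EFinP/measurable_funM.
  - by move=> y x _; rewrite nnfun_muleindic_ge0.
  apply: eq_fsbigr => r; rewrite inE => -[y _ <-].
  rewrite integralZl_indic_nnsfun// integral_indic//= setIT nuE//.
  under [RHS]eq_integral do rewrite EFinM -muleA.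
  rewrite ge0_integralZl_EFin//.
  - by move=> x _; rewrite mule_ge0 ?lee_fin.
  - by apply: emeasurable_funM => //; exact/measurable_EFinP.
rewrite -ge0_integral_fsum//.
- apply: eq_integral => x _.
  rewrite [in RHS]fimfunE -fsumEFin// ge0_mule_fsuml//.
  by move=> r; rewrite nnfun_muleindic_ge0.
- move=> r; apply: emeasurable_funM; apply/measurable_EFinP => //.
  exact: measurable_funM.
- by move=> k x _; rewrite mule_ge0 ?lee_fin// -lee_fin nnfun_muleindic_ge0.
Qed.

End DensityIntegral.

(** * Disintegration of the hyperplane measure along lines *)

Section LineIntegral.
Context {R : realType} {V : finType}.
Local Notation leb := (@lebesgue_measure R).
Local Notation N := #|V|.-1.
Hypothesis cardV : (2 <= #|V|)%N.
Implicit Types (eta : config R V) (x y z : V).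

Lemma config_ext eta eta' : (forall x, coord eta x = coord eta' x) -> eta = eta'.
Proof.
move=> h; apply: eq_from_tnth => i.
by have := h (enum_val i); rewrite /coord enum_valK.
Qed.

Lemma measurable_mkconfig d (T : measurableType d) (g : T -> V -> R) :
  (forall x, measurable_fun setT (g ^~ x)) ->
  measurable_fun setT (fun t => mkconfig (g t)).
Proof.
move=> mg; apply/measurable_fun_tnthP => i.
rewrite (_ : _ \o _ = g ^~ (enum_val i))//.
by apply/funext => t /=; rewrite tnth_mktuple.
Qed.

Definition move eta x y (v : R) : config R V :=
  mkconfig (fun z => if z == x then v
                     else if z == y then coord eta x + coord eta y - v
                     else coord eta z).

Lemma coord_move eta x y v z : coord (move eta x y v) z =
  if z == x then v else if z == y then coord eta x + coord eta y - v
  else coord eta z.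
Proof. exact: mkconfigE. Qed.

Lemma measurable_move eta x y : measurable_fun setT (move eta x y : R -> _).
Proof.
apply: measurable_mkconfig => z.
case: (z == x) => //; case: (z == y) => //.
exact: measurable_funB.
Qed.

Let N_gt0 : (0 < N)%N. Proof. by case: #|V| cardV => [|[|]]. Qed.

Let cardE : #|V| = N.+1. Proof. by rewrite prednK// (leq_trans _ cardV). Qed.

Let last_lt : (N < #|V|)%N. Proof. by rewrite cardE. Qed.

Definition lastv : V := enum_val (Ordinal last_lt).

Let lastvP z : (enum_rank z < N)%N = (z != lastv).
Proof.
rewrite -(inj_eq enum_rank_inj) /lastv enum_valK -val_eqE/= ltn_neqAle.
by have := ltn_ord (enum_rank z); rewrite {2}cardE ltnS => ->; rewrite andbT.
Qed.

(** Index of x among the free coordinates of [hyperplane_point]. At [lastv], which is not free, the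
    value is the default 0. *)
Definition rk x : 'I_N := insubd (Ordinal N_gt0) (val (enum_rank x)).

Let rkE x : x != lastv -> rk x = enum_rank x :> nat.
Proof. by move=> xl; rewrite /rk val_insubd lastvP xl. Qed.

Lemma coord_hp (t : N.-tuple R) x : coord (hyperplane_point t : config R V) x =
  if x == lastv then 1 - \sum_(i < N) tnth t i else tnth t (rk x).
Proof.
rewrite /hyperplane_point mkconfigE nth_rcons size_tuple lastvP.
have [->|xl] := eqVneq x lastv; rewrite /=.
  by rewrite /lastv enum_valK eqxx big_tuple.
by rewrite (tnth_nth 0) rkE.
Qed.

Lemma hp_upd (t : N.-tuple R) x v : x != lastv ->
  hyperplane_point (upd (rk x) v t) = move (hyperplane_point t) x lastv v.
Proof.
move=> xl; apply: config_ext => z; rewrite coord_move !coord_hp eqxx (negbTE xl).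
have [->|zl] := eqVneq z lastv.
  rewrite eq_sym (negbTE xl) (bigD1 (rk x))//= tnth_mktuple eqxx.
  rewrite [in RHS](bigD1 (rk x))//=.
  under eq_bigr => i /negbTE ix do rewrite tnth_mktuple ix.
  ring.
rewrite tnth_mktuple; have [->|zx] := eqVneq z x; first by rewrite eqxx.
rewrite ifF//; apply/negbTE; apply: contra zx => /eqP.
move=> /(congr1 val)/=; rewrite !rkE// => h.
by apply/eqP/enum_rank_inj/val_inj.
Qed.

Let I (G : config R V -> \bar R) := (\int[lebesgue_tuple N]_t G (hyperplane_point t))%E.

Let mI (G : config R V -> \bar R) : measurable_fun setT G ->
  measurable_fun setT (fun t : N.-tuple R => G (hyperplane_point t)).
Proof. by move=> mG; apply: measurableT_comp => //; exact: measurable_hyperplane_point. Qed.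

Let line_last x (G H : config R V -> \bar R) : x != lastv ->
  measurable_fun setT G -> measurable_fun setT H ->
  (forall eta, 0 <= G eta)%E -> (forall eta, 0 <= H eta)%E ->
  (forall eta, \int[leb]_v G (move eta x lastv v) =
               \int[leb]_v H (move eta x lastv v))%E -> I G = I H.
Proof.
move=> xl mG mH G0 H0 GH; apply: (eq_integral_upd (i := rk x)) => //; [exact: mI|exact: mI|].
move=> t; under eq_integral do rewrite hp_upd//.
by under [RHS]eq_integral do rewrite hp_upd//.
Qed.

Lemma moveC eta x y v : x != y ->
  move eta x y (coord eta x + coord eta y - v) = move eta y x v.
Proof.
move=> xy; apply: config_ext => z; rewrite !coord_move.
have [->|zx] := eqVneq z x; first by rewrite (negbTE xy) [coord eta y + _]addrC.
by case: eqVneq => // _; rewrite subKr.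
Qed.

Lemma integral_moveC (G : config R V -> \bar R) eta x y : x != y ->
  measurable_fun setT G -> (forall eta, 0 <= G eta)%E ->
  (\int[leb]_v G (move eta x y v) = \int[leb]_v G (move eta y x v))%E.
Proof.
move=> xy mG G0.
rewrite (@ge0_integral_reflect R _ (coord eta x + coord eta y))//; last first.
  by apply: measurableT_comp => //; exact: measurable_move.
by under eq_integral do rewrite moveC//.
Qed.

Definition swap y z eta : config R V := mkconfig (fun w => coord eta (tperm y z w)).

Lemma measurable_swap y z : measurable_fun setT (swap y z).
Proof. by apply: measurable_mkconfig => w; exact: measurable_coord. Qed.

(** Exchanging the coordinates y and [lastv] acts as a reflection on each line along which only
    these two vary, and Lebesgue measure on the line is invariant under it. *)
Let I_swap y (G : config R V -> \bar R) : y != lastv ->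
  measurable_fun setT G -> (forall eta, 0 <= G eta)%E ->
  I G = I (G \o swap y lastv).
Proof.
move=> yl mG G0; apply: (line_last yl) => //=.
  by apply: measurableT_comp => //; exact: measurable_swap.
move=> eta; rewrite integral_moveC//; apply: eq_integral => v _ /=; congr G.
apply: config_ext => z; rewrite [RHS]mkconfigE !coord_move.
have [->|zl] := eqVneq z lastv; first by rewrite tpermR eqxx.
have [->|zy] := eqVneq z y.
  by rewrite tpermL (eq_sym lastv y) (negbTE yl) eqxx [coord eta y + _]addrC.
have -> : tperm y lastv z = z by apply: tpermD; rewrite eq_sym.
by rewrite (negbTE zl) (negbTE zy).
Qed.

(** Only lines that trade mass with [lastv] are coordinate lines of the parametrization; other
    directions are brought there by the invariance of the hyperplane measure under swapping y with
    [lastv]. *)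
Lemma eq_integral_line x y (G H : config R V -> \bar R) : x != y ->
  measurable_fun setT G -> measurable_fun setT H ->
  (forall eta, 0 <= G eta)%E -> (forall eta, 0 <= H eta)%E ->
  (forall eta, \int[leb]_v G (move eta x y v) = \int[leb]_v H (move eta x y v))%E ->
  (\int[lebesgue_tuple N]_t G (hyperplane_point t) =
   \int[lebesgue_tuple N]_t H (hyperplane_point t))%E.
Proof.
move=> xy mG mH G0 H0 GH.
have [yl|yl] := eqVneq y lastv.
  by apply: (@line_last x) => //; rewrite -yl.
have [xl|xl] := eqVneq x lastv.
  apply: (@line_last y) => // eta; rewrite -xl.
  by rewrite integral_moveC 1?eq_sym// GH integral_moveC.
rewrite -!/(I _) (I_swap yl)// [RHS](I_swap yl)//.
have ms := measurable_swap y lastv.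
apply: (line_last xl) => //=; try exact: measurableT_comp.
move=> eta.
have swE v : swap y lastv (move eta x lastv v) = move (swap y lastv eta) x y v.
  have txE : tperm y lastv x = x by apply: tpermD; rewrite eq_sym.
  apply: config_ext => z; rewrite mkconfigE !coord_move !mkconfigE tpermL txE.
  have [->|zx] := eqVneq z x; first by rewrite txE eqxx.
  have [->|zy] := eqVneq z y; first by rewrite tpermL eqxx eq_sym (negbTE xl).
  have [->|zl] := eqVneq z lastv.
    by rewrite tpermR (eq_sym y x) (negbTE xy) (negbTE yl).
  have -> : tperm y lastv z = z by apply: tpermD; rewrite eq_sym.
  by rewrite (negbTE zx) (negbTE zl).
under eq_integral do rewrite swE.
by under [RHS]eq_integral do rewrite swE.
Qed.

End LineIntegral.

(** * The Dirichlet integral *)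

Section IteratedBeta.
Context {R : realType}.
Local Notation leb := (@lebesgue_measure R).

(** Iterated Beta convolutions. The total [sigma] is left free because fixing the first coordinate s
    leaves the total sigma - s to the others, and the induction needs a constant that does not
    depend on it. *)
Lemma integral_prod_ppow n (a : nat -> R) (b : R) : (forall i, 0 < a i) -> 0 < b ->
  exists2 C : R, 0 < C & forall sigma : R,
  (\int[lebesgue_tuple n]_t ((\prod_(i < n) ppow (a i) (tnth t i)) *
      ppow b (sigma - \sum_(i < n) tnth t i))%:E =
   (ppow (\sum_(i < n) a i + b) sigma * C)%:E)%E.
Proof.
have mt m (c : nat -> R) (s : R) : measurable_fun setT (fun t : m.-tuple R =>
    ((\prod_(i < m) ppow (c i) (tnth t i)) * ppow b (s - \sum_(i < m) tnth t i))%:E).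
  apply/measurable_EFinP/measurable_funM.
    apply: measurable_prod => i _.
    by apply: measurableT_comp (measurable_tnth i); exact: measurable_ppow.
  apply: measurableT_comp; first exact: measurable_ppow.
  by apply: measurable_funB => //; apply: measurable_sum => i; exact: measurable_tnth.
have p0 m (c : nat -> R) (s : R) (t : m.-tuple R) : (0 <=
    ((\prod_(i < m) ppow (c i) (tnth t i)) * ppow b (s - \sum_(i < m) tnth t i))%:E)%E.
  by rewrite lee_fin mulr_ge0 ?ppow_ge0 ?prodr_ge0// => i _; exact: ppow_ge0.
elim: n a => [|n IHn] a a0 b0.
  exists 1 => // sigma; rewrite [LHS]integral_dirac//; last exact: mt.
  rewrite [X in (X * _)%E](_ : _ = 1%E); last exact: diracT.
  rewrite mul1e; congr EFin.
  by rewrite !big_ord0 subr0 add0r mulr1 mul1r.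
have [C C0 hC] := IHn (a \o S) (fun i => a0 _) b0.
pose B := \sum_(i < n) a i.+1 + b.
have B0 : 0 < B by rewrite ltr_wpDl// sumr_ge0// => i _; exact: ltW.
exists (Gamma (a 0) * Gamma B / Gamma (a 0 + B) * C).
  have GB c : 0 < c -> 0 < @Gamma R c by exact: Gamma_gt0.
  apply: mulr_gt0 => //; apply: divr_gt0; last by apply/GB/addr_gt0.
  by apply: mulr_gt0; exact: GB.
move=> sigma.
rewrite ge0_integral_lebesgue_cons//.
rewrite fubini_tonelli1//; last exact: (measurable_cons_pair_comp (mt _ _ _)).
transitivity (\int[leb]_s ((ppow (a 0) s * ppow B (sigma - s)) * C)%:E)%E.
  apply: eq_integral => s _; rewrite /fubini_F.
  transitivity (\int[lebesgue_tuple n]_t ((ppow (a 0) s)%:E *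
      ((\prod_(i < n) ppow ((a \o S) i) (tnth t i)) *
      ppow b ((sigma - s) - \sum_(i < n) tnth t i))%:E))%E.
    apply: eq_integral => t _; rewrite -EFinM; congr EFin.
    rewrite !big_ord_recl /cons_pair/= tnth0.
    under eq_bigr do rewrite tnthS.
    under [X in ppow b (sigma - (s + X))]eq_bigr do rewrite tnthS.
    by rewrite mulrA opprD addrA.
  rewrite ge0_integralZl_EFin//; last 2 first.
  - exact: (mt n (a \o S)).
  - exact: ppow_ge0.
  by rewrite hC -EFinM mulrA.
under eq_integral do rewrite EFinM.
rewrite ge0_integralZr//; last 3 first.
- by apply/measurable_EFinP; exact: measurable_ppow_conv.
- by move=> s _; rewrite lee_fin mulr_ge0 ?ppow_ge0.
- by rewrite lee_fin ltW.
rewrite integral_ppow_conv// -EFinM big_ord_recl/=; congr EFin.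
by rewrite -[X in _ = ppow X _ * _]addrA; exact: (esym (mulrA _ _ _)).
Qed.

End IteratedBeta.

Section DirichletIntegral.
Context {R : realType} {V : finType} (alpha : V -> R).
Hypotheses (cardV : (2 <= #|V|)%N) (alpha_gt0 : forall x, 0 < alpha x).
Local Notation leb := (@lebesgue_measure R).
Local Notation N := #|V|.-1.
Local Notation mu := (dirichlet alpha).
Implicit Types (eta : config R V) (x y z : V).

(** The Dirichlet density with its indicator built in: a coordinate that is not positive makes the
    product vanish. On the simplex it can differ from the density only on the faces. *)
Definition pweight eta : R := \prod_x ppow (alpha x) (coord eta x).

Lemma pweight_ge0 eta : 0 <= pweight eta.
Proof. by rewrite prodr_ge0// => x _; exact: ppow_ge0. Qed.

Lemma measurable_pweight : measurable_fun setT pweight.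
Proof.
apply: measurable_prod => x _.
by apply: measurableT_comp (measurable_coord x); exact: measurable_ppow.
Qed.

Let hp : N.-tuple R -> config R V := hyperplane_point.

Let cardE : N.+1 = #|V|. Proof. by rewrite prednK// (leq_trans _ cardV). Qed.

Let vtx (i : 'I_N.+1) : V := enum_val (cast_ord cardE i).

Let vtx_bij : bijective vtx.
Proof.
exists (fun x => cast_ord (esym cardE) (enum_rank x)) => [i|x].
  by rewrite /vtx enum_valK cast_ordK.
by rewrite /vtx cast_ordKV enum_rankK.
Qed.

Let coord_hp_vtx (t : N.-tuple R) (i : 'I_N) :
  coord (hp t) (vtx (widen_ord (leqnSn N) i)) = tnth t i.
Proof.
by rewrite /hp mkconfigE /vtx enum_valK nth_rcons size_tuple/= ltn_ord (tnth_nth 0).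
Qed.

Let coord_hp_max (t : N.-tuple R) :
  coord (hp t) (vtx ord_max) = 1 - \sum_(i < N) tnth t i.
Proof.
by rewrite /hp mkconfigE /vtx enum_valK nth_rcons size_tuple/= ltnn eqxx big_tuple.
Qed.

Lemma sum_hp (t : N.-tuple R) : \sum_x coord (hp t) x = 1.
Proof.
rewrite (reindex vtx)/=; last exact: onW_bij.
rewrite big_ord_recr/= coord_hp_max.
under eq_bigr do rewrite coord_hp_vtx.
by rewrite addrC subrK.
Qed.

Let pweight_hp (t : N.-tuple R) : pweight (hp t) =
  \prod_(i < N) ppow (alpha (vtx (widen_ord (leqnSn N) i))) (tnth t i) *
  ppow (alpha (vtx ord_max)) (1 - \sum_(i < N) tnth t i).
Proof.
rewrite /pweight (reindex vtx)/=; last exact: onW_bij.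
rewrite big_ord_recr/= coord_hp_max.
by under eq_bigr do rewrite coord_hp_vtx.
Qed.

Lemma pweight_hp_mass : exists2 Z : R, 0 < Z &
  (\int[lebesgue_tuple N]_t (pweight (hp t))%:E = Z%:E)%E.
Proof.
(* [integral_prod_ppow] takes exponents indexed by all of nat; the default 1 beyond N keeps them
   positive. *)
pose a (i : nat) := oapp (fun j : 'I_N => alpha (vtx (widen_ord (leqnSn N) j))) 1 (insub i).
have a0 i : 0 < a i by rewrite /a; case: insub => //= j.
have [C C0 hC] := @integral_prod_ppow R N a (alpha (vtx ord_max)) a0 (alpha_gt0 _).
exists (ppow (\sum_(i < N) a i + alpha (vtx ord_max)) 1 * C).
  by rewrite /ppow ltr01 powR1 mul1r.
rewrite -hC; apply: eq_integral => t _; congr EFin; rewrite pweight_hp.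
by congr (_ * _); apply: eq_bigr => i _; rewrite /a valK.
Qed.

(** A line on which the coordinate at x is the parameter meets the face in a single point, so the
    face is null by the line version of Tonelli. *)
Lemma coord_hp_neq0 x : {ae lebesgue_tuple N, forall t, coord (hp t) x != 0}.
Proof.
have [y yx] : exists y, x != y.
  by move: cardV; rewrite (cardD1 x) inE => /card_gt0P[y]; rewrite !inE andbT eq_sym; exists y.
pose Z := [set eta : config R V | coord eta x = 0].
have mZ : measurable Z.
  rewrite -[X in measurable X]setTI.
  exact: (measurable_coord x measurableT (measurable_set1 0)).
have mhZ : measurable (hp @^-1` Z).
  by rewrite -[X in measurable X]setTI; exact: measurable_hyperplane_point.
exists (hp @^-1` Z); split => //; last first.
  by move=> t /= /negP; rewrite negbK => /eqP.
rewrite -[hp @^-1` Z]setIT -integral_indic//.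
transitivity (\int[lebesgue_tuple N]_(t in setT) (\1_Z (hyperplane_point t : config R V))%:E)%E.
  by apply: eq_integral => t _; rewrite !indicE.
rewrite (eq_integral_line cardV yx (G := fun eta => (\1_Z eta)%:E) (H := cst 0%E))//.
- by rewrite integral0.
- by apply/measurable_EFinP; exact: measurable_indic.
- move=> eta; rewrite integral0.
  transitivity (\int[leb]_v (\1_[set 0%R : measurableTypeR R] v)%:E)%E.
    apply: eq_integral => v _; rewrite !indicE; congr (nat_of_bool _)%:R%:E.
    by apply/idP/idP => /set_mem h; apply/mem_set; move: h; rewrite /Z/= coord_move eqxx.
  transitivity (leb (([set 0%R] : set (measurableTypeR R)) `&` setT)).
    exact: integral_indic.
  by rewrite setIT; exact: lebesgue_measure_set1.
Qed.

Lemma ge0_integral_dirichlet_weight (f : config R V -> \bar R) :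
  measurable_fun setT f -> (forall eta, 0 <= f eta)%E ->
  (\int[dirichlet_weight alpha]_eta f eta =
   \int[lebesgue_tuple N]_t (f (hp t) * (pweight (hp t))%:E))%E.
Proof.
move=> mf f0.
have md := measurable_dirichlet_density alpha.
have mh := @measurable_hyperplane_point R V.
have ms := @measurable_simplex R V.
have m1 : measurable_fun setT (\1_(@simplex R V) : config R V -> R).
  exact: measurable_indic.
have mfd : measurable_fun setT (fun eta => f eta * (dirichlet_density alpha eta)%:E)%E.
  by apply: emeasurable_funM => //; exact/measurable_EFinP.
have fd0 eta : (0 <= f eta * (dirichlet_density alpha eta)%:E)%E.
  by rewrite mule_ge0// dirichlet_density_ge0.
have mfd1 : measurable_fun setT (fun eta =>
    f eta * (dirichlet_density alpha eta)%:E * (\1_simplex eta)%:E)%E.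
  by apply: emeasurable_funM => //; exact/measurable_EFinP.
have fd10 eta : (0 <= f eta * (dirichlet_density alpha eta)%:E * (\1_simplex eta)%:E)%E.
  by rewrite mule_ge0// lee_fin.
rewrite (@ge0_integral_density _ _ _ uniform_simplex _ (dirichlet_density alpha))//; last 2 first.
- by move=> eta; exact: dirichlet_density_ge0.
- move=> A mA; rewrite /= /dirichlet_weight integral_mkcond.
  by apply: eq_integral => eta _; rewrite patchE indicE; case: ifP; rewrite (mul1e,mul0e).
rewrite (@ge0_integral_density _ _ _ hyperplane_measure _ (\1_simplex))//; last first.
- move=> A mA; rewrite /= /uniform_simplex/= /mrestr -[A `&` _]setIT -integral_indic//;
    last exact: measurableI.
  by apply: eq_integral => eta _; rewrite indicI -EFinM.
rewrite ge0_integral_pushforward//.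
rewrite preimage_setT; apply: ge0_ae_eq_integral => //.
- exact: (measurableT_comp mfd1 mh).
- apply: emeasurable_funM; first exact: (measurableT_comp mf mh).
  by apply/measurable_EFinP; exact: (measurableT_comp measurable_pweight mh).
- by move=> t _; exact: fd10.
- by move=> t _; rewrite mule_ge0// lee_fin pweight_ge0.
(* Off the faces, a point of the simplex has positive coordinates, where both weights agree. A point
   outside has a negative coordinate, since its sum is 1 by construction, and both weights
   vanish. *)
have : {ae lebesgue_tuple N, forall t, forall x, coord (hp t) x != 0}.
  by apply: filter_forall => x; exact: coord_hp_neq0.
apply: filterS => t tn0 _ /=; rewrite -muleA; congr (_ * _)%E; rewrite -EFinM; congr EFin.
rewrite indicE; case: (boolP (_ \in _)) => [/set_mem[c0 _]|ns].
  rewrite mulr1; apply: eq_bigr => x _; rewrite /ppow lt_neqAle eq_sym.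
  by rewrite [_ != 0]tn0 c0.
have [x cx] : exists x, ~~ (0 <= coord (hp t) x).
  apply/existsP; rewrite -negb_forall; apply: contra ns => /forallP c0.
  by apply/mem_set; split => //; exact: sum_hp.
rewrite mulr0 /pweight (bigD1 x)//= /ppow ifF ?mul0r//.
by apply/negbTE; apply: contra cx => /ltW.
Qed.

Lemma ge0_integral_dirichlet : exists2 Z : R, 0 < Z &
  forall f : config R V -> \bar R, measurable_fun setT f -> (forall eta, 0 <= f eta)%E ->
  (\int[mu]_eta f eta =
   \int[lebesgue_tuple N]_t (f (hp t) * (pweight (hp t))%:E) * Z%:E)%E.
Proof.
have [Z Z0 ZE] := pweight_hp_mass.
have mh := @measurable_hyperplane_point R V.
have wE : dirichlet_weight alpha setT = Z%:E.
  rewrite -[LHS]mul1e -integral_cst// ge0_integral_dirichlet_weight//.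
  by under eq_integral do rewrite mul1e.
exists Z^-1; first by rewrite invr_gt0.
move=> f mf f0; rewrite -ge0_integral_dirichlet_weight//.
rewrite (@ge0_integral_density _ _ _ (dirichlet_weight alpha) mu (cst Z^-1))//.
- by rewrite /cst ge0_integralZr// lee_fin invr_ge0 ltW.
- by move=> eta; rewrite invr_ge0 ltW.
- move=> A mA; rewrite /cst ge0_integralZr//; last 2 first.
  + by apply/measurable_EFinP; exact: measurable_indic.
  + by rewrite lee_fin invr_ge0 ltW.
  rewrite integral_indic// setIT /dirichlet/= /mnormalize.
  (* The mass is the positive real Z, so the default branch of [mnormalize] is excluded. *)
  case: ifPn => [/orP[/eqP h|/eqP h]|_].
  + by have /eqP := etrans (esym wE) h; rewrite eqe gt_eqF.
  + by have := etrans (esym wE) h.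
  + by congr (_ * _)%E; congr (_^-1)%:E; exact: (congr1 fine wE).
Qed.

End DirichletIntegral.

(** * Invariance of the Dirichlet distribution under resampling *)

Section Invariance.
Context {R : realType} {V : finType} (alpha : V -> R).
Hypotheses (cardV : (2 <= #|V|)%N) (alpha_gt0 : forall x, 0 < alpha x).
Local Notation leb := (@lebesgue_measure R).
Local Notation mu := (dirichlet alpha).
Implicit Types (eta : config R V) (x y z : V).

Lemma coord_exchange eta x y u z : coord (exchange eta x y u) z =
  if z == x then u * (coord eta x + coord eta y)
  else if z == y then (1 - u) * (coord eta x + coord eta y)
  else coord eta z.
Proof. exact: mkconfigE. Qed.

Lemma exchange_move eta x y u v : x != y ->
  exchange (move eta x y v) x y u = move eta x y (u * (coord eta x + coord eta y)).
Proof.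
move=> xy; apply: config_ext => z; rewrite coord_exchange !coord_move.
rewrite eqxx (eq_sym y x) (negbTE xy) eqxx.
case: eqVneq => // _; first by congr (_ * _); ring.
by case: eqVneq => // _; ring.
Qed.

(** An exchange depends on the coordinates at x and y only through their sum, which exchanges
    preserve. This makes resampling idempotent. *)
Lemma exchange_exchange eta x y u v : x != y ->
  exchange (exchange eta x y v) x y u = exchange eta x y u.
Proof.
move=> xy; apply: config_ext => z; rewrite !coord_exchange.
rewrite eqxx (eq_sym y x) (negbTE xy) eqxx.
case: eqVneq => // _; first by congr (_ * _); ring.
by case: eqVneq => // _; ring.
Qed.

Lemma measurable_exchange x y : measurable_fun setT
  (fun p : config R V * measurableTypeR R => exchange p.1 x y p.2).
Proof.
have mc z : measurable_fun setT (fun p : config R V * measurableTypeR R => coord p.1 z).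
  exact: (measurableT_comp (measurable_coord z) measurable_fst).
have m2 : measurable_fun setT (fun p : config R V * measurableTypeR R => p.2 : R).
  exact: measurable_snd.
apply: measurable_mkconfig => z.
case: (z == x); first by apply: measurable_funM => //; exact: measurable_funD.
case: (z == y); last exact: mc.
by apply: measurable_funM; [exact: measurable_funB|exact: measurable_funD].
Qed.

Lemma pweight_move eta x y v : x != y -> pweight alpha (move eta x y v) =
  \prod_(z | (z != x) && (z != y)) ppow (alpha z) (coord eta z) *
  (ppow (alpha x) v * ppow (alpha y) (coord eta x + coord eta y - v)).
Proof.
move=> xy; rewrite /pweight (bigD1 x)//= (bigD1 y)/=; last by rewrite eq_sym.
rewrite !coord_move eqxx eq_sym (negbTE xy) eqxx mulrA mulrC; congr (_ * _).
by apply: eq_bigr => z /andP[/negbTE zx /negbTE zy]; rewrite coord_move zx zy.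
Qed.

Let beta_scale (C p q sa sb G1 G2 G3 : R) : G1 != 0 -> G2 != 0 -> G3 != 0 ->
  C * (sa * p * (sb * q)) = C * (sa * sb) * (G1 * G2 / G3) * (G3 / (G1 * G2) * (p * q)).
Proof. by move=> *; field; repeat (apply/andP; split). Qed.

Let beta_scale1 (C s1 sa sb G : R) :
  s1 * (C * (sa * sb) * G) = C * (s1 * sa * sb * G).
Proof. ring. Qed.

(** On a line with pair sum s, the weight is a constant times v^(a-1) (s - v)^(b-1): given the other
    coordinates, v/s is Beta distributed, so drawing it afresh changes nothing. *)
Lemma ge0_integral_exchange x y (f : config R V -> \bar R) : x != y ->
  measurable_fun setT f -> (forall eta, 0 <= f eta)%E ->
  (\int[mu]_eta \int[leb]_u ((bet (alpha x) (alpha y) u)%:E * f (exchange eta x y u)) =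
   \int[mu]_eta f eta)%E.
Proof.
move=> xy mf f0; set a := alpha x; set b := alpha y.
have a0 : 0 < a by exact: alpha_gt0.
have b0 : 0 < b by exact: alpha_gt0.
have mg : measurable_fun setT (fun p : config R V * measurableTypeR R =>
    (bet a b p.2)%:E * f (exchange p.1 x y p.2))%E.
  apply: emeasurable_funM.
    by apply/measurable_EFinP; apply: measurableT_comp (measurable_snd); exact: measurable_bet.
  exact: (measurableT_comp mf (measurable_exchange x y)).
have g0 eta u : (0 <= (bet a b u)%:E * f (exchange eta x y u))%E.
  by rewrite mule_ge0// lee_fin bet_ge0.
have mPf : measurable_fun setT (fun eta =>
    \int[leb]_u ((bet a b u)%:E * f (exchange eta x y u)))%E.
  exact: (measurable_fun_fubini_tonelli_F (m2 := leb) _ mg (fun p => g0 p.1 p.2)).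
have Pf0 eta : (0 <= \int[leb]_u ((bet a b u)%:E * f (exchange eta x y u)))%E.
  exact: integral_ge0.
have [Z Z0 muE] := ge0_integral_dirichlet cardV alpha_gt0.
rewrite !muE//; congr (_ * _)%E.
have mpw := measurable_pweight alpha.
pose Pf eta := (\int[leb]_u ((bet a b u)%:E * f (exchange eta x y u)))%E.
apply: (@eq_integral_line R V cardV x y (fun eta => Pf eta * (pweight alpha eta)%:E)%E
   (fun eta => f eta * (pweight alpha eta)%:E)%E) => //.
- by apply: emeasurable_funM => //; exact/measurable_EFinP.
- by apply: emeasurable_funM => //; exact/measurable_EFinP.
- by move=> eta; rewrite mule_ge0// ?lee_fin ?pweight_ge0//; exact: Pf0.
- by move=> eta; rewrite mule_ge0// lee_fin pweight_ge0.
move=> eta; set s := coord eta x + coord eta y.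
pose C := \prod_(z | (z != x) && (z != y)) ppow (alpha z) (coord eta z).
have C0 : 0 <= C by rewrite prodr_ge0// => z _; exact: ppow_ge0.
pose h v := f (move eta x y v).
have mh : measurable_fun setT h by exact: (measurableT_comp mf (measurable_move eta x y)).
have h0 v : (0 <= h v)%E by exact: f0.
pose I := (\int[leb]_u ((bet a b u)%:E * h (u * s)%R))%E.
have mI : measurable_fun setT (fun u : R => (bet a b u)%:E * h (u * s)%R)%E.
  apply: emeasurable_funM; first by apply/measurable_EFinP; exact: measurable_bet.
  by apply: (measurableT_comp mh); exact: measurable_funM.
have I0 : (0 <= I)%E.
  by apply: integral_ge0 => u _; rewrite mule_ge0// lee_fin bet_ge0.
(* The resampled integrand is constant along the line and factors out of the left side as I; the
   right side produces the same I after substituting v = s u. *)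
transitivity (I * (C * (ppow (a + b) s * (Gamma a * Gamma b / Gamma (a + b))))%:E)%E.
  transitivity (\int[leb]_v (I * (C * (ppow a v * ppow b (s - v)))%:E))%E.
    apply: eq_integral => v _; rewrite pweight_move//; congr (_ * _)%E.
    by apply: eq_integral => u _; rewrite exchange_move.
  rewrite ge0_integralZl//; last 2 first.
  - apply/measurable_EFinP; apply: measurable_funM => //; exact: measurable_ppow_conv.
  - by move=> v _; rewrite lee_fin !mulr_ge0 ?ppow_ge0.
  congr (_ * _)%E; under eq_integral do rewrite EFinM.
  rewrite ge0_integralZl_EFin//; last 2 first.
  - by move=> v _; rewrite lee_fin !mulr_ge0 ?ppow_ge0.
  - by apply/measurable_EFinP; exact: measurable_ppow_conv.
  by rewrite integral_ppow_conv.
(* With a nonpositive pair sum, v and s - v are never both positive: the weight vanishes on the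
   whole line. *)
have [s0|s0] := ltP 0 s; last first.
  rewrite {1}/ppow ltNge s0/= mul0r mulr0 mule0; apply/esym.
  under eq_integral => v _.
    rewrite pweight_move// (_ : ppow _ v * _ = 0) ?mulr0 ?mule0; first over.
    rewrite /ppow; case: ifPn => [v0|]; last by rewrite mul0r.
    by rewrite ifF ?mulr0// subr_gt0; apply/negbTE; rewrite -leNgt (le_trans s0)// ltW.
  by rewrite integral0.
apply/esym.
rewrite (@ge0_integral_affine R _ s 0)//; last 2 first.
- apply: emeasurable_funM => //; apply/measurable_EFinP.
  exact: (measurableT_comp mpw (measurable_move eta x y)).
- by move=> v; rewrite mule_ge0// lee_fin pweight_ge0.
have Gab : 0 < Gamma (a + b) by rewrite Gamma_gt0 ?addr_gt0.
have Ga := Gamma_gt0 a0; have Gb := Gamma_gt0 b0.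
pose k := C * (s `^ (a - 1) * s `^ (b - 1)) * (Gamma a * Gamma b / Gamma (a + b)).
have k0 : 0 <= k.
  have Gabc : 0 <= Gamma a * Gamma b / Gamma (a + b) := ltW (divr_gt0 (mulr_gt0 Ga Gb) Gab).
  by apply: mulr_ge0 => //; apply: mulr_ge0 => //; apply: mulr_ge0; exact: powR_ge0.
under eq_integral => u _.
  rewrite addr0 (mulrC s u) pweight_move// -/C -/a -/b -/s.
  have -> : s - u * s = s * (1 - u) by ring.
  rewrite (mulrC u s) !ppowM// (mulrC s u) -/(h (u * s)%R).
  have -> : C * (s `^ (a - 1) * ppow a u * (s `^ (b - 1) * ppow b (1 - u))) =
     k * bet a b u.
    exact: (beta_scale _ _ _ _ _ (lt0r_neq0 Ga) (lt0r_neq0 Gb) (lt0r_neq0 Gab)).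
  rewrite EFinM muleCA (muleC (h _)); over.
rewrite ge0_integralZl_EFin//; last by move=> u _; rewrite mule_ge0// lee_fin bet_ge0.
rewrite -/I muleA -EFinM muleC; congr (_ * _%:E)%E.
rewrite /k /ppow s0 -[X in X * _ = _](powRr1 (ltW s0)).
have -> : a + b - 1 = 1 + (a - 1) + (b - 1) by ring.
have powD p q : s `^ (p + q) = s `^ p * s `^ q.
  by rewrite powRD// (gt_eqF s0) implybT.
rewrite !powD.
exact: beta_scale1.
Qed.

End Invariance.

(** * Expectations of bounded functions *)

Lemma discr_le (R : realFieldType) (a b c : R) :
  (forall k l, 0 <= k ^+ 2 * a + 2 * k * l * b + l ^+ 2 * c) -> b ^+ 2 <= a * c.
Proof.
move=> q.
have a0 : 0 <= a by have := q 1 0; rewrite expr1n mulr0 mul0r expr0n mul0r mul1r !addr0.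
have [a_eq0|an0] := eqVneq a 0.
  have c0 : 0 <= c by have := q 0 1; rewrite expr1n mulr0 !mul0r expr0n mul0r mul1r !add0r.
  (* At k = c + 1, l = -b the form equals -(c + 2) b^2, which forces b = 0. *)
  have := q (c + 1) (- b); rewrite a_eq0 mulr0 add0r mul0r => h.
  nra.
have {}a0 : 0 < a by rewrite lt_neqAle eq_sym an0.
(* At k = b, l = -a the form equals a (a c - b^2). *)
have := q b (- a) => h.
have : 0 <= a * (a * c - b ^+ 2) by apply: le_trans h _; rewrite le_eqVlt; apply/orP; left; apply/eqP; ring.
by rewrite pmulr_rge0// subr_ge0.
Qed.

(** * Means with respect to a weight carried by a set *)

Section WeightedMean.
Context d (T : measurableType d) (R : realType) (m : {measure set T -> \bar R}).
Variables (D : set T) (w : T -> R).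
Hypotheses (mw : measurable_fun setT w) (w0 : forall t, 0 <= w t).
Hypothesis w1 : (\int[m]_t (w t)%:E = 1)%E.
Hypothesis wD : forall t, w t = 0 \/ D t.
Implicit Types f g : T -> R.

(** Boundedness is asked only on D, which carries the weight: coordinates are unbounded on R^V but
    not on the simplex. The same calculus serves the Dirichlet measure, with D the simplex, and Beta
    variables, with D the open unit interval. *)
Definition bounded_on f := measurable_fun setT f /\
  exists M : R, forall t, D t -> `|f t| <= M.

Definition wmean f : R := \int[m]_t (w t * f t).

Lemma bounded_on_cst k : bounded_on (cst k).
Proof. by split => //; exists `|k|. Qed.

Lemma bounded_onD f g : bounded_on f -> bounded_on g -> bounded_on (f \+ g).
Proof.
move=> [mf [M Mf]] [mg [N Ng]]; split; first exact: measurable_funD.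
by exists (M + N) => t Dt; rewrite (le_trans (ler_normD _ _))// lerD ?Mf ?Ng.
Qed.

Lemma bounded_onM f g : bounded_on f -> bounded_on g -> bounded_on (f \* g).
Proof.
move=> [mf [M Mf]] [mg [N Ng]]; split; first exact: measurable_funM.
by exists (M * N) => t Dt; rewrite normrM ler_pM ?Mf ?Ng.
Qed.

Lemma bounded_onZ k f : bounded_on f -> bounded_on (fun t => k * f t).
Proof. by move=> bf; apply: (bounded_onM (bounded_on_cst k) bf). Qed.

Lemma bounded_onB f g : bounded_on f -> bounded_on g -> bounded_on (f \- g).
Proof.
move=> bf bg; have := bounded_onD bf (bounded_onZ (-1) bg); congr bounded_on.
by apply/funext => t /=; rewrite mulN1r.
Qed.

Lemma bounded_on_sum (I : Type) (r : seq I) (P : pred I) (F : I -> T -> R) :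
  (forall i, P i -> bounded_on (F i)) ->
  bounded_on (fun t => \sum_(i <- r | P i) F i t).
Proof.
move=> bF; elim: r => [|i r IH].
  by under eq_fun do rewrite big_nil; exact: bounded_on_cst.
under eq_fun do rewrite big_cons; case: (boolP (P i)) => // Pi.
by apply: bounded_onD => //; exact: bF.
Qed.

Lemma weight_eq f g : (forall t, D t -> f t = g t) -> (fun t => w t * f t) = (fun t => w t * g t).
Proof. by move=> fg; apply/funext => t; have [->|/fg->//] := wD t; rewrite !mul0r. Qed.

Lemma eq_wmean f g : (forall t, D t -> f t = g t) -> wmean f = wmean g.
Proof. by rewrite /wmean => /weight_eq ->. Qed.

Lemma wmean_integrable f : bounded_on f ->
  m.-integrable setT (EFin \o (fun t => w t * f t)).
Proof.
move=> [mf [M Mf]]; apply: (@le_integrable _ _ _ _ _ _ _ (fun t => M%:E * (w t)%:E)%E) => //.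
- by apply/measurable_EFinP; exact: measurable_funM.
- move=> t _; rewrite -EFinM lee_fin !normrM mulrC (ger0_norm (w0 t)).
  have [->|Dt] := wD t; first by rewrite !mulr0.
  apply: ler_wpM2r => //; exact: le_trans (Mf _ Dt) (ler_norm M).
apply: integrableZl => //; apply/integrableP; split; first exact/measurable_EFinP.
under eq_integral do rewrite abse_EFin ger0_norm//.
by rewrite w1 ltry.
Qed.

Lemma EFin_wmean f : bounded_on f ->
  (\int[m]_t (w t * f t)%:E = (wmean f)%:E)%E.
Proof.
move=> bf; rewrite fineK//.
exact: integrable_fin_num (wmean_integrable bf).
Qed.

Lemma wmean_cst k : wmean (cst k) = k.
Proof.
rewrite /wmean /cst RintegralZr//.
  by rewrite /Rintegral w1 mul1r.
have := wmean_integrable (bounded_on_cst 1).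
by congr (integrable _ _ (EFin \o _)); apply/funext => t; rewrite mulr1.
Qed.

Lemma wmeanD f g : bounded_on f -> bounded_on g ->
  wmean (fun t => f t + g t) = wmean f + wmean g.
Proof.
move=> bf bg; rewrite /wmean -RintegralD//; try exact: wmean_integrable.
by apply: eq_Rintegral => t _; rewrite mulrDr.
Qed.

Lemma wmeanZ k f : bounded_on f -> wmean (fun t => k * f t) = k * wmean f.
Proof.
move=> bf; rewrite /wmean -RintegralZl//; try exact: wmean_integrable.
by apply: eq_Rintegral => t _; rewrite mulrCA.
Qed.

Lemma wmeanB f g : bounded_on f -> bounded_on g ->
  wmean (fun t => f t - g t) = wmean f - wmean g.
Proof.
move=> bf bg; rewrite /wmean -RintegralB//; try exact: wmean_integrable.
by apply: eq_Rintegral => t _; rewrite mulrBr.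
Qed.

Lemma wmean_sum (I : Type) (r : seq I) (P : pred I) (F : I -> T -> R) :
  (forall i, P i -> bounded_on (F i)) ->
  wmean (fun t => \sum_(i <- r | P i) F i t) = \sum_(i <- r | P i) wmean (F i).
Proof.
move=> bF; elim: r => [|i r IH].
  by under eq_fun do rewrite big_nil; rewrite big_nil; exact: wmean_cst.
rewrite big_cons -IH; under eq_fun do rewrite big_cons.
by case: (boolP (P i)) => // Pi; rewrite wmeanD//; [exact: bF|exact: bounded_on_sum].
Qed.

Lemma wmean_ge0 f : (forall t, D t -> 0 <= f t) -> 0 <= wmean f.
Proof.
move=> f0; apply: Rintegral_ge0 => t _.
by have [->|/f0 ?] := wD t; rewrite ?mul0r// mulr_ge0.
Qed.

Lemma le_wmean f g : bounded_on f -> bounded_on g ->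
  (forall t, D t -> f t <= g t) -> wmean f <= wmean g.
Proof.
move=> bf bg fg; rewrite -subr_ge0 -wmeanB//; apply: wmean_ge0 => t Dt.
by rewrite subr_ge0 fg.
Qed.

Lemma norm_wmean_le f g : bounded_on f -> bounded_on g ->
  (forall t, D t -> `|f t| <= g t) -> `|wmean f| <= wmean g.
Proof.
move=> bf bg fg; rewrite ler_norml; apply/andP; split; last first.
  by apply: le_wmean => // t /fg; exact: le_trans (ler_norm _).
rewrite -mulN1r -wmeanZ//; apply: le_wmean => //; first exact: bounded_onZ.
by move=> t /fg; rewrite mulN1r ler_norml => /andP[].
Qed.

Lemma wmean_CS f g : bounded_on f -> bounded_on g ->
  wmean (f \* g) ^+ 2 <= wmean (f \* f) * wmean (g \* g).
Proof.
move=> bf bg; set a := wmean (f \* f); set b := wmean (f \* g); set c := wmean (g \* g).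
have q k l : 0 <= k ^+ 2 * a + 2 * k * l * b + l ^+ 2 * c.
  have -> : k ^+ 2 * a + 2 * k * l * b + l ^+ 2 * c =
      wmean (fun t => (k ^+ 2 * (f t * f t) + (2 * k * l) * (f t * g t)) + l ^+ 2 * (g t * g t)).
    rewrite !wmeanD ?wmeanZ//; try exact: bounded_onM; try exact/bounded_onZ/bounded_onM.
    by apply: bounded_onD; exact/bounded_onZ/bounded_onM.
  apply: wmean_ge0 => t _.
  have -> : k ^+ 2 * (f t * f t) + 2 * k * l * (f t * g t) + l ^+ 2 * (g t * g t) =
     (k * f t + l * g t) ^+ 2 by ring.
  exact: sqr_ge0.
exact: discr_le.
Qed.

End WeightedMean.

(** * Expectations and resampling operators *)

Section Kernel.
Context {R : realType} {V : finType} (alpha : V -> R).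
Hypotheses (cardV : (2 <= #|V|)%N) (alpha_gt0 : forall x, 0 < alpha x).
Local Notation leb := (@lebesgue_measure R).
Local Notation mu := (dirichlet alpha).
Implicit Types (eta : config R V) (x y z : V) (f g : config R V -> R).

Let S : set (config R V) := simplex.
Let D01 : set (measurableTypeR R) := `]0, 1[%classic.

Lemma dirichlet_simplex : (\int[mu]_eta (\1_S eta)%:E = 1)%E.
Proof.
have ms := @measurable_simplex R V.
rewrite integral_indic// setIT -[RHS](probability_setT mu) -(setUv S) measureU//; last first.
- by rewrite setICr.
- exact: measurableC.
rewrite [X in (_ + X)%E](_ : _ = 0%E) ?adde0//.
transitivity (\int[mu]_eta (\1_(~` S) eta)%:E)%E.
  by rewrite integral_indic ?setIT//; exact: measurableC.
have [Z Z0 muE] := ge0_integral_dirichlet cardV alpha_gt0.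
rewrite muE//; last by apply/measurable_EFinP/measurable_indic; exact: measurableC.
under eq_integral => t _.
  rewrite (_ : _ * _ = 0)%E; first over.
  rewrite -EFinM indicE; case: (boolP (_ \in _)) => [/set_mem h|]; last by rewrite mul0r.
  rewrite mul1r /pweight; congr EFin; apply/eqP/negPn/negP => /prodf_neq0 p0.
  apply: h; split; last exact: sum_hp.
  by move=> x; have := p0 x isT; rewrite /ppow; case: ifP => [/ltW//|_]; rewrite eqxx.
by rewrite integral0 mul0e.
Qed.

(** The indicator makes this an instance of [wmean]; the value agrees with [mean] because the
    simplex has full measure. *)
Definition expect f : R := wmean mu \1_S f.
Definition bdd f := bounded_on S f.

Let m1 : measurable_fun setT (\1_S : config R V -> R).
Proof. by apply: measurable_indic; exact: measurable_simplex. Qed.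

Let S0 eta : 0 <= \1_S eta :> R. Proof. by []. Qed.

Let SD eta : \1_S eta = 0 :> R \/ S eta.
Proof. by rewrite indicE; case: (boolP (_ \in _)) => [/set_mem|]; [right|left]. Qed.

Lemma eq_expect f g : (forall eta, S eta -> f eta = g eta) -> expect f = expect g.
Proof. exact: eq_wmean. Qed.

Lemma expect_cst k : expect (cst k) = k.
Proof. exact: (wmean_cst m1 S0 dirichlet_simplex SD). Qed.

Lemma expectD f g : bdd f -> bdd g ->
  expect (fun eta => f eta + g eta) = expect f + expect g.
Proof. exact: (wmeanD m1 S0 dirichlet_simplex SD). Qed.

Lemma expectB f g : bdd f -> bdd g ->
  expect (fun eta => f eta - g eta) = expect f - expect g.
Proof. exact: (wmeanB m1 S0 dirichlet_simplex SD). Qed.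

Lemma expectZ k f : bdd f -> expect (fun eta => k * f eta) = k * expect f.
Proof. exact: (wmeanZ m1 S0 dirichlet_simplex SD). Qed.

Lemma expect_sum (I : Type) (r : seq I) (P : pred I) (F : I -> config R V -> R) :
  (forall i, P i -> bdd (F i)) ->
  expect (fun eta => \sum_(i <- r | P i) F i eta) = \sum_(i <- r | P i) expect (F i).
Proof. exact: (wmean_sum m1 S0 dirichlet_simplex SD). Qed.

Lemma expect_ge0 f : (forall eta, S eta -> 0 <= f eta) -> 0 <= expect f.
Proof. exact: wmean_ge0. Qed.

Lemma le_expect f g : bdd f -> bdd g -> (forall eta, S eta -> f eta <= g eta) ->
  expect f <= expect g.
Proof. exact: (le_wmean m1 S0 dirichlet_simplex SD). Qed.

Lemma norm_expect_le f g : bdd f -> bdd g ->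
  (forall eta, S eta -> `|f eta| <= g eta) -> `|expect f| <= expect g.
Proof. exact: (norm_wmean_le m1 S0 dirichlet_simplex SD). Qed.

Lemma expect_CS f g : bdd f -> bdd g ->
  expect (f \* g) ^+ 2 <= expect (f \* f) * expect (g \* g).
Proof. exact: (wmean_CS m1 S0 dirichlet_simplex SD). Qed.

Lemma ae_dirichlet_simplex : {ae mu, forall eta, S eta}.
Proof.
have ms := @measurable_simplex R V.
exists (~` S); split => //; first exact: measurableC.
have := dirichlet_simplex; rewrite integral_indic// setIT => h.
by rewrite probability_setC// h subee.
Qed.

Lemma integral_expect f : bdd f -> (\int[mu]_eta (f eta)%:E = (expect f)%:E)%E.
Proof.
move=> bf; have [mf _] := bf; rewrite -(EFin_wmean m1 S0 dirichlet_simplex SD bf).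
apply: ae_eq_integral => //.
- exact/measurable_EFinP.
- by apply/measurable_EFinP; exact: measurable_funM.
apply: filterS ae_dirichlet_simplex => eta Seta _.
by rewrite /= indicE mem_set// mul1r.
Qed.

Lemma mean_expect f : measurable_fun setT f -> mean alpha f = expect f.
Proof.
move=> mf; congr fine; apply: ae_eq_integral => //.
- exact/measurable_EFinP.
- by apply/measurable_EFinP; exact: measurable_funM.
apply: filterS ae_dirichlet_simplex => eta Seta _.
by rewrite /= indicE mem_set// mul1r.
Qed.

Lemma bdd_coord x : bdd (coord ^~ x).
Proof.
split; first exact: measurable_coord.
exists 1 => eta [e0 e1]; rewrite ger0_norm// -e1 (bigD1 x)//= lerDl.
exact: sumr_ge0.
Qed.

Lemma simplex_exchange eta x y (u : R) : x != y -> 0 < u < 1 ->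
  S eta -> S (exchange eta x y u).
Proof.
move=> xy /andP[u0 u1] [e0 e1]; split => [z|].
  have s0 : 0 <= coord eta x + coord eta y by rewrite addr_ge0.
  rewrite coord_exchange; case: ifP => _; first by rewrite mulr_ge0// ltW.
  by case: ifP => // _; rewrite mulr_ge0// subr_ge0 ltW.
rewrite -e1 (bigD1 x)//= (bigD1 y)/=; last by rewrite eq_sym.
rewrite [RHS](bigD1 x)//= [in RHS](bigD1 y)/=; last by rewrite eq_sym.
rewrite !coord_exchange eqxx eq_sym (negbTE xy) eqxx.
rewrite addrA -mulrDl subrKC mul1r -addrA; congr (_ + (_ + _)).
by apply: eq_bigr => z /andP[/negbTE zx /negbTE zy]; rewrite coord_exchange zx zy.
Qed.

Definition resample x y f eta : R :=
  wmean leb (bet (alpha x) (alpha y)) (fun u => f (exchange eta x y u)).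

Let mb x y : @measurable_fun _ _ (measurableTypeR R) R setT (bet (alpha x) (alpha y)).
Proof. exact: measurable_bet. Qed.
Let b0 x y (u : measurableTypeR R) : 0 <= bet (alpha x) (alpha y) u. Proof. exact: bet_ge0. Qed.
Let b1 x y : (\int[leb]_u (bet (alpha x) (alpha y) u)%:E = 1)%E.
Proof. exact: integral_bet. Qed.
Let bD x y (u : measurableTypeR R) : bet (alpha x) (alpha y) u = 0 \/ D01 u.
Proof.
have [u01|/bet_out->] := boolP (0 < u < 1); last by left.
by right; rewrite /D01/= in_itv.
Qed.

Lemma bounded_on_exchange x y f eta : x != y -> S eta -> bdd f ->
  bounded_on D01 (fun u => f (exchange eta x y u)).
Proof.
move=> xy Seta [mf [M Mf]]; split.
  exact: (measurableT_comp mf (measurableT_comp (measurable_exchange x y) (measurable_pair1 eta))).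
by exists M => u; rewrite /D01/= in_itv/= => u01; apply: Mf; exact: simplex_exchange.
Qed.

(** Tonelli's measurability statement concerns nonnegative integrands, hence the split into positive
    and negative parts. *)
Lemma measurable_integral_bet x y (phi : config R V * measurableTypeR R -> R) :
  measurable_fun setT phi ->
  measurable_fun setT (fun eta => \int[leb]_u (bet (alpha x) (alpha y) u * phi (eta, u))).
Proof.
move=> mphi; apply: (measurableT_comp (f := fine)) => //=.
pose g (p : config R V * measurableTypeR R) := (bet (alpha x) (alpha y) p.2 * phi p)%:E.
have mg : measurable_fun setT g.
  apply/measurable_EFinP; apply: measurable_funM => //.
  by apply: measurableT_comp (measurable_snd); exact: measurable_bet.
have -> : (fun eta => \int[leb]_u (bet (alpha x) (alpha y) u * phi (eta, u))%:E)%E =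
  (fubini_F leb (g ^\+) \- fubini_F leb (g ^\-))%E.
  apply/funext => eta; rewrite [LHS]integralE /fubini_F/=.
  by congr (_ - _)%E; apply: eq_integral => u _; rewrite !(funeposE, funenegE).
apply: emeasurable_funB; apply: measurable_fun_fubini_tonelli_F => //.
- exact: measurable_funepos.
- exact: measurable_funeneg.
Qed.

Lemma measurable_resample x y f : measurable_fun setT f ->
  measurable_fun setT (resample x y f).
Proof.
move=> mf; apply: (@measurable_integral_bet x y (fun p => f (exchange p.1 x y p.2))).
exact: (measurableT_comp mf (measurable_exchange x y)).
Qed.

Lemma resample_bound x y f eta (M : R) : x != y -> S eta -> bdd f ->
  (forall eta, S eta -> `|f eta| <= M) -> `|resample x y f eta| <= M.
Proof.
move=> xy Seta bf Mf.
rewrite -[leRHS](wmean_cst (mb x y) (@b0 x y) (b1 x y) (@bD x y) M).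
apply: (norm_wmean_le (mb x y) (@b0 x y) (b1 x y) (@bD x y)).
- exact: bounded_on_exchange.
- exact: bounded_on_cst.
by move=> u; rewrite /D01/= in_itv/= => u01; apply: Mf; exact: simplex_exchange.
Qed.

Lemma bdd_resample x y f : x != y -> bdd f -> bdd (resample x y f).
Proof.
move=> xy bf; split; first by apply: measurable_resample; case: bf.
by have [mf [M Mf]] := bf; exists M => eta Seta; exact: resample_bound.
Qed.

Section Pair.
Variables (x y : V).
Hypothesis xy : x != y.
Local Notation P := (resample x y).

Lemma eq_resample f g eta : S eta -> (forall eta, S eta -> f eta = g eta) -> P f eta = P g eta.
Proof.
move=> Seta fg; apply: (eq_wmean leb (@bD x y)) => u.
by rewrite /D01/= in_itv/= => u01; apply: fg; exact: simplex_exchange.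
Qed.

Lemma resample_cst k eta : P (cst k) eta = k.
Proof. exact: (wmean_cst (mb x y) (@b0 x y) (b1 x y) (@bD x y)). Qed.

Lemma resampleD f g eta : S eta -> bdd f -> bdd g ->
  P (fun eta => f eta + g eta) eta = P f eta + P g eta.
Proof.
move=> Seta bf bg.
exact: (wmeanD (mb x y) (@b0 x y) (b1 x y) (@bD x y) (bounded_on_exchange xy Seta bf)
  (bounded_on_exchange xy Seta bg)).
Qed.

Lemma resampleB f g eta : S eta -> bdd f -> bdd g ->
  P (fun eta => f eta - g eta) eta = P f eta - P g eta.
Proof.
move=> Seta bf bg.
exact: (wmeanB (mb x y) (@b0 x y) (b1 x y) (@bD x y) (bounded_on_exchange xy Seta bf)
  (bounded_on_exchange xy Seta bg)).
Qed.

(** [P g] is unchanged by exchanges of x and y, so it comes out of the integral, as a known factor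
    comes out of a conditional expectation. *)
Lemma resampleM f g eta : S eta -> bdd f ->
  P (fun eta => f eta * P g eta) eta = P f eta * P g eta.
Proof.
move=> Seta bf; rewrite mulrC.
rewrite -[RHS](wmeanZ (mb x y) (@b0 x y) (b1 x y) (@bD x y) _ (bounded_on_exchange xy Seta bf)).
rewrite /resample; congr wmean; apply/funext => u; rewrite mulrC; congr (_ * _).
by congr wmean; apply/funext => v; rewrite exchange_exchange.
Qed.

Let expect_resample_ge0 f : bdd f -> (forall eta, 0 <= f eta) -> expect (P f) = expect f.
Proof.
move=> bf f0; have [mf _] := bf; have bPf := bdd_resample xy bf; have [mPf _] := bPf.
apply: EFin_inj; rewrite -!integral_expect// -[RHS](ge0_integral_exchange cardV alpha_gt0 xy)//; last first.
  exact/measurable_EFinP.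
apply: ae_eq_integral => //.
- exact/measurable_EFinP.
- apply: (measurable_fun_fubini_tonelli_F (m2 := leb)
    (fun p => (bet (alpha x) (alpha y) p.2)%:E * (f (exchange p.1 x y p.2))%:E)%E).
  + apply: emeasurable_funM; apply/measurable_EFinP.
      by apply: measurableT_comp (measurable_snd); exact: measurable_bet.
    exact: (measurableT_comp mf (measurable_exchange x y)).
  + by move=> p; rewrite mule_ge0// lee_fin.
apply: filterS ae_dirichlet_simplex => eta Seta _ /=.
rewrite /resample -(EFin_wmean (mb x y) (@b0 x y) (b1 x y) (@bD x y))//.
exact: bounded_on_exchange.
Qed.

Lemma expect_resample f : bdd f -> expect (P f) = expect f.
Proof.
move=> bf; have [mf [M Mf]] := bf.
(* The invariance is known for nonnegative functions: f is shifted by its bound M, and the maximum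
   with 0 only matters off the simplex. *)
pose g eta := Num.max (f eta + M) 0.
have gE eta : S eta -> g eta = f eta + M.
  move=> Seta; rewrite /g; apply/max_idPl.
  by have := Mf _ Seta; rewrite ler_norml -subr_ge0 opprK => /andP[].
have g0 eta : 0 <= g eta by rewrite /g le_max lexx orbT.
have bM := bounded_on_cst S M.
have bg : bdd g.
  split; first by apply: measurable_maxr => //; exact: measurable_funD.
  have [_ [N Nf]] := bounded_onD bf bM.
  by exists N => eta Seta; rewrite gE//; exact: Nf.
have fE : forall eta, S eta -> f eta = g eta - M by move=> eta Seta; rewrite gE// addrK.
have -> : expect (P f) = expect (P g) - M.
  rewrite -[X in _ - X](expect_cst M) -expectB//; last exact: bdd_resample.
  apply: eq_expect => eta Seta; rewrite (eq_resample Seta fE) resampleB//.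
  by rewrite -/(cst M) resample_cst.
rewrite expect_resample_ge0// -[X in _ - X](expect_cst M) -expectB//.
by apply: eq_expect => eta Seta; rewrite fE.
Qed.

(** Resampling preserves expectations and lets the factor [P g] through: P is an orthogonal
    projection for the scalar product of L^2(mu). *)
Lemma expect_mul_resample f g : bdd f -> bdd g ->
  expect (fun eta => f eta * P g eta) = expect (fun eta => P f eta * P g eta).
Proof.
move=> bf bg; have bPg := bdd_resample xy bg.
rewrite -expect_resample; last exact: bounded_onM.
by apply: eq_expect => eta Seta; exact: resampleM.
Qed.

End Pair.

End Kernel.

(** * Moments of Beta and Dirichlet variables *)

Section BetaMoments.
Context {R : realType}.
Local Notation leb := (@lebesgue_measure R).
Local Notation D01 := (`]0, 1[%classic : set (measurableTypeR R)).

Definition beta_var (a b : R) : R := a * b / ((a + b) ^+ 2 * (a + b + 1)).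

Lemma measurable_bet01 (a b : R) : @measurable_fun _ _ (measurableTypeR R) R setT (bet a b).
Proof. exact: measurable_bet. Qed.

Lemma bet01 (a b : R) (u : measurableTypeR R) : bet a b u = 0 \/ D01 u.
Proof.
have [u01|/bet_out->] := boolP (0 < u < 1); last by left.
by right; rewrite /= in_itv.
Qed.

Lemma bounded_on_id01 : bounded_on D01 (fun u => u : R).
Proof.
by split => //; exists 1 => u /=; rewrite in_itv/= => /andP[u0 u1]; rewrite ger0_norm ltW.
Qed.

Lemma wmean_betM (a b : R) f : 0 < a -> 0 < b -> bounded_on D01 f ->
  wmean leb (bet a b) (fun u => (u : R) * f u) =
  a / (a + b) * wmean leb (bet (a + 1) b) f.
Proof.
move=> a0 b0 bf; have a10 : 0 < a + 1 by rewrite addr_gt0.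
rewrite /wmean -RintegralZl//; last first.
  exact: (wmean_integrable (measurable_bet01 _ _) (bet_ge0 a10 b0) (integral_bet a10 b0) (bet01 _ _)).
by apply: eq_Rintegral => u _; rewrite mulrA betM// mulrA.
Qed.

(** Centered at the mean a/(a + b), the linear term integrates to 0 and the quadratic one to the
    variance. Later integrands in u are brought to this shape. *)
Lemma wmean_beta (a b p q r : R) : 0 < a -> 0 < b ->
  wmean leb (bet a b) (fun u => p + q * (u - a / (a + b)) + r * (u - a / (a + b)) ^+ 2) =
  p + r * beta_var a b.
Proof.
move=> a0 b0; have ab0 : 0 < a + b by exact: addr_gt0.
have a10 : 0 < a + 1 by rewrite addr_gt0.
have bu := bounded_on_id01.
pose wc c d (c0 : 0 < c) (d0 : 0 < d) k := wmean_cst (measurable_bet01 c d)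
  (bet_ge0 c0 d0) (integral_bet c0 d0) (bet01 c d) k.
set m := a / (a + b).
have M1 c : 0 < c -> wmean leb (bet c b) (fun u => u : R) = c / (c + b).
  move=> c0; have := wmean_betM c0 b0 (bounded_on_cst _ 1).
  under [X in wmean _ _ X = _]eq_fun do rewrite /cst mulr1.
  by rewrite wc ?mulr1// addr_gt0.
have M2 : wmean leb (bet a b) (fun u => (u : R) * u) = m * ((a + 1) / (a + 1 + b)).
  by rewrite wmean_betM// M1.
pose k0 := p - q * m + r * m ^+ 2; pose k1 := q - 2 * r * m.
transitivity (wmean leb (bet a b) (fun u => k0 + (k1 * u + r * (u * u)))).
  by congr wmean; apply/funext => u; rewrite /k0 /k1; ring.
have mb := measurable_bet01 a b; have w0 := bet_ge0 a0 b0.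
have w1 := integral_bet a0 b0; have wD := bet01 a b.
have bk1 := bounded_onZ k1 bu; have br := bounded_onZ r (bounded_onM bu bu).
rewrite (wmeanD mb w0 w1 wD (bounded_on_cst _ k0) (bounded_onD bk1 br)).
rewrite (wmeanD mb w0 w1 wD bk1 br) (wmeanZ mb w0 w1 wD k1 bu).
rewrite (wmeanZ mb w0 w1 wD r (bounded_onM bu bu)) (wmean_cst mb w0 w1 wD) M2 M1//.
rewrite /k0 /k1 /beta_var /m; field.
by rewrite !gt_eqF// addr_gt0.
Qed.

End BetaMoments.

Section Moments.
Context {R : realType} {V : finType} (alpha : V -> R).
Hypotheses (cardV : (2 <= #|V|)%N) (alpha_gt0 : forall x, 0 < alpha x).
Implicit Types (eta : config R V) (x y z : V) (b : V -> R).
Local Notation A := (alpha_sum alpha).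
Local Notation E := (expect alpha).

Lemma alpha_sum_gt0 : 0 < A.
Proof.
have /card_gt0P[x _] : (0 < #|V|)%N by exact: leq_trans cardV.
by rewrite /alpha_sum (bigD1 x)//= ltr_pwDl// sumr_ge0// => y _; exact: ltW.
Qed.

Definition lin b eta : R := \sum_z b z * coord eta z.

Definition avg x y b z : R :=
  if (z == x) || (z == y) then (alpha x * b x + alpha y * b y) / (alpha x + alpha y)
  else b z.

Lemma bdd_lin b : bdd (lin b).
Proof. by apply: bounded_on_sum => z _; apply: bounded_onZ; exact: bdd_coord. Qed.

Let s0 x y : 0 < alpha x + alpha y. Proof. exact: addr_gt0. Qed.

(** Stated for an arbitrary vector d because it is also applied to differences of two
    configurations, which do not lie in the simplex. *)
Lemma sum_exchange x y (b d : V -> R) (u : R) : x != y ->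
  \sum_z b z * (if z == x then u * (d x + d y)
                else if z == y then (1 - u) * (d x + d y) else d z) =
  \sum_z avg x y b z * d z +
  (u - alpha x / (alpha x + alpha y)) * (b x - b y) * (d x + d y).
Proof.
move=> xy; have yx : y != x by rewrite eq_sym.
rewrite (bigD1 x)//= (bigD1 y)//= eqxx (negbTE yx) eqxx.
rewrite [in RHS](bigD1 x)//= [in RHS](bigD1 y)//= /avg !eqxx orbT/=.
have -> : \sum_(i | (i != x) && (i != y)) b i * (if i == x then u * (d x + d y)
                else if i == y then (1 - u) * (d x + d y) else d i) =
    \sum_(i | (i != x) && (i != y)) (if (i == x) || (i == y) then
    (alpha x * b x + alpha y * b y) / (alpha x + alpha y) else b i) * d i.
  by apply: eq_bigr => i /andP[/negbTE -> /negbTE ->].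
set T := \sum_(i | _) _; field; exact: lt0r_neq0.
Qed.

Lemma lin_exchange x y b eta u : x != y -> lin b (exchange eta x y u) =
  lin (avg x y b) eta + (u - alpha x / (alpha x + alpha y)) * (b x - b y) *
  (coord eta x + coord eta y).
Proof.
by move=> xy; rewrite -sum_exchange//; apply: eq_bigr => z _; rewrite coord_exchange.
Qed.

Lemma resample_lin x y b eta : x != y ->
  resample alpha x y (lin b) eta = lin (avg x y b) eta.
Proof.
move=> xy.
have := wmean_beta (lin (avg x y b) eta) ((b x - b y) * (coord eta x + coord eta y)) 0
  (alpha_gt0 x) (alpha_gt0 y); rewrite mul0r addr0 => <-.
congr wmean; apply/funext => u; rewrite lin_exchange//; ring.
Qed.

(** Moments are extracted from invariance under resampling and from sum_x eta_x = 1, not from the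
    density. Here resampling sends eta_x to its share alpha_x / (alpha_x + alpha_y) of the pair
    sum. *)
Lemma expect_lin_eq x y : x != y -> alpha y * E (coord ^~ x) = alpha x * E (coord ^~ y).
Proof.
move=> xy; have bx := @bdd_coord R V x; have by_ := @bdd_coord R V y.
set q := alpha x / (alpha x + alpha y).
have : E (resample alpha x y (coord ^~ x)) = E (fun eta => q * (coord eta x + coord eta y)).
  congr wmean; apply/funext => eta.
  have := wmean_beta (q * (coord eta x + coord eta y)) (coord eta x + coord eta y) 0
    (alpha_gt0 x) (alpha_gt0 y); rewrite mul0r addr0 => <-.
  by congr wmean; apply/funext => u; rewrite coord_exchange eqxx -/q; ring.
rewrite expect_resample// expectZ//; last exact: bounded_onD.
rewrite expectD// /q => h.
have : (alpha x + alpha y) * E (coord^~ x) = alpha x * (E (coord^~ x) + E (coord^~ y)).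
  by rewrite {1}h mulrA mulrCA mulfV ?mulr1// lt0r_neq0.
by rewrite mulrDl mulrDr => /addrI.
Qed.

Let bM x y : bdd (fun eta => coord eta x * coord eta y).
Proof. apply: bounded_onM; exact: bdd_coord. Qed.

Lemma expect_coord x : E (coord ^~ x) = alpha x / A.
Proof.
have h : A * E (coord ^~ x) = alpha x.
  rewrite mulr_suml (eq_bigr (fun y => alpha x * E (coord ^~ y))) => [|y _].
    rewrite -mulr_sumr -expect_sum// => [|y _]; last exact: bdd_coord.
    by rewrite (@eq_expect _ _ _ _ (cst 1)) ?expect_cst ?mulr1// => eta [].
  by have [->//|yx] := eqVneq y x; rewrite expect_lin_eq// eq_sym.
by rewrite -[in RHS]h mulrC mulKf// lt0r_neq0// alpha_sum_gt0.
Qed.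

(** After resampling, both moments are multiples of E (eta_x + eta_y)^2, by the factors E U(1 - U)
    and E U^2, whose ratio is alpha_y / (alpha_x + 1). *)
Lemma expect_coordM_eq x y : x != y ->
  (alpha x + 1) * E (fun eta => coord eta x * coord eta y) =
  alpha y * E (fun eta => coord eta x * coord eta x).
Proof.
move=> xy; have yx : y != x by rewrite eq_sym.
set q := alpha x / (alpha x + alpha y); set v := beta_var (alpha x) (alpha y).
pose s2 eta := (coord eta x + coord eta y) * (coord eta x + coord eta y) : R.
have bs : bdd s2 by apply: bounded_onM; apply: bounded_onD; exact: bdd_coord.
have Exy : E (fun eta => coord eta x * coord eta y) = (q * (1 - q) - v) * E s2.
  rewrite -(expect_resample cardV alpha_gt0 xy)// -expectZ//; congr wmean; apply/funext => eta.
  have := wmean_beta (q * (1 - q) * s2 eta) ((1 - 2 * q) * s2 eta) (- s2 eta)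
    (alpha_gt0 x) (alpha_gt0 y); rewrite mulNr -/v -/q => h.
  rewrite mulrBl (mulrC v) -h; congr wmean; apply/funext => u.
  by rewrite !coord_exchange eqxx (negbTE yx) eqxx /s2; ring.
have Exx : E (fun eta => coord eta x * coord eta x) = (q ^+ 2 + v) * E s2.
  rewrite -(expect_resample cardV alpha_gt0 xy)// -expectZ//; congr wmean; apply/funext => eta.
  have := wmean_beta (q ^+ 2 * s2 eta) (2 * q * s2 eta) (s2 eta)
    (alpha_gt0 x) (alpha_gt0 y); rewrite -/v -/q => h.
  rewrite mulrDl (mulrC v) -h; congr wmean; apply/funext => u.
  by rewrite !coord_exchange eqxx /s2; ring.
rewrite Exy Exx !mulrA; congr (_ * _); rewrite /q /v /beta_var.
have := alpha_gt0 x; have := alpha_gt0 y; move: (alpha x) (alpha y) => a b b0 a0.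
have ab0 : 0 < a + b by exact: addr_gt0.
have ab1 : 0 < a + b + 1 by exact: addr_gt0.
by field; rewrite !gt_eqF.
Qed.

Lemma expect_coord2 x :
  E (fun eta => coord eta x * coord eta x) = alpha x * (alpha x + 1) / (A * (A + 1)).
Proof.
have h : (A + 1) * E (fun eta => coord eta x * coord eta x) = (alpha x + 1) * (alpha x / A).
  (* On the simplex eta_x is the sum over y of eta_x eta_y; the mixed moments being multiples of E
     eta_x^2, this is the only unknown left. *)
  rewrite -expect_coord (@eq_expect _ _ _ (coord ^~ x) (fun eta => \sum_y coord eta x * coord eta y)).
    rewrite expect_sum// mulr_sumr (bigD1 x)//= [A](bigD1 x)//=.
    have -> : \sum_(y | y != x) (alpha x + 1) * E (fun eta => coord eta x * coord eta y) =
        \sum_(y | y != x) alpha y * E (fun eta => coord eta x * coord eta x).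
      by apply: eq_bigr => y yx; rewrite expect_coordM_eq// eq_sym.
    by rewrite -mulr_suml; ring.
  by move=> eta [_ e1]; rewrite -mulr_sumr e1 mulr1.
have A0 := alpha_sum_gt0; have A1 : 0 < A + 1 by rewrite addr_gt0.
apply: (mulfI (lt0r_neq0 A1)); rewrite h; field.
by rewrite !gt_eqF.
Qed.

Lemma expect_coordM x y : x != y ->
  E (fun eta => coord eta x * coord eta y) = alpha x * alpha y / (A * (A + 1)).
Proof.
move=> xy; have a1 : 0 < alpha x + 1 by rewrite addr_gt0.
apply: (mulfI (lt0r_neq0 a1)); rewrite expect_coordM_eq// expect_coord2.
have A0 := alpha_sum_gt0; have A1 : 0 < A + 1 by rewrite addr_gt0.
by field; rewrite !gt_eqF.
Qed.

(** A^2 times the variance of b under the weights alpha_z / A on V. *)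
Definition sform b : R := A * (\sum_z alpha z * b z ^+ 2) - (\sum_z alpha z * b z) ^+ 2.

Lemma expect_lin b : E (lin b) = (\sum_z alpha z * b z) / A.
Proof.
rewrite /lin expect_sum//; last by move=> z _; apply: bounded_onZ; exact: bdd_coord.
rewrite mulr_suml; apply: eq_bigr => z _.
rewrite expectZ//; last exact: bdd_coord.
by rewrite expect_coord mulrCA mulrA.
Qed.

Lemma expect_lin2 b : E (fun eta => lin b eta * lin b eta) =
  ((\sum_z alpha z * b z) ^+ 2 + \sum_z alpha z * b z ^+ 2) / (A * (A + 1)).
Proof.
have A0 := alpha_sum_gt0; have A1 : 0 < A + 1 by rewrite addr_gt0.
transitivity (E (fun eta => \sum_y \sum_z (b y * b z) * (coord eta y * coord eta z))).
  congr wmean; apply/funext => eta; rewrite /lin mulr_suml; apply: eq_bigr => y _.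
  by rewrite mulr_sumr; apply: eq_bigr => z _; ring.
rewrite expect_sum//; last first.
  by move=> y _; apply: bounded_on_sum => z _; exact: (bounded_onZ _ (bM y z)).
rewrite expr2 mulr_suml -big_split/= mulr_suml; apply: eq_bigr => y _.
rewrite expect_sum//; last by move=> z _; exact: (bounded_onZ _ (bM y z)).
rewrite (bigD1 y)//= expectZ// expect_coord2 [in RHS]mulr_sumr [in RHS](bigD1 y)//=.
rewrite (eq_bigr (fun z => alpha y * b y * (alpha z * b z) / (A * (A + 1)))); last first.
  move=> z zy; rewrite expectZ// expect_coordM 1?eq_sym//.
  by field; rewrite !gt_eqF.
rewrite -mulr_suml; set T := \sum_(i | _) _.
by field; rewrite !gt_eqF.
Qed.

Lemma variance_lin b : E (fun eta => lin b eta * lin b eta) - E (lin b) ^+ 2 =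
  sform b / (A ^+ 2 * (A + 1)).
Proof.
have A0 := alpha_sum_gt0; have A1 : 0 < A + 1 by rewrite addr_gt0.
rewrite expect_lin2 expect_lin /sform; set T := \sum_z _ * _; set U := \sum_z _.
by field; rewrite !gt_eqF.
Qed.

Lemma sum_avg x y (b : V -> R) (F : V -> R -> R) : x != y ->
  \sum_z F z (avg x y b z) = \sum_z F z (b z) - F x (b x) - F y (b y) +
  F x ((alpha x * b x + alpha y * b y) / (alpha x + alpha y)) +
  F y ((alpha x * b x + alpha y * b y) / (alpha x + alpha y)).
Proof.
move=> xy; have yx : y != x by rewrite eq_sym.
rewrite (bigD1 x)//= (bigD1 y)//= [in RHS](bigD1 x)//= [in RHS](bigD1 y)//=.
rewrite /avg !eqxx orbT/=.
rewrite (eq_bigr (fun z => F z (b z))); last by move=> i /andP[/negbTE -> /negbTE ->].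
set T := \sum_(i | _) _; ring.
Qed.

Definition ind2 x y z : R := ((z == x) || (z == y))%:R.

(** Let s = alpha_x + alpha_y and w = alpha_x alpha_y / s. Averaging keeps sum alpha b and costs A w
    (b_x - b_y)^2. As [sform] of the edge indicator is s (A - s), the Beta fluctuation gives back (A
    - s)/(s + 1) times w (b_x - b_y)^2, and A - (A - s)/(s + 1) = (A + 1) s/(s + 1). *)
Lemma sform_avg x y b : x != y ->
  sform (avg x y b) + beta_var (alpha x) (alpha y) * (b x - b y) ^+ 2 * sform (ind2 x y) =
  sform b - (A + 1) * ((alpha x + alpha y) / (alpha x + alpha y + 1)) *
    (alpha x * alpha y / (alpha x + alpha y) * (b x - b y) ^+ 2).
Proof.
move=> xy; have yx : y != x by rewrite eq_sym.
have ind n : \sum_z alpha z * ind2 x y z ^+ n.+1 = alpha x + alpha y.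
  rewrite (bigD1 x)//= (bigD1 y)//= /ind2 !eqxx orbT !expr1n !mulr1.
  rewrite big1 ?addr0// => z /andP[/negbTE -> /negbTE ->].
  by rewrite expr0n mulr0.
rewrite /sform (sum_avg b (fun z t => alpha z * t ^+ 2))//.
rewrite (sum_avg b (fun z t => alpha z * t))// (ind 1%N) (ind 0%N).
set T := \sum_z _ * _; set U := \sum_z _; rewrite /beta_var.
have := alpha_gt0 x; have := alpha_gt0 y; move: (alpha x) (alpha y) => a c c0 a0.
have ac0 : 0 < a + c by exact: addr_gt0.
have ac1 : 0 < a + c + 1 by exact: addr_gt0.
by field; rewrite !gt_eqF.
Qed.

Lemma sformE b : 2 * sform b = \sum_x \sum_y alpha x * alpha y * (b x - b y) ^+ 2.
Proof.
rewrite /sform; set T := \sum_z _ * _; set U := \sum_z alpha z * b z.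
transitivity (\sum_x (A * (alpha x * b x ^+ 2) + (alpha x * T + - 2 * U * (alpha x * b x)))).
  by rewrite !big_split/= -!mulr_sumr -mulr_suml -/T -/U -/(alpha_sum alpha); ring.
apply: eq_bigr => x _.
rewrite /T /U mulr_suml !mulr_sumr mulr_suml -!big_split/=.
by apply: eq_bigr => y _; ring.
Qed.

Lemma sform_ge0 b : 0 <= sform b.
Proof.
rewrite -(pmulr_rge0 (sform b) (ltr0Sn R 1)) sformE.
apply: sumr_ge0 => x _; apply: sumr_ge0 => y _.
by rewrite mulr_ge0 ?sqr_ge0// mulr_ge0// ltW.
Qed.

Lemma sform_ge b x y : alpha x * alpha y * (b x - b y) ^+ 2 <= 2 * sform b.
Proof.
have p0 z w : 0 <= alpha z * alpha w * (b z - b w) ^+ 2.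
  by rewrite mulr_ge0 ?sqr_ge0// mulr_ge0// ltW.
rewrite sformE (bigD1 x)//= (bigD1 y)//= -addrA lerDl addr_ge0//.
  by apply: sumr_ge0 => z _.
by apply: sumr_ge0 => z _; apply: sumr_ge0 => w _.
Qed.

End Moments.

(** * Contraction of almost affine functions *)

Section Averaging.
Context {R : realType} {V : finType} (c : V -> V -> R) (alpha : V -> R).
Hypotheses (cardV : (2 <= #|V|)%N) (alpha_gt0 : forall x, 0 < alpha x).
Hypothesis c_ge0 : forall x y, 0 <= c x y.
Implicit Types (eta : config R V) (x y z : V) (b : V -> R) (p : V * V).
Implicit Types (f g : config R V -> R).
Local Notation A := (alpha_sum alpha).
Local Notation E := (expect alpha).
Local Notation S := (@simplex R V).
Local Notation P p := (resample alpha p.1 p.2).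

Let mul_funC f g : f \* g = g \* f.
Proof. by apply/funext => eta /=; rewrite mulrC. Qed.

Definition ordered p := (enum_rank p.1 < enum_rank p.2)%N.

Lemma ordered_neq p : ordered p -> p.1 != p.2.
Proof. by rewrite /ordered; apply: contraTneq => ->; rewrite ltnn. Qed.

Definition total_rate : R := \sum_(p | ordered p) c p.1 p.2.
Hypothesis total_rate_gt0 : 0 < total_rate.

Definition rate p : R := c p.1 p.2 / total_rate.

Lemma rate_ge0 p : 0 <= rate p.
Proof. by rewrite divr_ge0// ltW. Qed.

Lemma sum_rate : \sum_(p | ordered p) rate p = 1.
Proof. by rewrite -mulr_suml divff// lt0r_neq0. Qed.

(** The jump chain of the process: on bounded functions over the simplex, the generator is
    [total_rate] times K - 1. *)
Definition averaging f eta : R := \sum_(p | ordered p) rate p * P p f eta.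
Local Notation K := averaging.

Lemma bdd_averaging f : bdd f -> bdd (K f).
Proof.
move=> bf; apply: bounded_on_sum => p /ordered_neq pn.
by apply: bounded_onZ; exact: bdd_resample.
Qed.

Lemma averagingD f g eta : S eta -> bdd f -> bdd g ->
  K (fun eta => f eta + g eta) eta = K f eta + K g eta.
Proof.
move=> Seta bf bg; rewrite /K -big_split/=; apply: eq_bigr => p /ordered_neq pn.
by rewrite resampleD// mulrDr.
Qed.

Lemma averaging_bound f eta (M : R) : S eta -> bdd f -> (forall eta, S eta -> `|f eta| <= M) ->
  `|K f eta| <= M.
Proof.
move=> Seta bf fM; rewrite (le_trans (ler_norm_sum _ _ _))//.
rewrite -[leRHS]mul1r -sum_rate mulr_suml; apply: ler_sum => p /ordered_neq pn.
rewrite normrM (ger0_norm (rate_ge0 p)); apply: ler_wpM2l; first exact: rate_ge0.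
exact: resample_bound.
Qed.

Lemma expect_averaging f : bdd f -> E (K f) = E f.
Proof.
move=> bf; rewrite /K expect_sum//; last first.
  by move=> p /ordered_neq pn; apply: bounded_onZ; exact: bdd_resample.
rewrite -[RHS]mul1r -sum_rate mulr_suml; apply: eq_bigr => p /ordered_neq pn.
by rewrite expectZ ?expect_resample//; exact: bdd_resample.
Qed.

Lemma expect_mul_averaging f g : bdd f -> bdd g ->
  E (f \* K g) = \sum_(p | ordered p) rate p * E (P p f \* P p g).
Proof.
move=> bf bg.
rewrite (@eq_expect _ _ _ _ (fun eta => \sum_(p | ordered p) rate p * (f eta * P p g eta))).
  rewrite expect_sum//; last first.
    move=> p /ordered_neq pn; apply: bounded_onZ; apply: bounded_onM => //.
    exact: bdd_resample.
  apply: eq_bigr => p /ordered_neq pn; rewrite expectZ//; last first.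
    by apply: bounded_onM => //; exact: bdd_resample.
  by congr (_ * _); exact: expect_mul_resample.
by move=> eta _ /=; rewrite /K mulr_sumr; apply: eq_bigr => p _; rewrite mulrCA.
Qed.

Lemma averaging_sym f g : bdd f -> bdd g -> E (f \* K g) = E (K f \* g).
Proof.
move=> bf bg; rewrite (mul_funC (K f)) (expect_mul_averaging bf bg) (expect_mul_averaging bg bf).
by apply: eq_bigr => p _; rewrite (mul_funC (P p f)).
Qed.

(** Each P_e being an orthogonal projection, E (f K g) is a combination of the E (P_e f P_e g) with
    nonnegative weights: a positive semidefinite form, for which Cauchy-Schwarz holds. *)
Lemma averaging_CS f g : bdd f -> bdd g ->
  E (f \* K g) ^+ 2 <= E (f \* K f) * E (g \* K g).
Proof.
move=> bf bg; apply: discr_le => k l; rewrite !expect_mul_averaging//.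
rewrite !mulr_sumr -!big_split/=; apply: sumr_ge0 => p /ordered_neq pn.
have bPf := bdd_resample alpha_gt0 pn bf; have bPg := bdd_resample alpha_gt0 pn bg.
have bfg (h h' : config R V -> R) : bdd h -> bdd h' -> bdd (h \* h') by exact: bounded_onM.
have q (a b d : R) : k ^+ 2 * (rate p * a) + 2 * k * l * (rate p * b) + l ^+ 2 * (rate p * d) =
   rate p * (k ^+ 2 * a + (2 * k * l) * b + l ^+ 2 * d) by ring.
rewrite q; apply: mulr_ge0; first exact: rate_ge0.
rewrite -!expectZ//; try exact: bfg.
rewrite -!expectD//; try (apply: bounded_onZ; exact: bfg); last first.
  by apply: bounded_onD; apply: bounded_onZ; exact: bfg.
apply: expect_ge0 => eta _ /=.
have q' (a b : R) : k ^+ 2 * (a * a) + 2 * k * l * (a * b) + l ^+ 2 * (b * b) =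
  (k * a + l * b) ^+ 2 by ring.
by rewrite q' sqr_ge0.
Qed.

Definition avgK b z : R := \sum_(p | ordered p) rate p * avg alpha p.1 p.2 b z.

Lemma averaging_lin b eta : K (lin b) eta = lin (avgK b) eta.
Proof.
rewrite /K (eq_bigr (fun p => rate p * lin (avg alpha p.1 p.2 b) eta)); last first.
  by move=> p /ordered_neq pn; rewrite resample_lin.
rewrite /lin /avgK (eq_bigr (fun p => \sum_z (rate p * avg alpha p.1 p.2 b z) * coord eta z)).
  by rewrite exchange_big/=; apply: eq_bigr => z _; rewrite mulr_suml.
by move=> p _; rewrite mulr_sumr; apply: eq_bigr => z _; rewrite mulrA.
Qed.

Lemma bdd_iter t f : bdd f -> bdd (iter t K f).
Proof. by move=> bf; elim: t => //= t; exact: bdd_averaging. Qed.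

Lemma norm_iter_logconvex t f : bdd f ->
  E (iter t.+1 K f \* iter t.+1 K f) ^+ 2 <=
  E (iter t K f \* iter t K f) * E (iter t.+2 K f \* iter t.+2 K f).
Proof.
move=> bf; have bt n := @bdd_iter n f bf.
rewrite /= -averaging_sym ?bt//; last exact: (bt t.+1).
exact: (expect_CS cardV alpha_gt0 (bt t) (bt t.+2)).
Qed.

(** Averaging preserves sum alpha b, so only sum alpha b^2 drops in the formula for the second
    moment. *)
Lemma expect_lin_resample b x y : x != y ->
  E (fun eta => lin b eta * lin b eta) - E (resample alpha x y (lin b) \* resample alpha x y (lin b)) =
  alpha x * alpha y / (alpha x + alpha y) * (b x - b y) ^+ 2 / (A * (A + 1)).
Proof.
move=> xy; have A0 := alpha_sum_gt0 cardV alpha_gt0; have A1 : 0 < A + 1 by rewrite addr_gt0.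
rewrite expect_lin2//.
have -> : E (resample alpha x y (lin b) \* resample alpha x y (lin b)) =
  E (fun eta => lin (avg alpha x y b) eta * lin (avg alpha x y b) eta).
  by congr wmean; apply/funext => eta /=; rewrite resample_lin.
rewrite expect_lin2// (sum_avg _ _ (fun z t => alpha z * t ^+ 2))//.
rewrite (sum_avg _ _ (fun z t => alpha z * t))//.
set T := \sum_z _ * _; set U := \sum_z _.
have := alpha_gt0 x; have := alpha_gt0 y; move: (alpha x) (alpha y) => a d d0 a0.
have ad0 : 0 < a + d by exact: addr_gt0.
by field; rewrite !gt_eqF.
Qed.

End Averaging.

(** * Contraction of quadratic forms and propagation of Jensen defects *)

Section Contraction.
Context {R : realType} {V : finType} (c : V -> V -> R) (alpha : V -> R).
Hypotheses (cardV : (2 <= #|V|)%N) (alpha_gt0 : forall x, 0 < alpha x).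
Hypothesis c_ge0 : forall x y, 0 <= c x y.
Hypothesis total_rate_gt0 : 0 < total_rate c.
Local Notation leb := (@lebesgue_measure R).
Implicit Types (eta : config R V) (x y z : V) (b d : V -> R) (p : V * V).
Implicit Types (F f g : config R V -> R) (L : seq (R * (V -> R))).
Local Notation A := (alpha_sum alpha).
Local Notation S := (@simplex R V).
Local Notation P p := (resample alpha p.1 p.2).
Local Notation K := (averaging c alpha).
Local Notation w := (rate c).
Local Notation sf := (sform alpha).

Definition edge_weight p : R := alpha p.1 * alpha p.2 / (alpha p.1 + alpha p.2).

(** [a2] and [g] stand for alpha_2,min and gap_1. Divided by A (A + 1), [gap_sform] says that g
    Var(lin b) is at most the Dirichlet form of lin b. *)
Variables (a2 g : R).
Hypothesis a2_ge0 : 0 <= a2.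
Hypothesis a2_le : forall x y, x != y -> 0 < c x y -> a2 <= alpha x + alpha y.
Hypothesis gap_sform : forall b, g / A * sf b <=
  \sum_(p | ordered p) c p.1 p.2 * (edge_weight p * (b p.1 - b p.2) ^+ 2).

(** At a2 = alpha_2,min and g = gap_1 this is gamma gap_1, the lower bound to be proved for the
    gap. *)
Definition gap_rate : R := a2 / (1 + a2) * (1 + A^-1) * g.
Definition contraction : R := 1 - gap_rate / total_rate c.
Local Notation r := contraction.

Let A_gt0 := alpha_sum_gt0 cardV alpha_gt0.

(* A list of weighted linear forms encodes the quadratic form [sos L], which is
   evaluated at differences of configurations. *)
Definition sos L d : R := \sum_(l <- L) l.1 * (\sum_z l.2 z * d z) ^+ 2.
(** A linear functional of the encoded quadratic form, proportional to the weighted sum of the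
    variances of its linear forms; it is the quantity that [sos_step] contracts. *)
Definition sos_sform L : R := \sum_(l <- L) l.1 * sf l.2.
Definition sos_pos L := all (fun l => 0 <= l.1) L.

Let pairs := [seq p <- index_enum [the finType of (V * V)%type] | ordered p].

(* Exchanging with a Beta variable turns the square of a linear form into the
   square of its conditional mean plus its conditional variance; the latter is
   a multiple of the square of the form [ind2]. *)
Definition sos_step1 (l : R * (V -> R)) : seq (R * (V -> R)) :=
  [seq (w p * l.1, avg alpha p.1 p.2 l.2) | p <- pairs] ++
  [seq (w p * (beta_var (alpha p.1) (alpha p.2) * (l.2 p.1 - l.2 p.2) ^+ 2) * l.1,
        ind2 p.1 p.2) | p <- pairs].

Definition sos_step L := flatten (map sos_step1 L).

Let big_step (G : R * (V -> R) -> R) L : \sum_(l <- sos_step L) G l =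
  \sum_(l <- L) \sum_(p | ordered p) (G (w p * l.1, avg alpha p.1 p.2 l.2) +
    G (w p * (beta_var (alpha p.1) (alpha p.2) * (l.2 p.1 - l.2 p.2) ^+ 2) * l.1,
        ind2 p.1 p.2)).
Proof.
rewrite /sos_step big_flatten/= big_map; apply: eq_bigr => l _.
by rewrite /sos_step1 big_cat/= !big_map !big_filter big_split.
Qed.

Let beta_var_ge0 x y : 0 <= beta_var (alpha x) (alpha y).
Proof.
have a0 := ltW (alpha_gt0 x); have b0 := ltW (alpha_gt0 y).
apply: divr_ge0; first exact: mulr_ge0.
by rewrite mulr_ge0 ?sqr_ge0// addr_ge0 ?addr_ge0.
Qed.

Lemma sos_step_pos L : sos_pos L -> sos_pos (sos_step L).
Proof.
rewrite /sos_step; elim: L => //= l L IH /andP[l0 /IH L0].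
rewrite /sos_pos all_cat [X in _ && X]L0 andbT all_cat !all_map; apply/andP; split; apply/allP => p _ /=.
  by rewrite mulr_ge0// rate_ge0.
by apply: mulr_ge0 => //; apply: mulr_ge0; rewrite ?rate_ge0// mulr_ge0// sqr_ge0.
Qed.

Lemma sum_ind2 x y d : x != y -> \sum_z ind2 x y z * d z = d x + d y :> R.
Proof.
move=> xy; have yx : y != x by rewrite eq_sym.
rewrite (bigD1 x)//= (bigD1 y)//= /ind2 !eqxx orbT !mul1r.
by rewrite big1 ?addr0// => z /andP[/negbTE -> /negbTE ->]; rewrite mul0r.
Qed.

Lemma sos_stepE L d : sos (sos_step L) d =
  \sum_(l <- L) l.1 * \sum_(p | ordered p) w p *
    ((\sum_z avg alpha p.1 p.2 l.2 z * d z) ^+ 2 +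
    beta_var (alpha p.1) (alpha p.2) * ((l.2 p.1 - l.2 p.2) * (d p.1 + d p.2)) ^+ 2).
Proof.
rewrite /sos big_step; apply: eq_bigr => l _.
rewrite mulr_sumr; apply: eq_bigr => p /ordered_neq pn /=.
rewrite sum_ind2//; move: (\sum_z _) => T; ring.
Qed.

Let frac_le (a b : R) : 0 <= a -> a <= b -> a / (1 + a) <= b / (b + 1).
Proof.
move=> a0 ab; have b0 := le_trans a0 ab.
have a1 : 0 < 1 + a by rewrite ltr_pwDl.
have b1 : 0 < b + 1 by rewrite ltr_wpDl.
rewrite ler_pdivrMr// mulrAC ler_pdivlMr//; nra.
Qed.

Lemma sform_step b : \sum_(p | ordered p) w p * (sf (avg alpha p.1 p.2 b) +
    beta_var (alpha p.1) (alpha p.2) * (b p.1 - b p.2) ^+ 2 * sf (ind2 p.1 p.2)) <=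
  r * sf b.
Proof.
have A1 : 0 < A + 1 by rewrite addr_gt0.
set q := a2 / (1 + a2).
pose e p := edge_weight p * (b p.1 - b p.2) ^+ 2.
have e0 p : 0 <= e p.
  rewrite mulr_ge0 ?sqr_ge0// divr_ge0 ?mulr_ge0 ?addr_ge0//; exact: ltW.
apply: (@le_trans _ _ (\sum_(p | ordered p) (w p * sf b - (A + 1) * q / total_rate c * (c p.1 p.2 * e p)))).
  apply: ler_sum => p /ordered_neq pn; rewrite sform_avg// mulrBr lerD2l lerN2.
  rewrite -/(edge_weight p) -/(e p) /rate.
  have -> : (A + 1) * q / total_rate c * (c p.1 p.2 * e p) =
    c p.1 p.2 / total_rate c * ((A + 1) * q * e p) by ring.
  (* A pair of rate 0 may violate s >= [a2], but it carries no weight. *)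
  have [c0|c0] := eqVneq (c p.1 p.2) 0; first by rewrite c0 !mul0r.
  apply: ler_wpM2l; first exact: (rate_ge0 c_ge0).
  apply: ler_wpM2r => //; apply: ler_wpM2l; first exact: ltW.
  by apply: frac_le => //; apply: a2_le => //; rewrite lt_neqAle eq_sym c0 c_ge0.
rewrite sumrB -mulr_suml sum_rate// mul1r -mulr_sumr.
rewrite /contraction mulrBl mul1r lerD2l lerN2.
(* The A + 1 of the loss and the 1/A of [gap_sform] combine into the factor 1 + 1/A. *)
have -> : gap_rate / total_rate c * sf b = (A + 1) * q / total_rate c * (g / A * sf b).
  by rewrite /gap_rate -/q; field; rewrite !gt_eqF.
apply: ler_wpM2l; last exact: gap_sform.
have q0 : 0 <= q by apply: divr_ge0 => //; rewrite ltW// ltr_pwDl.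
by apply: divr_ge0; [apply: mulr_ge0 => //; exact: ltW|exact: ltW].
Qed.

Lemma sos_sform_step L : sos_pos L -> sos_sform (sos_step L) <= r * sos_sform L.
Proof.
rewrite /sos_sform big_step; elim: L => [_|l L IH /andP[l0 /IH L0]].
  by rewrite !big_nil mulr0.
rewrite !big_cons mulrDr lerD// mulrCA; apply: le_trans (ler_wpM2l l0 (sform_step l.2)).
rewrite mulr_sumr; apply: ler_sum => p _ /=; rewrite le_eqVlt; apply/orP; left; apply/eqP.
move: (sf (avg _ _ _ _)) (sf (ind2 _ _)) => T U; ring.
Qed.

(** [sform_step] at the indicator of a vertex bounds r times a positive number from below by a sum
    of nonnegative terms. *)
Lemma contraction_ge0 : 0 <= r.
Proof.
have [x [y xy]] : exists x y : V, x != y.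
  have /card_gt0P[x _] : (0 < #|V|)%N by exact: leq_trans cardV.
  move: cardV; rewrite (cardD1 x) inE => /card_gt0P[y]; rewrite !inE andbT => yx.
  by exists y, x.
pose b z : R := (z == x)%:R.
have b0 : 0 < sf b.
  have := sform_ge alpha_gt0 b x y; rewrite /b eqxx eq_sym (negbTE xy) subr0 expr1n mulr1.
  by rewrite -(pmulr_rgt0 _ (ltr0Sn R 1)); apply: lt_le_trans; exact: mulr_gt0.
rewrite -(pmulr_lge0 _ b0); apply: le_trans (sform_step b).
apply: sumr_ge0 => p _; apply: mulr_ge0; first exact: (rate_ge0 c_ge0).
have s0 b' : 0 <= sf b' by exact: sform_ge0.
by apply: addr_ge0 => //; apply: mulr_ge0 => //; apply: mulr_ge0 => //; exact: sqr_ge0.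
Qed.

Lemma sos_iter t L : sos_pos L ->
  sos_pos (iter t sos_step L) /\ sos_sform (iter t sos_step L) <= r ^+ t * sos_sform L.
Proof.
move=> L0; elim: t => [|t [IHp IH]]; first by rewrite expr0 mul1r.
split; first exact: sos_step_pos.
rewrite iterS (le_trans (sos_sform_step IHp))// exprS -mulrA.
by apply: ler_wpM2l => //; exact: contraction_ge0.
Qed.

Local Notation D01 := (`]0, 1[%classic : set (measurableTypeR R)).

Let bounded_on_quad (q1 q2 q3 m : R) :
  bounded_on D01 (fun u => q1 + q2 * (u - m) + q3 * (u - m) ^+ 2).
Proof.
have bum : bounded_on D01 (fun u => (u : R) - m).
  exact: (bounded_onB bounded_on_id01 (bounded_on_cst _ m)).
apply: bounded_onD; last by apply: bounded_onZ; exact: bounded_onM.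
by apply: (bounded_onD (bounded_on_cst _ q1)); exact: bounded_onZ.
Qed.

Definition comb (lam : V -> R) (y : V -> config R V) : config R V :=
  mkconfig (fun z => \sum_i lam i * coord (y i) z).

(* The Jensen defects of [F] are controlled by a quadratic form. *)
Definition sos_affine F L := bdd F /\ forall (lam : V -> R) (y : V -> config R V),
  (forall i, 0 <= lam i) -> \sum_i lam i = 1 -> (forall i, S (y i)) ->
  `|F (comb lam y) - \sum_i lam i * F (y i)| <=
  \sum_i \sum_j lam i * lam j * sos L (fun z => coord (y i) z - coord (y j) z).

Lemma simplex_comb (lam : V -> R) (y : V -> config R V) : (forall i, 0 <= lam i) ->
  \sum_i lam i = 1 -> (forall i, S (y i)) -> S (comb lam y).
Proof.
move=> l0 l1 Sy; split => [z|].
  rewrite mkconfigE; apply: sumr_ge0 => i _; apply: mulr_ge0 => //.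
  by have [] := Sy i.
under eq_bigr do rewrite mkconfigE.
rewrite exchange_big/= -[RHS]l1; apply: eq_bigr => i _.
by rewrite -mulr_sumr; have [_ ->] := Sy i; rewrite mulr1.
Qed.

(** For fixed u the exchange is linear in the configuration, so several points and their barycentre
    can be coupled through one Beta variable. *)
Lemma exchange_comb (lam : V -> R) (y : V -> config R V) x z u :
  exchange (comb lam y) x z u = comb lam (fun i => exchange (y i) x z u).
Proof.
apply: config_ext => v; rewrite coord_exchange !mkconfigE.
under [RHS]eq_bigr do rewrite coord_exchange.
rewrite -big_split/= !mulr_sumr; case: ifP => _.
  by apply: eq_bigr => i _; ring.
by case: ifP => _; apply: eq_bigr => i _ //; ring.
Qed.

(** The defect bound of F is applied to the exchanged points, all with the same u, then averaged
    over u. A linear form evaluated at an exchanged difference is X + (u - m) Y, with X given by the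
    averaged form; the mean square X^2 + [beta_var] Y^2 is what [sos_step] records. *)
Lemma sos_affine_averaging F L : sos_pos L -> sos_affine F L ->
  sos_affine (K F) (sos_step L).
Proof.
move=> L0 [bF FL]; split; first exact: bdd_averaging.
move=> lam y l0 l1 Sy.
rewrite /averaging.
under [X in _ - X]eq_bigr do rewrite mulr_sumr.
rewrite exchange_big/= -sumrB (le_trans (ler_norm_sum _ _ _))//.
pose D i j z := coord (y i) z - coord (y j) z.
have -> : \sum_i \sum_j lam i * lam j * sos (sos_step L) (D i j) =
  \sum_(p | ordered p) w p * \sum_i \sum_j lam i * lam j * \sum_(l <- L) l.1 *
    ((\sum_z avg alpha p.1 p.2 l.2 z * D i j z) ^+ 2 +
    beta_var (alpha p.1) (alpha p.2) * ((l.2 p.1 - l.2 p.2) * (D i j p.1 + D i j p.2)) ^+ 2).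
  under [RHS]eq_bigr do rewrite mulr_sumr.
  rewrite [RHS]exchange_big/=; apply: eq_bigr => i _.
  under [RHS]eq_bigr do rewrite mulr_sumr.
  rewrite [RHS]exchange_big/=; apply: eq_bigr => j _.
  rewrite sos_stepE mulr_sumr.
  under [RHS]eq_bigr do rewrite !mulr_sumr.
  rewrite [RHS]exchange_big/=; apply: eq_bigr => l _.
  by rewrite !mulr_sumr; apply: eq_bigr => p _; ring.
apply: ler_sum => p /ordered_neq pn.
have -> : w p * P p F (comb lam y) - \sum_i lam i * (w p * P p F (y i)) =
   w p * (P p F (comb lam y) - \sum_i lam i * P p F (y i)).
  by rewrite mulrBr mulr_sumr; congr (_ - _); apply: eq_bigr => i _; rewrite mulrCA.
rewrite normrM (ger0_norm (rate_ge0 c_ge0 total_rate_gt0 p)).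
apply: ler_wpM2l; first exact: (rate_ge0 c_ge0).
pose m := alpha p.1 / (alpha p.1 + alpha p.2).
have mb := measurable_bet01 (alpha p.1) (alpha p.2).
have w0 := bet_ge0 (alpha_gt0 p.1) (alpha_gt0 p.2).
have w1 := integral_bet (alpha_gt0 p.1) (alpha_gt0 p.2).
have wD := bet01 (alpha p.1) (alpha p.2).
have bex eta : S eta -> bounded_on D01 (fun u => F (exchange eta p.1 p.2 u)).
  by move=> Seta; exact: bounded_on_exchange.
have Sc := simplex_comb l0 l1 Sy.
pose X (l : R * (V -> R)) i j := \sum_z avg alpha p.1 p.2 l.2 z * D i j z.
pose Y (l : R * (V -> R)) i j := (l.2 p.1 - l.2 p.2) * (D i j p.1 + D i j p.2).
(* The square of X + (u - m) Y, expanded to the shape of [wmean_beta]. *)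
pose Q l i j (u : R) := X l i j ^+ 2 + (2 * X l i j * Y l i j) * (u - m) + Y l i j ^+ 2 * (u - m) ^+ 2.
have bQ l i j : bounded_on D01 (Q l i j) by exact: bounded_on_quad.
have -> : P p F (comb lam y) - \sum_i lam i * P p F (y i) =
  wmean leb (bet (alpha p.1) (alpha p.2)) (fun u => F (exchange (comb lam y) p.1 p.2 u) -
    \sum_i lam i * F (exchange (y i) p.1 p.2 u)).
  have bs i : bounded_on D01 (fun u => lam i * F (exchange (y i) p.1 p.2 u)).
    by apply: bounded_onZ; exact: bex.
  rewrite (wmeanB mb w0 w1 wD (bex _ Sc) (bounded_on_sum _ (fun i _ => bs i))).
  congr (_ - _); rewrite (wmean_sum mb w0 w1 wD _ (fun i _ => bs i)).
  by apply: eq_bigr => i _; rewrite (wmeanZ mb w0 w1 wD _ (bex _ (Sy i))).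
have b1 i j : bounded_on D01 (fun u => \sum_(l <- L) l.1 * Q l i j u).
  by apply: bounded_on_sum => l _; exact: bounded_onZ.
have b2 i : bounded_on D01 (fun u => \sum_j lam i * lam j * \sum_(l <- L) l.1 * Q l i j u).
  by apply: bounded_on_sum => j _; exact: bounded_onZ.
have -> : \sum_i \sum_j lam i * lam j * (\sum_(l <- L) l.1 * (X l i j ^+ 2 +
      beta_var (alpha p.1) (alpha p.2) * Y l i j ^+ 2)) =
  wmean leb (bet (alpha p.1) (alpha p.2)) (fun u =>
    \sum_i \sum_j lam i * lam j * \sum_(l <- L) l.1 * Q l i j u).
  rewrite (wmean_sum mb w0 w1 wD _ (fun i _ => b2 i)); apply: eq_bigr => i _.
  rewrite (wmean_sum mb w0 w1 wD _ (fun j _ => bounded_onZ _ (b1 i j))); apply: eq_bigr => j _.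
  rewrite (wmeanZ mb w0 w1 wD _ (b1 i j)); congr (_ * _).
  rewrite (wmean_sum mb w0 w1 wD _ (fun l _ => bounded_onZ _ (bQ l i j))); apply: eq_bigr => l _.
  rewrite (wmeanZ mb w0 w1 wD _ (bQ l i j)) (mulrC (beta_var _ _)); congr (_ * _).
  exact: esym (wmean_beta _ _ _ (alpha_gt0 p.1) (alpha_gt0 p.2)).
apply: (norm_wmean_le mb w0 w1 wD).
- apply: bounded_onB; first exact: bex.
  by apply: bounded_on_sum => i _; apply: bounded_onZ; exact: bex.
- by apply: bounded_on_sum => i _; exact: b2.
move=> u; rewrite /= in_itv/= => u01; rewrite exchange_comb.
apply: le_trans (FL _ _ l0 l1 (fun i => simplex_exchange pn u01 (Sy i))) _.
rewrite le_eqVlt; apply/orP; left; apply/eqP.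
apply: eq_bigr => i _; apply: eq_bigr => j _; congr (_ * _); apply: eq_bigr => l _; congr (_ * _).
have -> : Q l i j u = (X l i j + (u - m) * Y l i j) ^+ 2 by rewrite /Q; ring.
congr (_ ^+ 2); rewrite /X /Y mulrA -(sum_exchange alpha_gt0)//.
apply: eq_bigr => z _; congr (_ * _); rewrite !coord_exchange /D.
by case: ifP => _; [ring|case: ifP => _ //; ring].
Qed.

End Contraction.

(** Log-convexity makes successive ratios nondecreasing. If the first ratio s exceeded q, the
    sequence would grow at least like s^t, against the bound C q^t. *)
Lemma logconvex_le (R : realType) (n : nat -> R) (C q : R) : 0 < q ->
  (forall t, 0 <= n t) -> (forall t, n t.+1 ^+ 2 <= n t * n t.+2) ->
  (forall t, n t <= C * q ^+ t) -> n 1%N <= q * n 0%N.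
Proof.
move=> q0 n0 nc nC; rewrite leNgt; apply/negP => h.
have n00 : 0 < n 0%N.
  rewrite lt_neqAle n0 andbT eq_sym; apply/eqP => n00; have := nc 0%N.
  by rewrite n00 mul0r leNgt exprn_gt0// (le_lt_trans _ h)// n00 mulr0.
pose s := n 1%N / n 0%N.
have sq : q < s by rewrite /s ltr_pdivlMr.
have s0 : 0 < s by exact: lt_trans sq.
have ns t : 0 < n t /\ s * n t <= n t.+1.
  elim: t => [|t [nt st]]; first by rewrite /s divfK ?gt_eqF.
  have nt1 : 0 < n t.+1 by apply: lt_le_trans st; exact: mulr_gt0.
  split => //; rewrite -(ler_pM2l nt); apply: le_trans (nc t).
  by rewrite expr2 mulrA (mulrC _ s) ler_pM2r.
have nst t : n 0%N * s ^+ t <= n t.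
  elim: t => [|t IH]; first by rewrite expr0 mulr1.
  apply: le_trans (ns t).2; rewrite exprS mulrCA.
  by rewrite ler_pM2l.
(* By Bernoulli's inequality (s/q)^t grows at least linearly, so no C can bound it. *)
pose e := s / q - 1.
have e0 : 0 < e by rewrite subr_gt0 ltr_pdivlMr// mul1r.
have bern t : 1 + t%:R * e <= (s / q) ^+ t.
  rewrite -(subrK 1 (s / q)) -/e (addrC e); elim: t => [|t IH].
    by rewrite mul0r addr0 expr0.
  have e1 : 0 <= 1 + e by rewrite addr_ge0// ltW.
  rewrite exprS; apply: le_trans (ler_wpM2l e1 IH).
  have -> : (1 + e) * (1 + t%:R * e) = 1 + t.+1%:R * e + t%:R * e ^+ 2.
    by rewrite -natr1; ring.
  by rewrite lerDl mulr_ge0// sqr_ge0.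
have eC t : n 0%N * e * t%:R <= C.
  apply: (@le_trans _ _ (n 0%N * (s / q) ^+ t)).
    rewrite -mulrA ler_pM2l// mulrC; apply: le_trans (bern t); by rewrite lerDr.
  by rewrite expr_div_n mulrA ler_pdivrMr ?exprn_gt0// (le_trans (nst t)).
have ne0 : 0 < n 0%N * e by exact: mulr_gt0.
have := eC (Num.bound (C / (n 0%N * e))); rewrite leNgt => /negP; apply.
rewrite mulrC -ltr_pdivrMr//; apply: archi_boundP.
by rewrite divr_ge0 ?(ltW ne0)// (le_trans _ (eC 0%N))// mulr0.
Qed.

(** * Exponential decay and the one-step bound *)

Section Decay.
Context {R : realType} {V : finType} (c : V -> V -> R) (alpha : V -> R).
Hypotheses (cardV : (2 <= #|V|)%N) (alpha_gt0 : forall x, 0 < alpha x).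
Hypothesis c_ge0 : forall x y, 0 <= c x y.
Hypothesis total_rate_gt0 : 0 < total_rate c.
Implicit Types (eta : config R V) (x y z : V) (b d : V -> R) (p : V * V).
Implicit Types (F f h : config R V -> R) (L : seq (R * (V -> R))).
Local Notation A := (alpha_sum alpha).
Local Notation S := (@simplex R V).
Local Notation K := (averaging c alpha).
Local Notation E := (expect alpha).
Local Notation w := (rate c).
Local Notation sf := (sform alpha).

Variables (a2 g : R).
Hypotheses (a2_ge0 : 0 <= a2) (g_ge0 : 0 <= g) (a2_leA : a2 <= A).
Hypothesis a2_le : forall x y, x != y -> 0 < c x y -> a2 <= alpha x + alpha y.
Hypothesis gap_sform : forall b, g / A * sf b <=
  \sum_(p | ordered p) c p.1 p.2 * (edge_weight alpha p * (b p.1 - b p.2) ^+ 2).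

Local Notation r := (contraction c alpha a2 g).

Let A_gt0 := alpha_sum_gt0 cardV alpha_gt0.
Let r_ge0 : 0 <= r.
Proof. exact: contraction_ge0. Qed.

Let frac_ge0 : 0 <= a2 / (1 + a2).
Proof. by apply: divr_ge0 => //; rewrite ltW// ltr_pwDl. Qed.

Let r_le1 : r <= 1.
Proof.
rewrite /contraction gerBl; apply: divr_ge0; last exact: ltW.
by rewrite mulr_ge0// mulr_ge0// addr_ge0// invr_ge0 ltW.
Qed.

(** This amounts to gamma <= 1 and comes from a2 <= A: affine functions contract at least as fast as
    the Jensen defects. *)
Let r1_le : 1 - g / total_rate c <= r.
Proof.
rewrite /contraction lerD2l lerN2 ler_pM2r ?invr_gt0// /gap_rate.
rewrite -[leRHS]mul1r; apply: ler_wpM2r => //.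
have a20 : 0 < 1 + a2 by rewrite ltr_pwDl.
rewrite mulrAC ler_pdivrMr// mul1r mulrDr mulr1 addrC lerD2r.
by rewrite ler_pdivrMr// mul1r.
Qed.

Definition vertex x : config R V := mkconfig (fun z => (z == x)%:R).

Lemma simplex_vertex x : S (vertex x).
Proof.
split => [z|]; first by rewrite mkconfigE.
under eq_bigr do rewrite mkconfigE.
by rewrite (bigD1 x)//= eqxx big1 ?addr0// => z /negbTE ->.
Qed.

Lemma comb_vertex eta : comb (coord eta) vertex = eta.
Proof.
apply: config_ext => z; rewrite mkconfigE (bigD1 z)//= mkconfigE eqxx mulr1.
by rewrite big1 ?addr0// => i iz; rewrite mkconfigE eq_sym (negbTE iz) mulr0.
Qed.

(** Summing over all pairs is a crude way to get one constant valid for every pair of vertices. *)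
Let C0 : R := 2 * \sum_x \sum_y (alpha x * alpha y)^-1.

Let C0_ge0 : 0 <= C0.
Proof.
by rewrite mulr_ge0// sumr_ge0// => x _; rewrite sumr_ge0// => y _; rewrite invr_ge0 mulr_ge0// ltW.
Qed.

Lemma sform_diff b x y : (b x - b y) ^+ 2 <= C0 * sf b.
Proof.
have axy : 0 < alpha x * alpha y by exact: mulr_gt0.
have := sform_ge alpha_gt0 b x y; rewrite mulrC -ler_pdivlMr// => h; apply: (le_trans h).
rewrite mulrAC; apply: ler_wpM2r; first exact: sform_ge0.
rewrite ler_wpM2l// (bigD1 x)//= (bigD1 y)//= -addrA lerDl addr_ge0// sumr_ge0// => z _.
  by rewrite invr_ge0 mulr_ge0// ltW.
by rewrite sumr_ge0// => u _; rewrite invr_ge0 mulr_ge0// ltW.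
Qed.

Lemma sos_vertex L x y : sos_pos L ->
  sos L (fun z => coord (vertex x) z - coord (vertex y) z) <= C0 * sos_sform alpha L.
Proof.
rewrite /sos /sos_sform; elim: L => [_|l L IH /andP[l0 /IH {}IH]].
  by rewrite !big_nil mulr0.
rewrite !big_cons mulrDr; apply: lerD => //; rewrite [leRHS]mulrCA; apply: ler_wpM2l => //.
apply: le_trans (sform_diff l.2 x y); rewrite le_eqVlt; apply/orP; left; apply/eqP.
congr (_ ^+ 2); under eq_bigr do rewrite !mkconfigE mulrBr.
rewrite sumrB (bigD1 x)//= eqxx mulr1 big1 ?addr0 => [|z /negbTE->]; last by rewrite mulr0.
by rewrite (bigD1 y)//= eqxx mulr1 big1 ?addr0// => z /negbTE->; rewrite mulr0.
Qed.

(** A configuration is the barycentre of the vertices weighted by its own coordinates, so its Jensen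
    defect is exactly the distance from F to the interpolation of its vertex values. *)
Lemma sos_affine_vertex F L eta : sos_pos L -> sos_affine F L -> S eta ->
  `|F eta - lin (fun x => F (vertex x)) eta| <= C0 * sos_sform alpha L.
Proof.
move=> L0 [_ FL] [e0 e1].
have := FL _ _ e0 e1 simplex_vertex; rewrite comb_vertex => h.
have -> : lin (fun x => F (vertex x)) eta = \sum_i coord eta i * F (vertex i).
  by apply: eq_bigr => i _; rewrite mulrC.
apply: (le_trans h).
apply: (@le_trans _ _ (\sum_i \sum_j coord eta i * coord eta j * (C0 * sos_sform alpha L))).
  apply: ler_sum => i _; apply: ler_sum => j _; apply: ler_wpM2l; first exact: mulr_ge0.
  exact: sos_vertex.
rewrite le_eqVlt; apply/orP; left; apply/eqP.
under eq_bigr do rewrite -mulr_suml -mulr_sumr e1 mulr1.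
by rewrite -mulr_suml e1 mul1r.
Qed.

Definition nrm f : R := Num.sqrt (E (f \* f)).

Let E2_ge0 f : 0 <= E (f \* f).
Proof. by apply: expect_ge0 => eta _ /=; exact: sqr_ge0. Qed.

Lemma nrm_sq f : nrm f ^+ 2 = E (f \* f).
Proof. by rewrite sqr_sqrtr. Qed.

Lemma nrm_le f (M : R) : bdd f -> 0 <= M -> (forall eta, S eta -> `|f eta| <= M) -> nrm f <= M.
Proof.
move=> bf M0 fM; rewrite -[leRHS]ger0_norm// -sqrtr_sqr ler_wsqrtr//.
rewrite -[leRHS](expect_cst cardV alpha_gt0); apply: le_expect => //.
- exact: bounded_onM.
- exact: bounded_on_cst.
move=> eta /fM h /=; rewrite -expr2 -real_normK ?num_real//.
by rewrite lerXn2r ?nnegrE.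
Qed.

Lemma nrmD f h : bdd f -> bdd h -> nrm (fun eta => f eta + h eta) <= nrm f + nrm h.
Proof.
move=> bf bh; have n0 : 0 <= nrm f + nrm h by rewrite addr_ge0 ?sqrtr_ge0.
rewrite -[leRHS]ger0_norm// -sqrtr_sqr ler_wsqrtr//.
have bff := bounded_onM bf bf; have bhh := bounded_onM bh bh; have bfh := bounded_onM bf bh.
have b2fh := bounded_onZ 2 bfh.
have -> : E ((fun eta => f eta + h eta) \* (fun eta => f eta + h eta)) =
   E (f \* f) + 2 * E (f \* h) + E (h \* h).
  rewrite -(expectZ cardV alpha_gt0 2 bfh) -(expectD cardV alpha_gt0 bff b2fh).
  rewrite -(expectD cardV alpha_gt0 (bounded_onD bff b2fh) bhh).
  by congr wmean; apply/funext => eta /=; ring.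
have cs : E (f \* h) <= nrm f * nrm h.
  have := expect_CS cardV alpha_gt0 bf bh.
  rewrite -!nrm_sq -exprMn => h'; apply: le_trans (ler_norm _) _.
  have nn : 0 <= nrm f * nrm h by rewrite mulr_ge0 ?sqrtr_ge0.
  by rewrite -(ler_pXn2r (n := 2))// ?nnegrE// real_normK ?num_real.
by rewrite sqrrD !nrm_sq lerD2r lerD2l -[leRHS]mulr_natl ler_pM2l.
Qed.

Lemma eq_nrm f h : (forall eta, S eta -> f eta = h eta) -> nrm f = nrm h.
Proof.
by move=> fh; congr Num.sqrt; apply: eq_expect => eta Seta /=; rewrite fh.
Qed.

Let sq_bound (X N a b t : R) : 0 <= t -> 0 <= N -> 0 <= X -> 0 <= a -> 0 <= b ->
  X ^+ 2 <= a * b -> a <= t * N -> b <= t * X -> X <= t ^+ 2 * N.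
Proof.
move=> t0 N0 X0 a0 b0 h1 h2 h3.
have h4 : X ^+ 2 <= (t * N) * (t * X) by apply: le_trans h1 _; exact: ler_pM.
have [->|Xn0] := eqVneq X 0; first by rewrite mulr_ge0 ?sqr_ge0.
have {}X0 : 0 < X by rewrite lt_neqAle eq_sym Xn0.
by rewrite -(ler_pM2r X0) -expr2; apply: (le_trans h4); rewrite le_eqVlt; apply/orP; left; apply/eqP; ring.
Qed.

Let le_of_lt_sq (N1 N t : R) : 0 <= t -> 0 <= N ->
  (forall q, t < q -> N1 <= q ^+ 2 * N) -> N1 <= t ^+ 2 * N.
Proof.
move=> t0 N0 nq; apply/ler_addgt0Pr => e e0.
have D0 : 0 < (2 * t + 1) * N + 1.
  by rewrite ltr_wpDl// mulr_ge0// addr_ge0// mulr_ge0.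
(* With d <= 1 the excess 2 t d N + d^2 N is at most d (2 t + 1) N; the added 1 keeps the divisor
   positive when N = 0. *)
pose d := Num.min 1 (e / ((2 * t + 1) * N + 1)).
have d0 : 0 < d by rewrite lt_min ltr01 divr_gt0.
have d1 : d <= 1 by rewrite ge_min lexx.
have de : d * ((2 * t + 1) * N + 1) <= e by rewrite -ler_pdivlMr// ge_min lexx orbT.
have := nq (t + d); rewrite ltrDl => /(_ d0) h; apply: (le_trans h).
have h2 : d * d * N <= d * N by rewrite -mulrA ler_wpM2l ?(ltW d0)// ler_piMl.
have -> : (t + d) ^+ 2 * N = t ^+ 2 * N + (2 * t * d * N + d * d * N) by ring.
by rewrite lerD2l; apply: le_trans de; nra.
Qed.

Let le_of_sq (X N N1 t : R) : 0 <= t -> 0 <= N -> X ^+ 2 <= N * N1 ->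
  N1 <= t ^+ 2 * N -> X <= t * N.
Proof.
move=> t0 N0 h1 h2; have tN : 0 <= t * N by exact: mulr_ge0.
apply: le_trans (ler_norm _) _.
rewrite -(ler_pXn2r (n := 2))// ?nnegrE// real_normK ?num_real// (le_trans h1)//.
have -> : (t * N) ^+ 2 = N * (t ^+ 2 * N) by ring.
exact: ler_wpM2l.
Qed.

(** E (l K l) falls short of E l^2 by the Dirichlet form over [total_rate], hence by at least g /
    [total_rate] times the variance; [r1_le] then weakens the rate to r. *)
Lemma expect_lin_averaging b : E (lin b) = 0 ->
  E (lin b \* K (lin b)) <= r * E (lin b \* lin b).
Proof.
move=> b0; have A1 : 0 < A + 1 by rewrite addr_gt0.
rewrite expect_mul_averaging//; [|exact: bdd_lin..].
have v := variance_lin cardV alpha_gt0 b; rewrite b0 expr0n subr0 in v.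
pose e p := edge_weight alpha p * (b p.1 - b p.2) ^+ 2.
rewrite (eq_bigr (fun p => w p * E (lin b \* lin b) -
    (c p.1 p.2 * e p) / (total_rate c * (A * (A + 1))))); last first.
  move=> p /ordered_neq pn; have /eqP := expect_lin_resample cardV alpha_gt0 b pn.
  rewrite subr_eq addrC -subr_eq => /eqP <-.
  rewrite mulrBr; congr (_ - _); rewrite -/(edge_weight alpha p) -/(e p) /rate.
  by move: (e p) (c _ _) => u v'; field; rewrite !gt_eqF.
rewrite sumrB -mulr_suml sum_rate// mul1r -mulr_suml.
apply: (@le_trans _ _ ((1 - g / total_rate c) * E (lin b \* lin b))); last first.
  by apply: ler_wpM2r.
rewrite mulrBl mul1r lerD2l lerN2 [X in _ * X]v.
have -> : g / total_rate c * (sf b / (A ^+ 2 * (A + 1))) =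
   (g / A * sf b) / (total_rate c * (A * (A + 1))).
  by field; rewrite !gt_eqF.
apply: ler_wpM2r; last exact: gap_sform.
by rewrite invr_ge0 ltW// mulr_gt0// mulr_gt0.
Qed.

Lemma averaging_lin_funE b : K (lin b) = lin (avgK c alpha b).
Proof. by apply/funext => eta; exact: averaging_lin. Qed.

(** From the form to the norm: ||K l||^2 is the form E (l K h) at h = K l. Cauchy-Schwarz for this
    form splits it, and the form bound applies to l and to K l, which is again linear and
    centered. *)
Lemma nrm_averaging_lin b : E (lin b) = 0 -> nrm (K (lin b)) <= r * nrm (lin b).
Proof.
move=> b0; have bl := @bdd_lin R V b; have bK := bdd_averaging c alpha_gt0 bl.
have K0 : E (K (lin b)) = 0 by rewrite expect_averaging.
have n0 : 0 <= r * nrm (lin b) by rewrite mulr_ge0 ?sqrtr_ge0.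
rewrite -[leRHS]ger0_norm// -sqrtr_sqr ler_wsqrtr// exprMn nrm_sq.
set X := E (K (lin b) \* K (lin b)); set N := E (lin b \* lin b).
have XE : X = E (lin b \* K (K (lin b))) by rewrite averaging_sym.
have h1 : X ^+ 2 <= E (lin b \* K (lin b)) * E (K (lin b) \* K (K (lin b))).
  by rewrite XE; exact: averaging_CS.
have h2 : E (lin b \* K (lin b)) <= r * N by exact: expect_lin_averaging.
have h3 : E (K (lin b) \* K (K (lin b))) <= r * X.
  rewrite /X averaging_lin_funE; apply: expect_lin_averaging.
  by rewrite -averaging_lin_funE.
have KK0 f : bdd f -> 0 <= E (f \* K f).
  move=> bf; rewrite (expect_mul_averaging c cardV alpha_gt0 bf bf); apply: sumr_ge0 => p _.
  by apply: mulr_ge0; [exact: (rate_ge0 c_ge0)|exact: E2_ge0].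
have X0 : 0 <= X := E2_ge0 _.
exact: (sq_bound r_ge0 (E2_ge0 _) X0 (KK0 _ bl) (KK0 _ bK) h1 h2 h3).
Qed.

Lemma sos_affine_iter F L t : sos_pos L -> sos_affine F L ->
  sos_affine (iter t K F) (iter t (sos_step c alpha) L).
Proof.
move=> L0 FL; elim: t => //= t IH; apply: sos_affine_averaging => //.
by have [] := sos_iter cardV alpha_gt0 c_ge0 total_rate_gt0 a2_ge0 a2_le gap_sform t L0.
Qed.

(** K^t F splits into [l0], the centered interpolation of its vertex values, and an error [G] of
    size O(r^t). The next [l0] is K applied to the current one plus errors, a contraction by r
    forced by terms of the same rate. Such a recursion only bounds the norm by t r^t up to a
    constant, whence some q > r. *)
Lemma nrm_iter F L q : sos_pos L -> sos_affine F L -> E F = 0 -> r < q ->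
  exists C, forall t, nrm (iter t K F) <= C * q ^+ t.
Proof.
move=> L0 FL F0 rq; have q0 : 0 < q by exact: le_lt_trans rq.
have sL0 : 0 <= sos_sform alpha L.
  rewrite /sos_sform; move: L0; rewrite /sos_pos; elim: (L) => [|l L' IH]; first by rewrite big_nil.
  move=> /andP[l0 /IH h]; rewrite big_cons addr_ge0// mulr_ge0//; exact: sform_ge0.
pose Ft t := iter t K F; pose v t x := Ft t (vertex x).
have bF t : bdd (Ft t) by exact: (bdd_iter c alpha_gt0 t FL.1).
have EF t : E (Ft t) = 0.
  elim: t => // t IH; rewrite /Ft iterS expect_averaging//; exact: bF.
pose C1 := C0 * sos_sform alpha L; have C10 : 0 <= C1 by exact: mulr_ge0.
have D1 t eta : S eta -> `|Ft t eta - lin (v t) eta| <= C1 * r ^+ t.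
  move=> Seta.
  have [Lt0 Lt] := sos_iter cardV alpha_gt0 c_ge0 total_rate_gt0 a2_ge0 a2_le gap_sform t L0.
  apply: le_trans (sos_affine_vertex Lt0 (sos_affine_iter t L0 FL) Seta) _.
  by rewrite /C1 -mulrA ler_wpM2l// mulrC.
(* On the simplex, subtracting m from every coefficient subtracts the constant m, so the centered
   function is still a [lin]. *)
pose m t := E (lin (v t)); pose l0 t := lin (fun x => v t x - m t).
have bv b := @bdd_lin R V b.
have l0E t eta : S eta -> l0 t eta = lin (v t) eta - m t.
  move=> [_ e1]; rewrite /l0 /lin; under eq_bigr do rewrite mulrBl.
  by rewrite sumrB -mulr_sumr e1 mulr1.
have bm t := bounded_on_cst S (m t).
have El0 t : E (l0 t) = 0.
  rewrite (eq_expect _ (l0E t)) (expectB cardV alpha_gt0 (bv _) (bm t)).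
  by rewrite expect_cst// subrr.
have mt t : `|m t| <= C1 * r ^+ t.
  have -> : m t = E (fun eta => lin (v t) eta - Ft t eta).
    by rewrite (expectB cardV alpha_gt0 (bv _) (bF t)) EF subr0.
  rewrite -[leRHS](expect_cst cardV alpha_gt0); apply: norm_expect_le => //.
  - exact: (bounded_onB (bv _) (bF t)).
  - exact: bounded_on_cst.
  by move=> eta /(D1 t); rewrite distrC.
pose G t eta := Ft t eta - l0 t eta; pose C2 := 2 * C1.
have C20 : 0 <= C2 by rewrite mulr_ge0.
have bG t : bdd (G t) := bounded_onB (bF t) (bv _).
have bKG t : bdd (K (G t)) := bdd_averaging c alpha_gt0 (bG t).
have Gb t eta : S eta -> `|G t eta| <= C2 * r ^+ t.
  move=> Seta; rewrite /G l0E// opprB addrA addrAC.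
  apply: le_trans (ler_normD _ _) _.
  by rewrite /C2 mulrDl mul1r mulrDl lerD// D1.
have Mt t : 0 <= C2 * r ^+ t by rewrite mulr_ge0 ?exprn_ge0.
have st t : nrm (l0 t.+1) <= r * nrm (l0 t) + 2 * C2 * r ^+ t.
  rewrite (@eq_nrm _ (fun eta => K (l0 t) eta + (K (G t) eta - G t.+1 eta))); last first.
    move=> eta Seta; rewrite addrA -averagingD//; last exact: bv.
    have -> : (fun eta => l0 t eta + G t eta) = Ft t.
      by apply/funext => eta'; rewrite /G addrC subrK.
    by rewrite /G opprB addrC -[Ft t.+1]/(K (Ft t)) subrK.
  apply: le_trans (nrmD _ _) _.
  - by apply: bdd_averaging => //; exact: bv.
  - exact: (bounded_onB (bKG t) (bG t.+1)).
  apply: lerD; first exact: (nrm_averaging_lin (El0 t)).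
  apply: nrm_le.
  - exact: (bounded_onB (bKG t) (bG t.+1)).
  - by rewrite mulr_ge0 ?exprn_ge0// mulr_ge0.
  move=> eta Seta; rewrite (le_trans (ler_normB _ _))// -mulrA mulr_natl mulr2n lerD//.
    by apply: averaging_bound => // eta'; exact: Gb.
  apply: le_trans (Gb _ _ Seta) _; rewrite ler_wpM2l// exprS ler_piMl// exprn_ge0//.
have rqt t : r ^+ t <= q ^+ t by rewrite lerXn2r ?nnegrE// ltW.
(* Chosen so that r C + 2 C2 <= q C, which closes the induction. *)
pose C := nrm (l0 0%N) + 2 * C2 / (q - r).
have qr0 : 0 < q - r by rewrite subr_gt0.
have C2q : 0 <= 2 * C2 / (q - r).
  by apply: divr_ge0; [exact: mulr_ge0|exact: ltW].
have C00 : 0 <= C by apply: addr_ge0 => //; exact: sqrtr_ge0.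
have nl t : nrm (l0 t) <= C * q ^+ t.
  elim: t => [|t IH]; first by rewrite expr0 mulr1 lerDl.
  apply: le_trans (st t) _.
  apply: (@le_trans _ _ (r * (C * q ^+ t) + 2 * C2 * q ^+ t)).
    by apply: lerD; apply: ler_wpM2l => //; rewrite mulr_ge0.
  rewrite exprS (mulrA r) (mulrA C q) -mulrDl; apply: ler_wpM2r; first by rewrite exprn_ge0// ltW.
  rewrite -lerBrDl (mulrC C q) -mulrBl -ler_pdivrMl// (mulrC (q - r)^-1).
  by rewrite lerDr sqrtr_ge0.
exists (C + C2) => t.
rewrite (@eq_nrm _ (fun eta => l0 t eta + G t eta)); last first.
  by move=> eta _; rewrite /G addrC subrK.
apply: le_trans (nrmD (bv _) (bG t)) _.
rewrite mulrDl; apply: lerD; first exact: nl.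
apply: le_trans (nrm_le (bG t) (Mt t) (Gb t)) _.
by rewrite ler_wpM2l.
Qed.

(** Decay and log-convexity give ||K F|| <= q ||F|| for each q > r, hence for r; Cauchy-Schwarz
    turns this into E (F K F) <= r E F^2. The conclusion is this bound times [total_rate], since (1
    - r) [total_rate] is [gap_rate]. *)
Lemma spectral_bound F L : sos_pos L -> sos_affine F L -> E F = 0 ->
  gap_rate alpha a2 g * E (F \* F) <= total_rate c * (E (F \* F) - E (F \* K F)).
Proof.
move=> L0 FL F0; have [bF _] := FL.
set N := E (F \* F); set N1 := E (K F \* K F); set X := E (F \* K F).
have N0 : 0 <= N := E2_ge0 _; have N10 : 0 <= N1 := E2_ge0 _.
have nq q : r < q -> N1 <= q ^+ 2 * N.
  move=> rq; have q0 : 0 < q by exact: le_lt_trans rq.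
  have [C hC] := nrm_iter L0 FL F0 rq.
  apply: (@logconvex_le _ (fun t => E (iter t K F \* iter t K F)) (C ^+ 2)) => [|t|t|t].
  - exact: exprn_gt0.
  - exact: E2_ge0.
  - exact: norm_iter_logconvex.
  rewrite -nrm_sq -exprM mulnC exprM -exprMn.
  by rewrite ler_sqr ?nnegrE ?sqrtr_ge0// (le_trans (sqrtr_ge0 _) (hC t)).
have nK : N1 <= r ^+ 2 * N by exact: le_of_lt_sq.
have XN : X <= r * N.
  exact: (le_of_sq r_ge0 N0 (expect_CS cardV alpha_gt0 bF (bdd_averaging c alpha_gt0 bF))).
apply: (@le_trans _ _ (total_rate c * (N - r * N))).
  rewrite /contraction le_eqVlt; apply/orP; left; apply/eqP.
  by move: (N) => n; field; rewrite gt_eqF.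
by rewrite ler_pM2l// lerD2l lerN2.
Qed.

End Decay.

(** * Density in L^2 *)

Section SmoothFunctions.
Context {R : realType}.

(* A C^{1,1} approximation of the indicator of ]a, +oo[. *)
Definition soft_step (m a t : R) : R := 1 - (1 + m * Num.max (t - a) 0 ^+ 2)^-1.

Definition soft_step' (m a t : R) : R :=
  2 * m * Num.max (t - a) 0 * (1 + m * Num.max (t - a) 0 ^+ 2)^-1 ^+ 2.

Variables (m a : R).
Hypothesis m_ge0 : 0 <= m.

Let psi_bound (p : R) : 0 < (1 + m * p ^+ 2)^-1 <= 1.
Proof.
have p0 : 0 <= m * p ^+ 2 by rewrite mulr_ge0 ?sqr_ge0.
have p1 : 0 < 1 + m * p ^+ 2 by rewrite ltr_pwDl.
by rewrite invr_gt0 p1 invf_le1// lerDl.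
Qed.

Lemma soft_step_ge0 t : 0 <= soft_step m a t.
Proof. by rewrite subr_ge0; have /andP[] := psi_bound (Num.max (t - a) 0). Qed.

Lemma soft_step_le1 t : soft_step m a t <= 1.
Proof. by rewrite gerBl ltW//; have /andP[] := psi_bound (Num.max (t - a) 0). Qed.

Lemma measurable_soft_step : measurable_fun setT (soft_step m a).
Proof.
apply: measurable_funB => //.
have -> : (fun t => (1 + m * Num.max (t - a) 0 ^+ 2)^-1) =
    (fun t => (1 + m * Num.max (t - a) 0 ^+ 2) `^ (-1)).
  apply/funext => t; rewrite powR_inv1//.
  by rewrite -invr_ge0 ltW//; have /andP[] := psi_bound (Num.max (t - a) 0).
apply: (measurableT_comp (f := @powR R ^~ (-1))); first exact: measurable_powR.
apply: measurable_funD => //; apply: measurable_funM => //.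
apply: measurable_funX; apply: measurable_maxr => //.
exact: measurable_funB.
Qed.

Let max_lip (t s : R) : (Num.max (s - a) 0 - Num.max (t - a) 0) ^+ 2 <= (s - t) ^+ 2.
Proof.
have -> : s - t = (s - a) - (t - a) by ring.
move: (s - a) (t - a) => x y.
by case: (lerP x 0) => hx; case: (lerP y 0) => hy;
  rewrite ?subrr ?expr0n ?sqr_ge0// ?sub0r ?subr0 ?sqrrN; nra.
Qed.

Let max_sq (t s : R) : 0 <= Num.max (s - a) 0 ^+ 2 - Num.max (t - a) 0 ^+ 2 -
  2 * Num.max (t - a) 0 * (s - t) <= (s - t) ^+ 2.
Proof.
have -> : s - t = (s - a) - (t - a) by ring.
move: (s - a) (t - a) => x y.
have y2 := sqr_ge0 y; have x2 := sqr_ge0 x; have xy2 := sqr_ge0 (x - y).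
case: (lerP x 0) => hx; case: (lerP y 0) => hy; rewrite ?expr0n/= ?mulr0 ?mul0r ?subr0 ?sub0r.
- by rewrite lexx.
- have xy : x * y <= 0 by rewrite pmulr_lle0.
  by apply/andP; split; nra.
- have xy : x * y <= 0 by rewrite pmulr_rle0.
  by apply/andP; split; nra.
- have -> : x ^+ 2 - y ^+ 2 - 2 * y * (x - y) = (x - y) ^+ 2 by ring.
  by rewrite lexx andbT.
Qed.

(** From u m p^2 = 1 - u and v m q^2 = 1 - v, the damped sum u v m (p^2 + q^2) is at most 2 for all
    p and q; this makes the Lipschitz and Taylor constants global. *)
Let key (p q d : R) : (q - p) ^+ 2 <= d ^+ 2 ->
  let u := (1 + m * p ^+ 2)^-1 in let v := (1 + m * q ^+ 2)^-1 in
  (m * (q ^+ 2 - p ^+ 2)) ^+ 2 * u * v <= 4 * m * d ^+ 2.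
Proof.
move=> qpd; set u := (1 + m * p ^+ 2)^-1; set v := (1 + m * q ^+ 2)^-1 => /=.
have /andP[u0 u1] := psi_bound p; have /andP[v0 v1] := psi_bound q.
rewrite -/u in u0 u1; rewrite -/v in v0 v1.
have uE : u * (1 + m * p ^+ 2) = 1 by rewrite mulVf// gt_eqF// -invr_gt0.
have vE : v * (1 + m * q ^+ 2) = 1 by rewrite mulVf// gt_eqF// -invr_gt0.
have h1 : u * v * (m * (p ^+ 2 + q ^+ 2)) <= 2.
  have -> : u * v * (m * (p ^+ 2 + q ^+ 2)) =
    v * (u * (1 + m * p ^+ 2)) + u * (v * (1 + m * q ^+ 2)) - 2 * (u * v) by ring.
  rewrite uE vE !mulr1; have : 0 < u * v by exact: mulr_gt0.
  lra.
have h2 : (q + p) ^+ 2 <= 2 * (p ^+ 2 + q ^+ 2).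
  have -> : 2 * (p ^+ 2 + q ^+ 2) = (q + p) ^+ 2 + (p - q) ^+ 2 by ring.
  by rewrite lerDl sqr_ge0.
have uv0 : 0 <= u * v by rewrite ltW// mulr_gt0.
have -> : (m * (q ^+ 2 - p ^+ 2)) ^+ 2 * u * v = m * ((q - p) ^+ 2 * (u * v * (m * (q + p) ^+ 2))) by ring.
have -> : 4 * m * d ^+ 2 = m * (d ^+ 2 * (2 * 2)) by ring.
apply: ler_wpM2l => //; apply: ler_pM => //; first exact: sqr_ge0.
  by apply: mulr_ge0 => //; apply: mulr_ge0 => //; exact: sqr_ge0.
apply: (@le_trans _ _ (2 * (u * v * (m * (p ^+ 2 + q ^+ 2))))); last by rewrite ler_pM2l.
have -> : 2 * (u * v * (m * (p ^+ 2 + q ^+ 2))) = u * v * (m * (2 * (p ^+ 2 + q ^+ 2))) by ring.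
by apply: ler_wpM2l => //; exact: ler_wpM2l.
Qed.

Lemma soft_step_lip t s : (soft_step m a s - soft_step m a t) ^+ 2 <= 4 * m * (s - t) ^+ 2.
Proof.
set p := Num.max (t - a) 0; set q := Num.max (s - a) 0.
rewrite /soft_step -/p -/q.
have := key (max_lip t s); rewrite -/p -/q /=.
have := psi_bound p; have := psi_bound q.
have p1 : 1 + m * p ^+ 2 != 0 by rewrite gt_eqF// ltr_pwDl// mulr_ge0 ?sqr_ge0.
have q1 : 1 + m * q ^+ 2 != 0 by rewrite gt_eqF// ltr_pwDl// mulr_ge0 ?sqr_ge0.
set u := (1 + m * p ^+ 2)^-1; set v := (1 + m * q ^+ 2)^-1 => /andP[v0 v1] /andP[u0 u1] h.
have -> : 1 - v - (1 - u) = m * (q ^+ 2 - p ^+ 2) * u * v.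
  by rewrite /u /v; field; rewrite p1 q1.
apply: le_trans h; set X := m * _.
have -> : (X * u * v) ^+ 2 = X ^+ 2 * u * v * (u * v) by ring.
rewrite ler_piMr//; last by rewrite mulr_ile1// ltW.
by apply: mulr_ge0; [apply: mulr_ge0; [exact: sqr_ge0|]|]; exact: ltW.
Qed.

Lemma soft_step_taylor t s :
  `|soft_step m a s - soft_step m a t - soft_step' m a t * (s - t)| <= 5 * m * (s - t) ^+ 2.
Proof.
set p := Num.max (t - a) 0; set q := Num.max (s - a) 0.
rewrite /soft_step /soft_step' -/p -/q.
have := key (max_lip t s); have := max_sq t s; rewrite -/p -/q /=.
have := psi_bound p; have := psi_bound q.
have p1 : 1 + m * p ^+ 2 != 0 by rewrite gt_eqF// ltr_pwDl// mulr_ge0 ?sqr_ge0.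
have q1 : 1 + m * q ^+ 2 != 0 by rewrite gt_eqF// ltr_pwDl// mulr_ge0 ?sqr_ge0.
set u := (1 + m * p ^+ 2)^-1; set v := (1 + m * q ^+ 2)^-1 => /andP[v0 v1] /andP[u0 u1].
set d := s - t; set rho := (X in 0 <= X <= _) => /andP[rho0 rho1].
set X := m * (q ^+ 2 - p ^+ 2) => h.
(* As u - v = X u v, the Taylor remainder is m u^2 times the remainder rho of the squared positive
   part, minus a term quadratic in X. They contribute 1 and 4 to the constant 5. *)
have -> : 1 - v - (1 - u) - 2 * m * p * u ^+ 2 * d = m * rho * u ^+ 2 - X ^+ 2 * u * v * u.
  by rewrite /X /rho /u /v; field; rewrite p1 q1.
have mr0 : 0 <= m * rho by exact: mulr_ge0.
have Xuv0 : 0 <= X ^+ 2 * u * v.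
  by apply: mulr_ge0; [apply: mulr_ge0; [exact: sqr_ge0|]|]; exact: ltW.
have a0 : 0 <= m * rho * u ^+ 2 by apply: mulr_ge0 => //; exact: sqr_ge0.
have a1 : m * rho * u ^+ 2 <= m * d ^+ 2.
  rewrite -[leRHS]mulr1; apply: ler_pM => //; [exact: sqr_ge0|exact: ler_wpM2l|].
  by rewrite expr2 mulr_ile1// ltW.
have b0 : 0 <= X ^+ 2 * u * v * u by apply: mulr_ge0 => //; exact: ltW.
have b1 : X ^+ 2 * u * v * u <= 4 * m * d ^+ 2.
  by apply: le_trans h; rewrite ler_piMr.
have -> : 5 * m * d ^+ 2 = m * d ^+ 2 + 4 * m * d ^+ 2 by ring.
apply: le_trans (ler_normB _ _) _; rewrite !ger0_norm//.
exact: lerD.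
Qed.

End SmoothFunctions.

(** * Functions with C^{1,1} regularity and their Jensen defects *)

Section SmoothConfig.
Context {R : realType} {V : finType}.
Implicit Types (eta zeta : config R V) (F H : config R V -> R) (L : seq (R * (V -> R))).

Definition dist2 zeta eta : R := \sum_z (coord zeta z - coord eta z) ^+ 2.

(** One constant M controls the values, the squared increments and the first-order Taylor remainder,
    with [G] as gradient. All bounds are global on R^V, which makes the class stable under
    products. *)
Definition smooth F := measurable_fun setT F /\
  exists (M : R) (G : config R V -> V -> R), [/\ 0 <= M, forall eta, `|F eta| <= M,
    forall eta zeta, (F zeta - F eta) ^+ 2 <= M * dist2 zeta eta &
    forall eta zeta, `|F zeta - F eta - \sum_z G eta z * (coord zeta z - coord eta z)| <=
      M * dist2 zeta eta].

Let dist2_ge0 zeta eta : 0 <= dist2 zeta eta.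
Proof. by apply: sumr_ge0 => z _; exact: sqr_ge0. Qed.

Lemma smooth_cst k : smooth (cst k).
Proof.
split => //; exists `|k|, (fun _ _ => 0); split => // eta zeta.
  by rewrite subrr expr0n mulr_ge0.
by rewrite subrr sub0r big1 ?oppr0 ?normr0 ?mulr_ge0// => z _; rewrite mul0r.
Qed.

Lemma smooth_soft_step (m a : R) x : 0 <= m -> smooth (fun eta => soft_step m a (coord eta x)).
Proof.
move=> m0; split.
  by apply: measurableT_comp (measurable_coord x); exact: measurable_soft_step.
exists (1 + 5 * m), (fun eta z => if z == x then soft_step' m a (coord eta x) else 0).
have dx eta zeta : (coord zeta x - coord eta x) ^+ 2 <= dist2 zeta eta.
  by rewrite /dist2 (bigD1 x)//= lerDl; apply: sumr_ge0 => z _; exact: sqr_ge0.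
split.
- by rewrite addr_ge0 ?mulr_ge0.
- move=> eta; rewrite ger0_norm ?soft_step_ge0// (le_trans (soft_step_le1 a m0 _))//.
  by rewrite lerDl mulr_ge0.
- move=> eta zeta; apply: le_trans (soft_step_lip a m0 _ _) _.
  apply: ler_pM => //; [by rewrite mulr_ge0|exact: sqr_ge0|].
  by apply: ler_wpDl => //; apply: ler_wpM2r => //; rewrite ler_nat.
move=> eta zeta; rewrite (bigD1 x)//= eqxx big1 ?addr0 => [|z /negbTE->]; last by rewrite mul0r.
apply: le_trans (soft_step_taylor a m0 _ _) _.
by apply: ler_pM => //; [by rewrite mulr_ge0|exact: sqr_ge0|rewrite lerDr].
Qed.

Lemma smoothM F H : smooth F -> smooth H -> smooth (F \* H).
Proof.
move=> [mF [M [G [M0 FM FL FT]]]] [mH [N [G' [N0 HN HL HT]]]].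
split; first exact: measurable_funM.
pose C := M * N + 2 * M ^+ 2 * N + 2 * N ^+ 2 * M + 2 * M * N + M + N.
exists C, (fun eta z => G eta z * H eta + F eta * G' eta z).
have M2 : 0 <= M ^+ 2 by exact: sqr_ge0.
have N2 : 0 <= N ^+ 2 by exact: sqr_ge0.
have MN : 0 <= M * N by exact: mulr_ge0.
have M2N : 0 <= M ^+ 2 * N by exact: mulr_ge0.
have N2M : 0 <= N ^+ 2 * M by exact: mulr_ge0.
have sqle (k x : R) : `|x| <= k -> x ^+ 2 <= k ^+ 2.
  move=> xk; rewrite -real_normK ?num_real// lerXn2r ?nnegrE//; exact: le_trans xk.
split.
- by rewrite /C; lra.
- by move=> eta /=; rewrite normrM (le_trans (ler_pM _ _ (FM eta) (HN eta)))// /C; lra.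
- move=> eta zeta /=; set D := dist2 zeta eta; have D0 : 0 <= D := dist2_ge0 _ _.
  have -> : F zeta * H zeta - F eta * H eta =
    F zeta * (H zeta - H eta) + H eta * (F zeta - F eta) by ring.
  set x := F zeta * _; set y := H eta * _.
  have x2 : x ^+ 2 <= M ^+ 2 * (N * D).
    by rewrite exprMn; apply: ler_pM; [exact: sqr_ge0|exact: sqr_ge0|exact: sqle|exact: HL].
  have y2 : y ^+ 2 <= N ^+ 2 * (M * D).
    by rewrite exprMn; apply: ler_pM; [exact: sqr_ge0|exact: sqr_ge0|exact: sqle|exact: FL].
  have xy : (x + y) ^+ 2 <= 2 * x ^+ 2 + 2 * y ^+ 2.
    have -> : 2 * x ^+ 2 + 2 * y ^+ 2 = (x + y) ^+ 2 + (x - y) ^+ 2 by ring.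
    by rewrite lerDl sqr_ge0.
  apply: (le_trans xy); apply: (@le_trans _ _ ((2 * M ^+ 2 * N + 2 * N ^+ 2 * M) * D)).
    have -> : (2 * M ^+ 2 * N + 2 * N ^+ 2 * M) * D =
      2 * (M ^+ 2 * (N * D)) + 2 * (N ^+ 2 * (M * D)) by ring.
    by apply: lerD; rewrite ler_pM2l.
  by apply: ler_wpM2r => //; rewrite /C; lra.
move=> eta zeta /=; set D := dist2 zeta eta; have D0 : 0 <= D := dist2_ge0 _ _.
pose d z := coord zeta z - coord eta z.
have -> : \sum_z (G eta z * H eta + F eta * G' eta z) * (coord zeta z - coord eta z) =
    H eta * (\sum_z G eta z * d z) + F eta * (\sum_z G' eta z * d z).
  by rewrite !mulr_sumr -big_split/=; apply: eq_bigr => z _; rewrite /d; ring.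
have := FT eta zeta; have := HT eta zeta; rewrite -/D.
set g := \sum_z G eta z * _; set g' := \sum_z G' eta z * _ => hH hF.
rewrite -/g -/g'.
(* The remainder of a product: one remainder per factor, plus the product of both increments, which
   is of second order. *)
have -> : F zeta * H zeta - F eta * H eta - (H eta * g + F eta * g') =
  H eta * (F zeta - F eta - g) + F eta * (H zeta - H eta - g') +
  (F zeta - F eta) * (H zeta - H eta) by ring.
have e1 : `|H eta * (F zeta - F eta - g)| <= N * (M * D) by rewrite normrM; exact: ler_pM.
have e2 : `|F eta * (H zeta - H eta - g')| <= M * (N * D) by rewrite normrM; exact: ler_pM.
have e3 : `|(F zeta - F eta) * (H zeta - H eta)| <= (M + N) * D.
  have := FL eta zeta; have := HL eta zeta; rewrite -/D.
  move: (F zeta - F eta) (H zeta - H eta) => x y y2 x2.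
  rewrite normrM mulrDl; apply: le_trans (lerD x2 y2).
  rewrite -(real_normK (num_real x)) -(real_normK (num_real y)).
  have := sqr_ge0 (`|x| - `|y|); have := normr_ge0 x; have := normr_ge0 y.
  move: `|x| `|y| => u v; nra.
apply: le_trans (ler_normD _ _) _; apply: le_trans (lerD (ler_normD _ _) (lexx _)) _.
apply: le_trans (lerD (lerD e1 e2) e3) _.
have -> : N * (M * D) + M * (N * D) + (M + N) * D = (2 * M * N + M + N) * D by ring.
by apply: ler_wpM2r => //; rewrite /C; lra.
Qed.

Lemma smooth_prod (I : Type) (r : seq I) (F : I -> config R V -> R) :
  (forall i, smooth (F i)) -> smooth (fun eta => \prod_(i <- r) F i eta).
Proof.
move=> sF; elim: r => [|i r IH].
  by under eq_fun do rewrite big_nil; exact: smooth_cst.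
under eq_fun do rewrite big_cons.
exact: (smoothM (sF i) IH).
Qed.

Definition almost_affine F := exists2 L, sos_pos L & sos_affine F L.

(** In the Taylor expansion at the barycentre the gradient terms cancel. The remainder M sum lam_i
    |y_i - eta|^2 is half of M sum lam_i lam_j |y_i - y_j|^2, so M times the squared Euclidean norm
    serves as quadratic form. *)
Lemma smooth_almost_affine F : smooth F -> almost_affine F.
Proof.
move=> [mF [M [G [M0 FM _ FT]]]].
exists [seq (M, fun z => (z == x)%:R) | x <- index_enum V].
  by rewrite /sos_pos all_map; apply/allP => x _.
split; first by split => //; exists M => eta _; exact: FM.
move=> lam y l0 l1 Sy; set eta := comb lam y.
have G0 : \sum_i lam i * (\sum_z G eta z * (coord (y i) z - coord eta z)) = 0.
  under eq_bigr do rewrite mulr_sumr.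
  rewrite exchange_big/= big1// => z _.
  rewrite (eq_bigr (fun i => G eta z * (lam i * coord (y i) z - lam i * coord eta z))).
    by rewrite -mulr_sumr sumrB -mulr_suml l1 mul1r mkconfigE subrr mulr0.
  by move=> i _; ring.
have -> : F eta - \sum_i lam i * F (y i) =
  - \sum_i lam i * (F (y i) - F eta - \sum_z G eta z * (coord (y i) z - coord eta z)).
  under [in RHS]eq_bigr do rewrite !mulrBr.
  by rewrite !sumrB G0 subr0 -mulr_suml l1 mul1r opprB.
rewrite normrN; apply: le_trans (ler_norm_sum _ _ _) _.
apply: (@le_trans _ _ (\sum_i lam i * (M * dist2 (y i) eta))).
  by apply: ler_sum => i _; rewrite normrM (ger0_norm (l0 i)); apply: ler_wpM2l.
have sosE (d : V -> R) : sos [seq (M, fun z => (z == x)%:R) | x <- index_enum V] d =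
    M * \sum_z d z ^+ 2.
  rewrite /sos big_map mulr_sumr; apply: eq_bigr => x _ /=; congr (_ * _ ^+ 2).
  by rewrite (bigD1 x)//= eqxx mul1r big1 ?addr0// => z /negbTE ->; rewrite mul0r.
under [leRHS]eq_bigr do under eq_bigr do rewrite sosE mulrCA.
under [leRHS]eq_bigr do rewrite -mulr_sumr.
under [leLHS]eq_bigr do rewrite mulrCA.
rewrite -!mulr_sumr; apply: ler_wpM2l => //.
rewrite /dist2; under eq_bigr do rewrite mulr_sumr.
rewrite exchange_big/=.
under [leRHS]eq_bigr do under eq_bigr do rewrite mulr_sumr.
under [leRHS]eq_bigr do rewrite exchange_big/=.
rewrite [leRHS]exchange_big/=; apply: ler_sum => z _.
have aE : coord eta z = \sum_i lam i * coord (y i) z by rewrite mkconfigE.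
set a := coord eta z; pose b i := coord (y i) z.
pose q := \sum_i lam i * b i ^+ 2.
have lE : \sum_i lam i * (b i - a) ^+ 2 = q - a ^+ 2.
  rewrite (eq_bigr (fun i => lam i * b i ^+ 2 - 2 * a * (lam i * b i) + lam i * a ^+ 2)).
    by rewrite big_split/= sumrB -mulr_sumr -mulr_suml l1 -/q /b -aE -/a; ring.
  by move=> i _; ring.
have rE : \sum_i \sum_j lam i * lam j * (b i - b j) ^+ 2 = 2 * (q - a ^+ 2).
  rewrite (eq_bigr (fun i => lam i * b i ^+ 2 - 2 * a * (lam i * b i) + lam i * q)).
    by rewrite big_split/= sumrB -mulr_sumr -mulr_suml l1 -/q /b -aE -/a; ring.
  move=> i _; rewrite (eq_bigr (fun j => lam i * b i ^+ 2 * lam j - 2 * lam i * b i * (lam j * b j) +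
     lam i * (lam j * b j ^+ 2))).
    by rewrite big_split/= sumrB -!mulr_sumr l1 -/q /b -aE -/a; ring.
  by move=> j _; ring.
rewrite -/(b _) lE rE mulr_natl mulr2n lerDl -lE; apply: sumr_ge0 => i _.
by rewrite mulr_ge0// sqr_ge0.
Qed.

Lemma almost_affineZ k F : almost_affine F -> almost_affine (fun eta => k * F eta).
Proof.
move=> [L L0 [bF FL]]; exists [seq (`|k| * l.1, l.2) | l <- L].
  by rewrite /sos_pos all_map; apply/sub_all : L0 => l /= l0; rewrite mulr_ge0.
split; first exact: bounded_onZ.
move=> lam y l0 l1 Sy.
have -> : k * F (comb lam y) - \sum_i lam i * (k * F (y i)) =
    k * (F (comb lam y) - \sum_i lam i * F (y i)).
  by rewrite mulrBr mulr_sumr; congr (_ - _); apply: eq_bigr => i _; rewrite mulrCA.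
have sosE (d : V -> R) : sos [seq (`|k| * l.1, l.2) | l <- L] d = `|k| * sos L d.
  by rewrite /sos big_map mulr_sumr; apply: eq_bigr => l _; rewrite /= -mulrA.
under [leRHS]eq_bigr do under eq_bigr do rewrite sosE mulrCA.
under [leRHS]eq_bigr do rewrite -mulr_sumr.
by rewrite -mulr_sumr normrM; apply: ler_wpM2l => //; exact: FL.
Qed.

Lemma almost_affineD F H : almost_affine F -> almost_affine H ->
  almost_affine (fun eta => F eta + H eta).
Proof.
move=> [L L0 [bF FL]] [L' L'0 [bH HL]]; exists (L ++ L').
  by rewrite /sos_pos all_cat; apply/andP.
split; first exact: bounded_onD.
move=> lam y l0 l1 Sy.
have -> : F (comb lam y) + H (comb lam y) - \sum_i lam i * (F (y i) + H (y i)) =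
    (F (comb lam y) - \sum_i lam i * F (y i)) + (H (comb lam y) - \sum_i lam i * H (y i)).
  by under eq_bigr do rewrite mulrDr; rewrite big_split/=; ring.
apply: le_trans (ler_normD _ _) _.
apply: le_trans (lerD (FL _ _ l0 l1 Sy) (HL _ _ l0 l1 Sy)) _.
rewrite -big_split/=; apply: ler_sum => i _; rewrite -big_split/=; apply: ler_sum => j _.
by rewrite /sos big_cat mulrDr.
Qed.

End SmoothConfig.

Lemma ge0_integral_comb d (T : measurableType d) (R : realType) (m : {measure set T -> \bar R})
    (k l : R) (f g : T -> \bar R) : 0 <= k -> 0 <= l ->
  measurable_fun setT f -> (forall t, 0 <= f t)%E ->
  measurable_fun setT g -> (forall t, 0 <= g t)%E ->
  (\int[m]_t (k%:E * f t + l%:E * g t) = k%:E * \int[m]_t f t + l%:E * \int[m]_t g t)%E.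
Proof.
move=> k0 l0 mf f0 mg g0; rewrite ge0_integralD//.
- by rewrite !ge0_integralZl_EFin.
- by move=> t _; rewrite mule_ge0.
- exact: measurable_funeM.
- by move=> t _; rewrite mule_ge0.
- exact: measurable_funeM.
Qed.

(** * Closure of a vector space of functions in L^2 *)

Section L2Density.
Context d (T : measurableType d) (R : realType) (P : probability T R).
Implicit Types f g h : T -> R.
Local Open Scope ereal_scope.

Definition dist_sq f g := \int[P]_t ((f t - g t) ^+ 2)%:E.

Let msq f g : measurable_fun setT f -> measurable_fun setT g ->
  measurable_fun setT (fun t => ((f t - g t) ^+ 2)%:E).
Proof.
move=> mf mg; apply/measurable_EFinP; apply: measurable_funX.
exact: measurable_funB.
Qed.

Lemma dist_sqD f f' g g' : measurable_fun setT f -> measurable_fun setT f' ->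
  measurable_fun setT g -> measurable_fun setT g' ->
  dist_sq (fun t => f t + f' t)%R (fun t => g t + g' t)%R <=
  2%:E * dist_sq f g + 2%:E * dist_sq f' g'.
Proof.
move=> mf mf' mg mg'; have n2 := ler0n R 2.
have d0 h h' t : 0 <= ((h t - h' t : R) ^+ 2)%:E by rewrite lee_fin sqr_ge0.
rewrite -(ge0_integral_comb P n2 n2 (msq mf mg) (d0 f g) (msq mf' mg') (d0 f' g')).
apply: ge0_le_integral => //.
- by move=> t _; rewrite lee_fin sqr_ge0.
- by apply: msq; exact: measurable_funD.
- by apply: emeasurable_funD; apply: measurable_funeM; exact: msq.
move=> t _; rewrite -!EFinM -EFinD lee_fin.
have -> : (2 * (f t - g t) ^+ 2 + 2 * (f' t - g' t) ^+ 2 =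
  (f t + f' t - (g t + g' t)) ^+ 2 + (f t - g t - (f' t - g' t)) ^+ 2)%R by ring.
by rewrite lerDl sqr_ge0.
Qed.

Lemma dist_sq_triangle f g h : measurable_fun setT f -> measurable_fun setT g ->
  measurable_fun setT h -> dist_sq f h <= 2%:E * dist_sq f g + 2%:E * dist_sq g h.
Proof.
move=> mf mg mh; apply: le_trans (dist_sqD mf mg mg mh).
suff -> : dist_sq f h = dist_sq (fun t => f t + g t)%R (fun t => g t + h t)%R by [].
by apply: eq_integral => t _; congr (_ ^+ 2)%:E; ring.
Qed.

Lemma dist_sq_cvg0 f (f_ : nat -> T -> R) g (e : R) :
  measurable_fun setT f -> (forall n, measurable_fun setT (f_ n)) ->
  P.-integrable setT (EFin \o g) -> (forall n t, ((f t - f_ n t) ^+ 2 <= g t)%R) ->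
  (forall t, f_ n t @[n --> \oo] --> f t) -> (0 < e)%R ->
  exists n, dist_sq f (f_ n) <= e%:E.
Proof.
move=> mf mf_ ig fg cf e0.
have c0 : dist_sq f (f_ n) @[n --> \oo] --> \int[P]_t cst 0 t.
  apply: (@dominated_cvg _ _ _ P setT measurableT _ _ (EFin \o g)) => //.
  - by move=> n; exact: msq.
  - move=> t _; apply: cvg_EFin; first exact: nearW.
    have : (f t - f_ n t)%R @[n --> \oo] --> (f t - f t)%R by apply: cvgB => //; exact: cvg_cst.
    rewrite subrr => h; rewrite -[X in _ --> X](mulr0 0%R).
    exact: (cvgM h h).
  - by move=> n t _; rewrite gee0_abs ?lee_fin ?sqr_ge0.
rewrite integral0 in c0.
apply: contrapT => /forallNP h.
have : e%:E <= limn (fun n => dist_sq f (f_ n)).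
  apply: lime_ge; first by apply/cvg_ex; exists 0.
  by apply: nearW => n; have /negP := h n; rewrite -ltNge => /ltW.
by rewrite (cvg_lim _ c0)// lee_fin leNgt e0.
Qed.

Variable A : (T -> R) -> Prop.
Hypothesis mA : forall f, A f -> measurable_fun setT f.
Hypothesis AD : forall f g, A f -> A g -> A (fun t => f t + g t)%R.
Hypothesis AZ : forall k f, A f -> A (fun t => k * f t)%R.

Definition approximable f := measurable_fun setT f /\
  forall e : R, (0 < e)%R -> exists2 F, A F & dist_sq f F <= e%:E.

Lemma approximable_lim f : measurable_fun setT f ->
  (forall e : R, (0 < e)%R -> exists2 g, approximable g & dist_sq f g <= e%:E) ->
  approximable f.
Proof.
move=> mf H; split => // e e0; have e4 : (0 < e / 4)%R by rewrite divr_gt0.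
have [g [mg gA] fg] := H _ e4; have [F AF gF] := gA _ e4.
exists F => //; apply: le_trans (dist_sq_triangle mf mg (mA AF)) _.
have -> : e%:E = 2%:E * (e / 4)%:E + 2%:E * (e / 4)%:E.
  by rewrite -!EFinM -EFinD; congr EFin; field.
by apply: leeD; apply: lee_wpmul2l; rewrite ?lee_fin.
Qed.

Lemma approximableZ k f : approximable f -> approximable (fun t => k * f t)%R.
Proof.
(* The divisor k^2 + 1 stays positive when k = 0. *)
move=> [mf fA]; split; first exact: measurable_funM.
move=> e e0; have k0 : (0 < k ^+ 2 + 1)%R by rewrite ltr_wpDl// sqr_ge0.
have [F AF fF] := fA (e / (k ^+ 2 + 1))%R (divr_gt0 e0 k0).
exists (fun t => k * F t)%R; first exact: AZ.
have -> : dist_sq (fun t => k * f t)%R (fun t => k * F t)%R = (k ^+ 2)%:E * dist_sq f F.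
  rewrite /dist_sq -ge0_integralZl//; last 3 first.
  - exact: msq (mA AF).
  - by move=> t _; rewrite lee_fin sqr_ge0.
  - by rewrite lee_fin sqr_ge0.
  by apply: eq_integral => t _; rewrite -EFinM -mulrBr exprMn.
apply: (@le_trans _ _ ((k ^+ 2)%:E * (e / (k ^+ 2 + 1))%:E)).
  by apply: lee_wpmul2l => //; rewrite lee_fin sqr_ge0.
by rewrite -EFinM lee_fin mulrA ler_pdivrMr// mulrC ler_pM2l// lerDl.
Qed.

Lemma approximableD f g : approximable f -> approximable g ->
  approximable (fun t => f t + g t)%R.
Proof.
move=> [mf fA] [mg gA]; split; first exact: measurable_funD.
move=> e e0; have e4 : (0 < e / 4)%R by rewrite divr_gt0.
have [F AF fF] := fA _ e4; have [G AG gG] := gA _ e4.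
exists (fun t => F t + G t)%R; first exact: AD.
apply: le_trans (dist_sqD mf mg (mA AF) (mA AG)) _.
have -> : e%:E = 2%:E * (e / 4)%:E + 2%:E * (e / 4)%:E.
  by rewrite -!EFinM -EFinD; congr EFin; field.
by apply: leeD; apply: lee_wpmul2l; rewrite ?lee_fin.
Qed.

Lemma approximable_sub f : A f -> approximable f.
Proof.
move=> Af; split; first exact: mA.
move=> e e0; exists f => //; rewrite /dist_sq.
under eq_integral do rewrite subrr expr0n/=.
by rewrite integral0 lee_fin ltW.
Qed.

Lemma approximable_sum (I : Type) (r : seq I) (F : I -> T -> R) :
  A (cst 0%R) -> (forall i, approximable (F i)) ->
  approximable (fun t => \sum_(i <- r) F i t)%R.
Proof.
move=> A0 AF; elim: r => [|i r IH].
  by under eq_fun do rewrite big_nil; exact: approximable_sub.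
under eq_fun do rewrite big_cons.
exact: approximableD.
Qed.

Hypothesis A1 : A (cst 1%R).
Variable G : set (set T).
Hypothesis GE : @measurable _ T = <<s G >>.
Hypothesis GI : setI_closed G.
Hypothesis GA : forall B, G B -> approximable \1_B.

Let A0 : A (cst 0%R).
Proof. by have := AZ 0%R A1; congr A; apply/funext => t; rewrite mul0r. Qed.

(** Dynkin's pi-lambda theorem: complements come from linearity and the constant 1, countable
    disjoint unions from dominated convergence of the partial sums. *)
Lemma approximable_indic B : measurable B -> approximable \1_B.
Proof.
rewrite GE; apply: (@dynkin_induction _ _ _ (fun B => approximable \1_B) GE GI) => //.
- have := approximable_sub A1; congr approximable; apply/funext => t.
  by rewrite indicT.
- move=> S mS AS.
  have := approximableD (approximable_sub A1) (approximableZ (-1) AS).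
  congr approximable; apply/funext => t.
  by rewrite /= mulN1r !indicE in_setC; case: (t \in S) => /=; rewrite ?subrr ?subr0.
move=> F mF tF AF; apply: approximable_lim; first by apply: measurable_indic; exact: bigcupT_measurable.
move=> e e0.
pose f_ n : T -> R := (fun t => \sum_(i <- index_iota 0 n) \1_(F i) t)%R.
have f_0 n t : ~ (\bigcup_k F k) t -> f_ n t = 0%R.
  move=> nt; rewrite /f_ big1// => i _; rewrite indicE memNset// => Ft.
  by apply: nt; exists i.
have f_1 n t k : F k t -> f_ n t = (k < n)%N%:R.
  move=> Fk; rewrite /f_ (eq_bigr (fun i => (i == k)%:R)) => [|i _].
    elim: n => [|n IH]; first by rewrite big_nil.
    rewrite -/(index_iota 0 n.+1) big_nat_recr//= IH.
    have -> : (k < n.+1)%N = (n == k) || (k < n)%N by rewrite ltnS leq_eqVlt eq_sym.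
    by case: eqVneq => [->|_]; rewrite ?ltnn ?add0r ?addr0.
  rewrite indicE; have [->|ik] := eqVneq i k; first by rewrite mem_set.
  rewrite memNset// => Fi; move/eqP: ik; apply.
  by apply: tF => //; exists t.
have mf_ n : measurable_fun setT (f_ n).
  by apply: measurable_sum => i; exact: measurable_indic.
have [n fn] : exists n, dist_sq \1_(\bigcup_k F k) (f_ n) <= e%:E.
  apply: (@dist_sq_cvg0 _ _ (cst 1%R)) => //.
  - by apply: measurable_indic; exact: bigcupT_measurable.
  - exact: finite_measure_integrable_cst.
  - move=> n t; have [[k _ Fk]|nt] := pselect ((\bigcup_k F k) t).
      rewrite indicE mem_set; last by exists k.
      by rewrite (f_1 _ _ _ Fk); case: (k < n)%N; rewrite ?subrr ?subr0 ?expr1n ?expr0n.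
    by rewrite indicE memNset// f_0// subrr expr0n.
  move=> t; apply: cvg_near_cst.
  have [[k _ Fk]|nt] := pselect ((\bigcup_k F k) t).
    exists k.+1 => // n /= kn; rewrite (f_1 _ _ _ Fk) kn indicE mem_set//.
    by exists k.
  by apply: nearW => n; rewrite indicE memNset// f_0.
by exists (f_ n) => //; exact: approximable_sum.
Qed.

Lemma approximable_nnsfun (f : {nnsfun T >-> R}) : approximable f.
Proof.
rewrite (_ : (f : T -> R) = fun t =>
    (\sum_(r <- finmap.enum_fset (fset_set (range f))) r * \1_(f @^-1` [set r]) t)%R).
  apply: approximable_sum => // r; apply: approximableZ; exact: approximable_indic.
by apply/funext => t; rewrite fimfunE fsbig_finite.
Qed.

Let approximable_ge0 f : measurable_fun setT f -> (forall t, 0 <= f t)%R ->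
  P.-integrable setT (EFin \o (fun t => f t ^+ 2)%R) -> approximable f.
Proof.
move=> mf f0 if2; apply: approximable_lim => // e e0.
have mfE : measurable_fun setT (EFin \o f) by exact/measurable_EFinP.
pose f_ := nnsfun_approx measurableT mfE.
have f_f n t : (f_ n t <= f t)%R.
  rewrite -lee_fin nnsfun_approxE; apply: (@le_approx _ _ _ setT (EFin \o f)) => // x _.
  by rewrite lee_fin.
have [n fn] : exists n, dist_sq f (f_ n) <= e%:E.
  apply: (@dist_sq_cvg0 _ _ (fun t => f t ^+ 2)%R) => //.
    move=> n t; have f_0 : (0 <= f_ n t)%R by [].
    by rewrite lerXn2r ?nnegrE ?subr_ge0// gerBl.
  move=> t.
  have : EFin \o f_ ^~ t @ \oo --> (f t)%:E.
    by apply: cvg_nnsfun_approx => // x _; rewrite lee_fin.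
  by move/fine_cvg.
by exists (f_ n) => //; exact: approximable_nnsfun.
Qed.

Lemma approximable_Lfun2 f : measurable_fun setT f ->
  P.-integrable setT (EFin \o (fun t => f t ^+ 2)%R) -> approximable f.
Proof.
move=> mf if2.
have fE : f = (fun t => Num.max (f t) 0 + -1 * Num.max (- f t) 0)%R.
  by apply/funext => t; case: (lerP (f t) 0); case: (lerP (- f t) 0) => h1 h2; lra.
rewrite fE; apply: approximableD; last apply: approximableZ.
- apply: approximable_ge0.
  + exact: measurable_maxr.
  + by move=> t; rewrite le_max lexx orbT.
  apply: le_integrable if2 => //.
    by apply/measurable_EFinP; apply: measurable_funX; exact: measurable_maxr.
  move=> t _; rewrite /= lee_fin !ger0_norm ?sqr_ge0//.
  by case: (lerP (f t) 0) => h //; rewrite expr0n sqr_ge0.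
- have mNf : measurable_fun setT (fun t => - f t)%R by exact: measurable_funN.
  apply: approximable_ge0.
  + exact: measurable_maxr.
  + by move=> t; rewrite le_max lexx orbT.
  apply: le_integrable if2 => //.
    by apply/measurable_EFinP; apply: measurable_funX; exact: measurable_maxr.
  move=> t _; rewrite /= lee_fin !ger0_norm ?sqr_ge0//.
  by case: (lerP (- f t) 0) => h; rewrite ?expr0n ?sqr_ge0// sqrrN.
Qed.

End L2Density.

Section DirichletDensity.
Context {R : realType} {V : finType} (alpha : V -> R).
Local Notation mu := (dirichlet alpha).
Implicit Types (eta : config R V) (F : config R V -> R).

(** A generating pi-system: with lists, intersection is concatenation, and the empty list gives the
    whole space. *)
Definition orthant (s : seq (V * R)) : set (config R V) :=
  [set eta | all (fun p => p.2 < coord eta p.1) s].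

Lemma measurable_orthant s : measurable (orthant s).
Proof.
elim: s => [|p s IH]; first by rewrite (_ : orthant _ = setT)//; apply/seteqP; split.
rewrite (_ : orthant _ = ((coord ^~ p.1) @^-1` `]p.2, +oo[) `&` orthant s).
  apply: measurableI => //; rewrite -[X in measurable X]setTI.
  exact: measurable_coord.
apply/seteqP; split => eta; rewrite /orthant/= in_itv/= andbT.
  by move=> /andP[].
by move=> [-> ->].
Qed.

Lemma measurable_configE :
  @measurable _ (config R V) = <<s range orthant >>.
Proof.
apply/seteqP; split; last first.
  apply: smallest_sub; first exact: sigma_algebra_measurable.
  by move=> _ [s _ <-]; exact: measurable_orthant.
apply: smallest_sub; first exact: smallest_sigma_algebra.
apply: (big_ind (fun X : set (set (config R V)) => X `<=` <<s range orthant >>)) =>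
  [//|X Y hX hY|i _]; first by move=> B [/hX|/hY].
move=> _ [C mC <-].
have mi : @measurable_fun _ _ (g_sigma_algebraType (range orthant)) R setT (fun x : config R V => tnth x i).
  apply: (measurability _ (RGenOInfty.measurableE R)) => _ [_ [a ->] <-].
  apply: sub_sigma_algebra; exists [:: (enum_val i, a)] => //.
  by apply/seteqP; split => x; rewrite /orthant/= /coord enum_valK in_itv/= !andbT => // -[].
exact: mi.
Qed.

Lemma setI_closed_orthant : setI_closed (range orthant).
Proof.
move=> _ _ [s _ <-] [t _ <-]; exists (s ++ t) => //.
by apply/seteqP; split => eta; rewrite /orthant/= all_cat => /andP.
Qed.

Let step n (s : seq (V * R)) eta : R := \prod_(p <- s) soft_step n.+1%:R p.2 (coord eta p.1).

(** At t = a every soft step vanishes, so the limit is the indicator of a strict inequality, as in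
    [orthant]. *)
Lemma soft_step_cvg (a t : R) : soft_step n.+1%:R a t @[n --> \oo] --> ((a < t)%R%:R : R).
Proof.
have [at0|ta] := ltP a t; last first.
  apply: cvg_near_cst; apply: nearW => n; rewrite /soft_step.
  by rewrite (_ : Num.max _ _ = 0) ?expr0n ?mulr0 ?addr0 ?invr1 ?subrr//; apply/max_idPr; rewrite subr_le0.
have q0 : 0 < (t - a) ^+ 2 by rewrite exprn_gt0// subr_gt0.
rewrite -[X in _ --> X](subr0 1); apply: cvgB; first exact: cvg_cst.
apply: (@squeeze_cvgr _ _ _ _ (cst 0) (fun n => ((t - a) ^+ 2)^-1 * harmonic n)).
- apply: nearW => n; rewrite (_ : Num.max _ _ = t - a); last by apply/max_idPl; rewrite subr_ge0 ltW.
  have n0 : 0 < n.+1%:R * (t - a) ^+ 2 by exact: mulr_gt0.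
  have n1 : 0 < 1 + n.+1%:R * (t - a) ^+ 2 by rewrite addr_gt0.
  apply/andP; split; first by rewrite /cst invr_ge0 ltW.
  by rewrite /harmonic -invfM [X in _ <= X^-1]mulrC lef_pV2 ?posrE// lerDr.
- exact: cvg_cst.
by rewrite -(mulr0 ((t - a) ^+ 2)^-1); apply: cvgM; [exact: cvg_cst|exact: cvg_harmonic].
Qed.

Let step_cvg s eta : step n s eta @[n --> \oo] --> (\1_(orthant s) eta : R).
Proof.
elim: s => [|p s IH].
  rewrite /step; under eq_fun do rewrite big_nil.
  by rewrite indicE mem_set//; exact: cvg_cst.
rewrite /step; under eq_fun do rewrite big_cons.
have -> : \1_(orthant (p :: s)) eta = (p.2 < coord eta p.1)%R%:R * \1_(orthant s) eta :> R.
  rewrite !indicE -natrM mulnb; congr (nat_of_bool _)%:R.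
  apply/idP/andP; first by move/set_mem => /andP[? ?]; split => //; exact/mem_set.
  by move=> [? /set_mem ?]; apply/mem_set/andP.
apply: cvgM; [exact: soft_step_cvg|exact: IH].
Qed.

Lemma Lfun2_almost_affine F e : measurable_fun setT F ->
  mu.-integrable setT (EFin \o (fun eta => F eta ^+ 2)) -> 0 < e ->
  exists2 H, almost_affine H & (dist_sq mu F H <= e%:E)%E.
Proof.
move=> mF iF.
have smooth_step n s : smooth (step n s) by apply: smooth_prod => p; exact: smooth_soft_step.
have [] // := @approximable_Lfun2 _ _ _ mu almost_affine _ _ _ _ (range orthant)
  measurable_configE setI_closed_orthant _ F mF iF.
- by move=> f [L _ [[]]].
- exact: almost_affineD.
- exact: almost_affineZ.
- exact/smooth_almost_affine/smooth_cst.
- move=> _ [s _ <-].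
  split; first by apply: measurable_indic; exact: measurable_orthant.
  move=> e' e'0.
  have [n sn] : exists n, (dist_sq mu \1_(orthant s) (step n s) <= e'%:E)%E.
    apply: (@dist_sq_cvg0 _ _ _ mu _ _ (cst 1)) => //.
    - by apply: measurable_indic; exact: measurable_orthant.
    - by move=> n; case: (smooth_step n s).
    - exact: finite_measure_integrable_cst.
    - move=> n eta.
      have s0 : 0 <= step n s eta by apply: prodr_ge0 => p _; exact: soft_step_ge0.
      have s1 : step n s eta <= 1.
        by apply: prodr_ile1 => p; rewrite soft_step_ge0//= soft_step_le1.
      have [i0 i1] : 0 <= (\1_(orthant s) eta : R) /\ (\1_(orthant s) eta : R) <= 1.
        by rewrite indicE; case: (_ \in _).
      rewrite -real_normK ?num_real// expr_le1// ler_norml; lra.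
  by exists (step n s) => //; exact: smooth_almost_affine.
by move=> _ H e0; exact: H.
Qed.

End DirichletDensity.

(** * The Dirichlet form *)

(** The two sides differ by a square divided by d. As d tends to 0 the weight of the main term tends
    to 1, at the price of a large weight on the error. *)
Lemma young_sqr (R : realFieldType) (d s t p q : R) : 0 < d ->
  (s - t) ^+ 2 <= (1 + d) * (p - q) ^+ 2 + (1 + d^-1) * (s - p - (t - q)) ^+ 2.
Proof.
move=> d0; rewrite -subr_ge0.
rewrite (_ : _ - _ = d^-1 * (d * (p - q) - (s - p - (t - q))) ^+ 2).
  by rewrite mulr_ge0 ?sqr_ge0// invr_ge0 ltW.
by field; rewrite gt_eqF.
Qed.

(** * Energy of the jumps along one pair *)

Section JumpEnergy.
Context {R : realType} {V : finType} (alpha : V -> R).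
Hypotheses (cardV : (2 <= #|V|)%N) (alpha_gt0 : forall x, 0 < alpha x).
Local Notation leb := (@lebesgue_measure R).
Local Notation mu := (dirichlet alpha).
Local Notation S := (@simplex R V).
Variables (x y : V).
Hypothesis xy : x != y.
Implicit Types (eta : config R V) (f g F : config R V -> R).
Local Notation b := (bet (alpha x) (alpha y)).
Local Notation P := (resample alpha x y).
Local Notation ex := (fun eta u => exchange eta x y u).

Let mb : @measurable_fun _ _ (measurableTypeR R) R setT b := measurable_bet01 _ _.
Let b0 u : 0 <= b u := bet_ge0 (alpha_gt0 x) (alpha_gt0 y) u.
Let b1 : (\int[leb]_u (b u)%:E = 1)%E := integral_bet (alpha_gt0 x) (alpha_gt0 y).

Definition jump f eta : \bar R := (\int[leb]_u (b u * (f eta - f (ex eta u)) ^+ 2)%:E)%E.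

Definition jump_energy f : \bar R := (\int[mu]_eta jump f eta)%E.

(** The mean of f^2 after resampling, kept in the extended reals: for f in L^2(mu) finiteness holds
    only almost everywhere. *)
Definition resample_sq f eta : \bar R := (\int[leb]_u (b u * f (ex eta u) ^+ 2)%:E)%E.

Let measurable_inner (phi : config R V * measurableTypeR R -> R) : measurable_fun setT phi ->
  (forall p, 0 <= phi p) ->
  measurable_fun setT (fun eta => \int[leb]_u (b u * phi (eta, u))%:E)%E.
Proof.
move=> mphi phi0.
apply: (measurable_fun_fubini_tonelli_F (m2 := leb) (fun p => (b p.2 * phi p)%:E)).
  apply/measurable_EFinP; apply: measurable_funM => //.
  by apply: measurableT_comp measurable_snd; exact: measurable_bet.
by move=> p; rewrite lee_fin mulr_ge0.
Qed.

Let mex f : measurable_fun setT f ->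
  measurable_fun setT (fun p : config R V * measurableTypeR R => f (exchange p.1 x y p.2)).
Proof. by move=> mf; exact: (measurableT_comp mf (measurable_exchange x y)). Qed.

Let mfst f : measurable_fun setT f ->
  measurable_fun setT (fun p : config R V * measurableTypeR R => f p.1).
Proof. by move=> mf; exact: (measurableT_comp mf measurable_fst). Qed.

Let mexu f eta : measurable_fun setT f ->
  @measurable_fun _ _ (measurableTypeR R) R setT (fun u => f (ex eta u)).
Proof. by move=> mf; exact: (measurableT_comp (mex mf) (measurable_pair1 eta)). Qed.

Lemma measurable_jump f : measurable_fun setT f -> measurable_fun setT (jump f).
Proof.
move=> mf; apply: (@measurable_inner (fun p => (f p.1 - f (exchange p.1 x y p.2)) ^+ 2)).
  by apply: measurable_funX; apply: measurable_funB; [exact: mfst|exact: mex].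
by move=> p; exact: sqr_ge0.
Qed.

Lemma measurable_resample_sq f : measurable_fun setT f -> measurable_fun setT (resample_sq f).
Proof.
move=> mf; apply: (@measurable_inner (fun p => f (exchange p.1 x y p.2) ^+ 2)).
  by apply: measurable_funX; exact: mex.
by move=> p; exact: sqr_ge0.
Qed.

Lemma jump_ge0 f eta : (0 <= jump f eta)%E.
Proof. by apply: integral_ge0 => u _; rewrite lee_fin mulr_ge0// sqr_ge0. Qed.

Lemma resample_sq_ge0 f eta : (0 <= resample_sq f eta)%E.
Proof. by apply: integral_ge0 => u _; rewrite lee_fin mulr_ge0// sqr_ge0. Qed.

Lemma integral_resample_sq f : measurable_fun setT f ->
  (\int[mu]_eta resample_sq f eta = \int[mu]_eta (f eta ^+ 2)%:E)%E.
Proof.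
move=> mf; rewrite -(ge0_integral_exchange cardV alpha_gt0 xy (f := fun eta => (f eta ^+ 2)%:E))//.
- by apply/measurable_EFinP; exact: measurable_funX.
- by move=> eta; rewrite lee_fin sqr_ge0.
Qed.

Let comb_integral (k l : R) (g h : R -> R) : 0 <= k -> 0 <= l ->
  @measurable_fun _ _ (measurableTypeR R) R setT g -> (forall u, 0 <= g u) ->
  @measurable_fun _ _ (measurableTypeR R) R setT h -> (forall u, 0 <= h u) ->
  (\int[leb]_u (b u * (k * g u + l * h u))%:E =
   k%:E * \int[leb]_u (b u * g u)%:E + l%:E * \int[leb]_u (b u * h u)%:E)%E.
Proof.
move=> k0 l0 mg g0 mh h0.
have mbg : measurable_fun setT (fun u : measurableTypeR R => (b u * g u)%:E).
  by apply/measurable_EFinP; exact: measurable_funM.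
have mbh : measurable_fun setT (fun u : measurableTypeR R => (b u * h u)%:E).
  by apply/measurable_EFinP; exact: measurable_funM.
have bg0 u : (0 <= (b u * g u)%:E)%E by rewrite lee_fin mulr_ge0.
have bh0 u : (0 <= (b u * h u)%:E)%E by rewrite lee_fin mulr_ge0.
rewrite -(ge0_integral_comb leb k0 l0 mbg bg0 mbh bh0).
by apply: eq_integral => u _; rewrite -!EFinM -EFinD; congr EFin; ring.
Qed.

Lemma le_jump (k l : R) f (g h : R -> R) eta : measurable_fun setT f -> 0 <= k -> 0 <= l ->
  @measurable_fun _ _ (measurableTypeR R) R setT g -> (forall u, 0 <= g u) ->
  @measurable_fun _ _ (measurableTypeR R) R setT h -> (forall u, 0 <= h u) ->
  (forall u, (f eta - f (ex eta u)) ^+ 2 <= k * g u + l * h u) ->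
  (jump f eta <= k%:E * \int[leb]_u (b u * g u)%:E + l%:E * \int[leb]_u (b u * h u)%:E)%E.
Proof.
move=> mf k0 l0 mg g0 mh h0 le; rewrite -comb_integral//; apply: ge0_le_integral => //.
- by move=> u _; rewrite lee_fin mulr_ge0// sqr_ge0.
- apply/measurable_EFinP; apply: measurable_funM => //; apply: measurable_funX.
  by apply: measurable_funB => //; exact: mexu.
- apply/measurable_EFinP; apply: measurable_funM => //.
  by apply: measurable_funD; apply: measurable_funM.
by move=> u _; rewrite lee_fin ler_wpM2l.
Qed.

Let sq_integral f : measurable_fun setT f ->
  measurable_fun setT (fun eta => (f eta ^+ 2)%:E) /\ (forall eta, (0 <= (f eta ^+ 2)%:E)%E).
Proof.
move=> mf; split; first by apply/measurable_EFinP; exact: measurable_funX.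
by move=> eta; rewrite lee_fin sqr_ge0.
Qed.

(** (s - t)^2 <= 2 s^2 + 2 t^2, and resampling preserves the mean of f^2. Small L^2 errors therefore
    have small energy. *)
Lemma jump_energy_le f : measurable_fun setT f ->
  (jump_energy f <= 4%:E * \int[mu]_eta (f eta ^+ 2)%:E)%E.
Proof.
move=> mf; have [msq sq0] := sq_integral mf; have mr := measurable_resample_sq mf.
have r0 := resample_sq_ge0 f.
rewrite (_ : 4%:E = 2%:E + 2%:E)%E; last by rewrite -EFinD; congr EFin; ring.
rewrite ge0_muleDl// -{2}integral_resample_sq//.
have n2 := ler0n R 2.
rewrite -(ge0_integral_comb mu n2 n2 msq sq0 mr r0).
apply: ge0_le_integral => //.
- by move=> eta _; exact: jump_ge0.
- exact: measurable_jump.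
- by apply: emeasurable_funD; exact: measurable_funeM.
move=> eta _.
have := @le_jump 2 2 f (cst (f eta ^+ 2)) (fun u => f (ex eta u) ^+ 2) eta
  mf (ler0n R 2) (ler0n R 2) _ _ _ _ _.
have -> : (\int[leb]_u (b u * cst (f eta ^+ 2) u)%:E = (f eta ^+ 2)%:E)%E.
  rewrite -[RHS]mule1 -b1 -ge0_integralZl_EFin//.
  - by apply: eq_integral => u _; rewrite -EFinM mulrC.
  - by move=> u _; rewrite lee_fin.
  - exact/measurable_EFinP.
  - exact: sqr_ge0.
apply => //.
- by move=> u; exact: sqr_ge0.
- by apply: measurable_funX; exact: mexu.
- by move=> u; exact: sqr_ge0.
move=> u; rewrite /cst; move: (f eta) (f (ex eta u)) => s t.
by rewrite -subr_ge0 (_ : _ - _ = (s + t) ^+ 2) ?sqr_ge0//; ring.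
Qed.

Lemma jump_energy_split (d : R) f g : 0 < d -> measurable_fun setT f -> measurable_fun setT g ->
  (jump_energy f <= (1 + d)%:E * jump_energy g +
    (1 + d^-1)%:E * jump_energy (fun eta => f eta - g eta)%R)%E.
Proof.
move=> d0 mf mg; have mh := measurable_funB mf mg.
have mjg := measurable_jump mg; have mjh := measurable_jump mh.
have k0 : 0 <= 1 + d by rewrite addr_ge0// ltW.
have l0 : 0 <= 1 + d^-1 by rewrite addr_ge0// invr_ge0 ltW.
rewrite -(ge0_integral_comb mu k0 l0 mjg (jump_ge0 _) mjh (jump_ge0 _)).
apply: ge0_le_integral => //.
- by move=> eta _; exact: jump_ge0.
- exact: measurable_jump.
- by apply: emeasurable_funD; exact: measurable_funeM.
move=> eta _; apply: le_jump => //.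
- by apply: measurable_funX; apply: measurable_funB => //; exact: mexu.
- by move=> u; exact: sqr_ge0.
- by apply: measurable_funX; apply: measurable_funB => //; exact: mexu.
- by move=> u; exact: sqr_ge0.
by move=> u; exact: young_sqr.
Qed.

Lemma jump_energyB f (k : R) : jump_energy (fun eta => f eta - k) = jump_energy f.
Proof.
apply: eq_integral => eta _; apply: eq_integral => u _; congr (_ * _ ^+ 2)%:E; ring.
Qed.

Let integrable_b : leb.-integrable setT (EFin \o b).
Proof.
apply/integrableP; split; first exact/measurable_EFinP.
under eq_integral do rewrite abse_EFin ger0_norm//.
by rewrite b1 ltry.
Qed.

Lemma integrable_resample_sq f eta : measurable_fun setT f -> (resample_sq f eta < +oo)%E ->
  leb.-integrable setT (EFin \o (fun u => b u * f (ex eta u) ^+ 2)).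
Proof.
move=> mf foo; apply/integrableP; split.
  by apply/measurable_EFinP; apply: measurable_funM => //; apply: measurable_funX; exact: mexu.
apply: le_lt_trans foo; rewrite le_eqVlt; apply/orP; left; apply/eqP.
apply: eq_integral => u _;
  rewrite /= ger0_norm//; apply: mulr_ge0 => //; exact: sqr_ge0.
Qed.

Lemma integrable_resample f eta : measurable_fun setT f -> (resample_sq f eta < +oo)%E ->
  leb.-integrable setT (EFin \o (fun u => b u * f (ex eta u))).
Proof.
move=> mf foo; pose g u := f (ex eta u).
have mg : @measurable_fun _ _ (measurableTypeR R) R setT g := mexu _ mf.
have ib : leb.-integrable setT (EFin \o b) := integrable_b.
have ibg2 := integrable_resample_sq mf foo.
apply: (le_integrable measurableT _ _ (integrableD measurableT ib ibg2)).
  by apply/measurable_EFinP; exact: measurable_funM.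
move=> u _; rewrite /= -/(g u) lee_fin normrM (ger0_norm (b0 u)).
rewrite [leRHS]ger0_norm; last by rewrite addr_ge0// mulr_ge0// sqr_ge0.
rewrite -[X in _ <= X + _]mulr1 -mulrDr; apply: ler_wpM2l => //.
rewrite -(real_normK (num_real (g u))).
have := sqr_ge0 (`|g u| - 2^-1); have := normr_ge0 (g u); move: `|g u| => t; nra.
Qed.

Lemma quad_resample f eta (k : R) : measurable_fun setT f -> (resample_sq f eta < +oo)%E ->
  (\int[leb]_u (b u * (k - f (ex eta u)) ^+ 2)%:E =
   (k ^+ 2 - 2 * k * P f eta + fine (resample_sq f eta))%:E)%E.
Proof.
move=> mf foo; pose g u := f (ex eta u).
have ib : leb.-integrable setT (EFin \o b) := integrable_b.
have ibg2 : leb.-integrable setT (EFin \o (fun u => b u * g u ^+ 2)) := integrable_resample_sq mf foo.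
have ibg : leb.-integrable setT (EFin \o (fun u => b u * g u)) := integrable_resample mf foo.
have i1 : leb.-integrable setT (EFin \o (fun u => k ^+ 2 * b u)).
  by have := integrableZl measurableT (k ^+ 2) ib.
have i2 : leb.-integrable setT (EFin \o (fun u => (- 2 * k) * (b u * g u))).
  by have := integrableZl measurableT (- 2 * k) ibg.
transitivity (\int[leb]_u (k ^+ 2 * b u + (- 2 * k) * (b u * g u) + b u * g u ^+ 2)%:E)%E.
  by apply: eq_integral => u _; congr EFin; rewrite /g; ring.
have i12 : leb.-integrable setT (EFin \o (fun u => k ^+ 2 * b u + (- 2 * k) * (b u * g u))).
  by have := integrableD measurableT i1 i2.
have i123 : leb.-integrable setT (EFin \o (fun u => k ^+ 2 * b u + (- 2 * k) * (b u * g u) + b u * g u ^+ 2)).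
  by have := integrableD measurableT i12 ibg2.
rewrite -[LHS]fineK; last exact: (integrable_fin_num measurableT i123).
congr EFin.
rewrite -[LHS]/(Rintegral leb setT (fun u => k ^+ 2 * b u + (- 2 * k) * (b u * g u) + b u * g u ^+ 2)).
rewrite (RintegralD measurableT i12 ibg2) (RintegralD measurableT i1 i2).
have -> : \int[leb]_u (k ^+ 2 * b u) = k ^+ 2.
  rewrite (@RintegralZl _ _ _ leb setT b)// (_ : Rintegral _ _ _ = 1) ?mulr1//.
  exact: (congr1 fine b1).
have -> : \int[leb]_u (- 2 * k * (b u * g u)) = - 2 * k * P f eta.
  by rewrite (@RintegralZl _ _ _ leb setT (fun u => b u * g u)).
by congr (_ + _); ring.
Qed.

Lemma jumpE f eta : measurable_fun setT f -> (resample_sq f eta < +oo)%E ->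
  jump f eta = (f eta ^+ 2 - 2 * f eta * P f eta + fine (resample_sq f eta))%:E.
Proof. exact: quad_resample. Qed.

Lemma resample_sqE f eta : bdd f -> S eta -> resample_sq f eta = (P (f \* f) eta)%:E.
Proof.
move=> bf Seta; rewrite /resample.
rewrite -(EFin_wmean mb b0 b1 (bet01 _ _) (bounded_on_exchange xy Seta (bounded_onM bf bf))).
by apply: eq_integral => u _ /=; rewrite expr2.
Qed.

Lemma jump_energy_bdd f : bdd f ->
  jump_energy f = (2 * (expect alpha (f \* f) - expect alpha (f \* P f)))%:E.
Proof.
move=> bf; have [mf _] := bf; have bff := bounded_onM bf bf.
have bPf := bdd_resample alpha_gt0 xy bf; have bPff := bdd_resample alpha_gt0 xy bff.
have bfPf := bounded_onM bf bPf; have b2 := bounded_onZ 2 bfPf.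
have bB := bounded_onB bff b2.
transitivity (\int[mu]_eta ((f \* f) eta - 2 * (f \* P f) eta + P (f \* f) eta)%:E)%E.
  apply: ae_eq_integral => //; first exact: measurable_jump.
    by apply/measurable_EFinP; case: (bounded_onD bB bPff).
  apply: filterS (ae_dirichlet_simplex cardV alpha_gt0) => eta Seta _.
  have rE := resample_sqE bf Seta.
  rewrite jumpE//; last by rewrite rE ltry.
  by rewrite rE /=; congr EFin; ring.
rewrite (integral_expect cardV alpha_gt0 (bounded_onD bB bPff)); congr EFin.
rewrite (expectD cardV alpha_gt0 bB bPff) (expectB cardV alpha_gt0 bff b2).
rewrite (expectZ cardV alpha_gt0 2 bfPf) (expect_resample cardV alpha_gt0 xy bff).
ring.
Qed.

(** [generator] integrates over the closed interval, where powers of 0 take conventional values,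
    whereas [bet] is cut off there. The integrands agree inside, and the endpoints are null. *)
Lemma generator_termE f eta : measurable_fun setT f ->
  \int[leb]_(u in `[0, 1]) (beta_density (alpha x) (alpha y) u * (f (ex eta u) - f eta)) =
  \int[leb]_u (b u * (f (ex eta u) - f eta)).
Proof.
move=> mf; rewrite [RHS](_ : _ = \int[leb]_(u in `]0, 1[) (b u * (f (ex eta u) - f eta))); last first.
  rewrite [RHS]Rintegral_mkcond; apply: eq_Rintegral => u _; rewrite patchE.
  case: (boolP (u \in _)) => //; rewrite notin_setE/= in_itv/= => /negP u01.
  by rewrite bet_out// mul0r.
have mbf : @measurable_fun _ _ (measurableTypeR R) R setT (fun u => b u * (f (ex eta u) - f eta)).
  by apply: measurable_funM => //; apply: measurable_funB => //; exact: mexu.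
have e u : `]0, 1[%classic u -> beta_density (alpha x) (alpha y) u = b u.
  by rewrite /= in_itv/= => u01; rewrite beta_densityE.
rewrite -[RHS](@eq_Rintegral _ _ _ leb _ _
  (fun u => beta_density (alpha x) (alpha y) u * (f (ex eta u) - f eta))); last first.
  by move=> u /set_mem u01; rewrite e.
have md : @measurable_fun _ _ (measurableTypeR R) R (`]0%R, 1%R[%classic)
    (fun u => beta_density (alpha x) (alpha y) u * (f (ex eta u) - f eta)).
  apply: (eq_measurable_fun (fun u => b u * (f (ex eta u) - f eta))).
    by move=> u /set_mem u01; rewrite e.
  exact: measurable_funTS.
congr fine; rewrite -integral_itv_bndo_bndc; last first.
  by apply/measurable_EFinP; exact/measurable_fun_itv_obnd_cbndP.
by rewrite -integral_itv_obnd_cbnd//; exact/measurable_EFinP.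
Qed.

Lemma generator_term f eta : measurable_fun setT f -> (resample_sq f eta < +oo)%E ->
  \int[leb]_u (b u * (f (ex eta u) - f eta)) = P f eta - f eta.
Proof.
move=> mf foo; have ig := integrable_resample mf foo.
have ik : leb.-integrable setT (EFin \o (fun u => b u * f eta)).
  exact: (wmean_integrable mb b0 b1 (bet01 _ _) (bounded_on_cst _ (f eta))).
under eq_Rintegral do rewrite mulrBr.
rewrite (RintegralB measurableT ig ik); congr (_ - _).
exact: (wmean_cst mb b0 b1 (bet01 _ _)).
Qed.

End JumpEnergy.

Section DirichletForm.
Context {R : realType} {V : finType} (c : V -> V -> R) (alpha : V -> R).
Hypotheses (cardV : (2 <= #|V|)%N) (alpha_gt0 : forall x, 0 < alpha x).
Local Notation leb := (@lebesgue_measure R).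
Local Notation mu := (dirichlet alpha).
Implicit Types (eta : config R V) (f g : config R V -> R).

Lemma generatorE f : measurable_fun setT f -> generator c alpha f = fun eta =>
  \sum_(p : V * V | ordered p) c p.1 p.2 *
    \int[leb]_u (bet (alpha p.1) (alpha p.2) u * (f (exchange eta p.1 p.2 u) - f eta)).
Proof.
move=> mf; apply/funext => eta; apply: eq_bigr => p _; congr (_ * _).
by apply: generator_termE.
Qed.

Lemma measurable_generator f : measurable_fun setT f -> measurable_fun setT (generator c alpha f).
Proof.
move=> mf; rewrite generatorE//; pose h p (q : config R V * measurableTypeR R) :=
  f (exchange q.1 p.1 p.2 q.2) - f q.1.
under eq_fun do rewrite -big_filter.
apply: measurable_sum => p; apply: measurable_funM => //.
apply: (@measurable_integral_bet _ _ _ p.1 p.2 (h p)).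
apply: measurable_funB; last exact: (measurableT_comp mf measurable_fst).
exact: (measurableT_comp mf (measurable_exchange p.1 p.2)).
Qed.

(** Almost everywhere f (f - P f) is half of jump + f^2 - P (f^2), and the integrals of f^2 and P
    (f^2) cancel by invariance. The pointwise identity needs P (f^2) finite, which holds off a null
    set. *)
Lemma dirichlet_form_jump f : measurable_fun setT f ->
  mu.-integrable setT (fun eta => (f eta ^+ 2)%:E) ->
  dirichlet_form c alpha f =
  (\sum_(p : V * V | ordered p) (c p.1 p.2 / 2)%:E * jump_energy alpha p.1 p.2 f)%E.
Proof.
move=> mf isq; pose sq eta := (f eta ^+ 2)%:E.
pose J p := jump alpha p.1 p.2 f; pose Q p := resample_sq alpha p.1 p.2 f.
have sqoo : (\int[mu]_eta sq eta < +oo)%E.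
  by rewrite ltey_eq (integrable_fin_num measurableT isq).
have iQ p : ordered p -> mu.-integrable setT (Q p).
  move=> /ordered_neq pn; apply/integrableP; split; first exact: measurable_resample_sq.
  rewrite (eq_integral (Q p)); last by move=> eta _; rewrite gee0_abs// resample_sq_ge0.
  by rewrite integral_resample_sq.
have iJ p : ordered p -> mu.-integrable setT (J p).
  move=> /ordered_neq pn; apply/integrableP; split; first exact: measurable_jump.
  rewrite (eq_integral (J p)); last by move=> eta _; rewrite gee0_abs// jump_ge0.
  apply: le_lt_trans (jump_energy_le cardV alpha_gt0 pn mf) _.
  by rewrite lte_mul_pinfty// ge0_fin_numE// integral_ge0// => eta _; rewrite lee_fin sqr_ge0.
(* Set to 0 on pairs that are not ordered, so that every member of the family is integrable. *)
pose T p eta := (if ordered p then (c p.1 p.2 / 2)%:E * (J p eta + sq eta - Q p eta) else 0)%E.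
have iJS p : ordered p -> mu.-integrable setT (fun eta => J p eta + sq eta)%E.
  by move=> op; exact: (integrableD measurableT (iJ p op) isq).
have iJSQ p : ordered p -> mu.-integrable setT (fun eta => J p eta + sq eta - Q p eta)%E.
  by move=> op; exact: (integrableB measurableT (iJS p op) (iQ p op)).
have iT p : mu.-integrable setT (T p).
  have [op|nop] := boolP (ordered p); last by rewrite /T (negbTE nop); exact: integrable0.
  rewrite /T op; exact: (integrableZl measurableT _ (iJSQ p op)).
transitivity (\int[mu]_eta (\sum_(p : V * V | ordered p) T p eta)%R)%E; last first.
  rewrite (integral_sum measurableT iT); apply: eq_bigr => p op.
  rewrite /T op (integralZl measurableT (iJSQ p op)); congr (_ * _)%E.
  rewrite (integralB measurableT (iJS p op) (iQ p op)) (integralD measurableT (iJ p op) isq).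
  rewrite integral_resample_sq//; last exact: ordered_neq.
  by rewrite -addeA subee ?adde0//; exact: integrable_fin_num.
have Qoo p : \forall eta \ae mu, ordered p -> (Q p eta < +oo)%E.
  have [op|nop] := boolP (ordered p); last by apply: nearW.
  apply: filterS (integrable_ae measurableT (iQ p op)) => eta /(_ Logic.I) h _.
  by rewrite ltey_eq h.
apply: ae_eq_integral => //.
- apply/measurable_EFinP; apply: measurable_funM => //; apply: measurableT_comp => //.
  exact: measurable_generator.
- by apply: measurable_int (integrable_sum _ _ (fun p _ => iT p)).
have Qall := filter_forall (ae_filter_ringOfSetsType mu) Qoo.
apply: filterS Qall => eta Qeta _.
rewrite generatorE// -sumrN mulr_sumr -sumEFin; apply: eq_bigr => p op.
have qE : Q p eta = (fine (Q p eta))%:E.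
  rewrite fineK// ge0_fin_numE; first exact: Qeta.
  exact: resample_sq_ge0.
rewrite /T op /J /sq (jumpE alpha_gt0)//; last exact: Qeta.
rewrite -/(Q p eta) qE (generator_term alpha_gt0)//; last exact: Qeta.
rewrite -!EFinD -EFinM; congr EFin; rewrite /=; move: (fine _) => q.
by field.
Qed.

End DirichletForm.

Lemma ler_add_vanishing (R : realFieldType) (x y M : R) : 0 <= M ->
  (forall d, 0 < d -> d <= 1 -> x <= y + d * M) -> x <= y.
Proof.
move=> M0 h; apply/ler_addgt0Pr => e e0.
have M1 : 0 < M + 1 by rewrite ltr_wpDl.
pose d := Num.min 1 (e / (M + 1)).
have d0 : 0 < d by rewrite lt_min ltr01 divr_gt0.
have d1 : d <= 1 by rewrite ge_min lexx.
have de : d * (M + 1) <= e by rewrite -ler_pdivlMr// ge_min lexx orbT.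
apply: le_trans (h d d0 d1) _; rewrite lerD2l; apply: le_trans de.
by rewrite mulrDr mulr1 lerDl ltW.
Qed.

Section CenteredSquare.
Context d (T : measurableType d) (R : realType) (P : probability T R).

Lemma Lnorm2E (f : T -> R) : 'N[P]_2%:E [EFin \o f]%E = ((\int[P]_t (f t ^+ 2)%:E) `^ 2^-1)%E.
Proof.
rewrite unlock /=; congr (_ `^ _)%E; apply: eq_integral => t _.
by rewrite /= powR_mulrn// real_normK// num_real.
Qed.

Lemma Lnorm2_eq1 (f : T -> R) :
  ('N[P]_2%:E [EFin \o f] = 1)%E <-> (\int[P]_t (f t ^+ 2)%:E = 1)%E.
Proof.
rewrite Lnorm2E; have : (0 <= \int[P]_t (f t ^+ 2)%:E)%E.
  by apply: integral_ge0 => t _; rewrite lee_fin sqr_ge0.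
move: (\int[P]_t _)%E => I I0; split => [h|->]; last by rewrite poweR1r.
have : ((I `^ 2^-1) `^ 2 = 1)%E by rewrite h poweR1r.
by rewrite -poweRrM mulVf// poweRe1.
Qed.

Lemma square_integrableP (f : T -> R) : measurable_fun setT f ->
  (\int[P]_t (f t ^+ 2)%:E < +oo)%E <-> P.-integrable setT (fun t => (f t ^+ 2)%:E).
Proof.
move=> mf; have e : (\int[P]_t `|(f t ^+ 2)%:E| = \int[P]_t (f t ^+ 2)%:E)%E.
  by apply: eq_integral => t _; rewrite gee0_abs// lee_fin sqr_ge0.
split=> [h|/integrableP[_]]; last by rewrite e.
apply/integrableP; split; last by rewrite e.
by apply/measurable_EFinP; exact: measurable_funX.
Qed.

Lemma Lfun2P (f : T -> R) : f \in Lfun P 2%:E <->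
  measurable_fun setT f /\ P.-integrable setT (fun t => (f t ^+ 2)%:E).
Proof.
split=> [fL|[mf /(square_integrableP mf) foo]].
  split; last exact: Lfun2_integrable_sqr.
  by move: fL; rewrite inE => /andP[/[!inE]/= ? _].
rewrite inE; apply/andP; split; rewrite inE//=; rewrite /finite_norm Lnorm2E.
by rewrite poweR_lty.
Qed.

Lemma integrable_of_sq (f : T -> R) : measurable_fun setT f ->
  P.-integrable setT (fun t => (f t ^+ 2)%:E) -> P.-integrable setT (EFin \o f).
Proof.
move=> mf i2; apply: (le_integrable measurableT _ _ (integrableD measurableT
  (finite_measure_integrable_cst P 1 measurableT) i2)); first exact/measurable_EFinP.
move=> t _; rewrite /= lee_fin [leRHS]ger0_norm; last by rewrite addr_ge0// sqr_ge0.
rewrite -(real_normK (num_real (f t))).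
have := sqr_ge0 (`|f t| - 2^-1); have := normr_ge0 (f t); move: `|f t| => s; nra.
Qed.

Lemma integral_centered_sq (f : T -> R) (k : R) : measurable_fun setT f ->
  P.-integrable setT (fun t => (f t ^+ 2)%:E) ->
  (\int[P]_t ((f t - k) ^+ 2)%:E =
   (\int[P]_t (f t ^+ 2) - 2 * k * \int[P]_t f t + k ^+ 2)%:E)%E.
Proof.
move=> mf i2; have i1 := integrable_of_sq mf i2.
have ik : P.-integrable setT (EFin \o (fun=> k ^+ 2)) :=
  finite_measure_integrable_cst P (k ^+ 2) measurableT.
have i3 : P.-integrable setT (EFin \o (fun t => - (2 * k) * f t)).
  by have := integrableZl measurableT (- (2 * k)) i1.
have i23 : P.-integrable setT (EFin \o (fun t => f t ^+ 2 + - (2 * k) * f t)).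
  by have := integrableD measurableT i2 i3.
have i : P.-integrable setT (EFin \o (fun t => f t ^+ 2 + - (2 * k) * f t + k ^+ 2)).
  by have := integrableD measurableT i23 ik.
transitivity (\int[P]_t (f t ^+ 2 + - (2 * k) * f t + k ^+ 2)%:E)%E.
  by apply: eq_integral => t _; congr EFin; ring.
rewrite -[LHS]fineK; last exact: (integrable_fin_num measurableT i).
congr EFin.
rewrite -[LHS]/(Rintegral P setT (fun t => f t ^+ 2 + - (2 * k) * f t + k ^+ 2)).
rewrite (RintegralD measurableT i23 ik) (RintegralD measurableT i2 i3).
rewrite (@RintegralZl _ _ _ P setT f)// mulNr; congr (_ + _).
rewrite /Rintegral (integral_cst P measurableT (k ^+ 2)%:E) /=.
by have := probability_setT P; rewrite /= => ->; rewrite mule1.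
Qed.

End CenteredSquare.

(** * From almost affine functions to L^2 *)

Section JumpForm.
Context {R : realType} {V : finType} (c : V -> V -> R) (alpha : V -> R).
Hypotheses (cardV : (2 <= #|V|)%N) (alpha_gt0 : forall x, 0 < alpha x).
Hypothesis c_ge0 : forall x y, 0 <= c x y.
Hypothesis total_rate_gt0 : 0 < total_rate c.
Local Notation mu := (dirichlet alpha).
Local Notation A := (alpha_sum alpha).
Local Notation E := (expect alpha).
Local Notation K := (averaging c alpha).
Local Notation P p := (resample alpha p.1 p.2).
Local Notation JE p := (jump_energy alpha p.1 p.2).
Implicit Types (f F : config R V -> R) (b : V -> R) (p : V * V).

Definition jump_form f : \bar R := (\sum_(p : V * V | ordered p) (c p.1 p.2 / 2)%:E * JE p f)%E.

Let c2_ge0 p : 0 <= c p.1 p.2 / 2. Proof. exact: divr_ge0. Qed.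

Lemma jump_form_bdd F : bdd F ->
  jump_form F = (total_rate c * (E (F \* F) - E (F \* K F)))%:E.
Proof.
move=> bF; rewrite expect_mul_averaging//.
rewrite (_ : E (F \* F) = \sum_(p | ordered p) rate c p * E (F \* F)); last first.
  by rewrite -mulr_suml sum_rate// mul1r.
rewrite -sumrB mulr_sumr -sumEFin; apply: eq_bigr => p /ordered_neq pn.
rewrite jump_energy_bdd// -EFinM; congr EFin.
have -> : E (F \* P p F) = E (P p F \* P p F) by exact: expect_mul_resample.
by rewrite /rate; move: (E _) (E _) => u v; field; rewrite gt_eqF.
Qed.

Let jump_energy_ge0 p f : (0 <= JE p f)%E.
Proof. by apply: integral_ge0 => eta _; exact: jump_ge0. Qed.

Lemma jump_form_ge0 f : (0 <= jump_form f)%E.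
Proof. by apply: sume_ge0 => p _; rewrite mule_ge0// lee_fin. Qed.

Lemma jump_form_le f : measurable_fun setT f ->
  (jump_form f <= (2 * total_rate c)%:E * \int[mu]_eta (f eta ^+ 2)%:E)%E.
Proof.
move=> mf; rewrite mulr_sumr -sumEFin ge0_sume_distrl; last first.
  by move=> p _; rewrite lee_fin mulr_ge0.
apply: lee_sum => p /ordered_neq pn.
apply: le_trans (lee_wpmul2l _ (jump_energy_le cardV alpha_gt0 pn mf)) _.
  by rewrite lee_fin.
rewrite muleA -EFinM; have -> // : c p.1 p.2 / 2 * 4 = 2 * c p.1 p.2 by field.
Qed.

Lemma jump_form_split (d : R) f g : 0 < d -> measurable_fun setT f -> measurable_fun setT g ->
  (jump_form f <= (1 + d)%:E * jump_form g +
    (1 + d^-1)%:E * jump_form (fun eta => f eta - g eta)%R)%E.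
Proof.
move=> d0 mf mg.
have k0 : 0 <= 1 + d by rewrite addr_ge0// ltW.
have l0 : 0 <= 1 + d^-1 by rewrite addr_ge0// invr_ge0 ltW.
rewrite /jump_form !ge0_sume_distrr; last 2 first.
- by move=> p _; rewrite mule_ge0// lee_fin.
- by move=> p _; rewrite mule_ge0// lee_fin.
rewrite -big_split/=; apply: lee_sum => p _.
have h := @jump_energy_split _ _ _ alpha_gt0 p.1 p.2 d f g d0 mf mg.
apply: le_trans (lee_wpmul2l _ h) _.
  by rewrite lee_fin.
move: (jump_energy_ge0 p g) (jump_energy_ge0 p (fun eta => f eta - g eta)).
move: (JE p g) (JE p _) => u v u0 v0; rewrite ge0_muleDr.
- by rewrite muleCA [X in (_ + X)%E]muleCA.
- by apply: mule_ge0 => //; rewrite lee_fin.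
- by apply: mule_ge0 => //; rewrite lee_fin.
Qed.

Lemma jump_formB f (k : R) : jump_form (fun eta => f eta - k) = jump_form f.
Proof. by apply: eq_bigr => p _; rewrite jump_energyB. Qed.

Variables (a2 g : R).
Hypotheses (a2_ge0 : 0 <= a2) (g_ge0 : 0 <= g) (a2_leA : a2 <= A).
Hypothesis a2_le : forall x y, x != y -> 0 < c x y -> a2 <= alpha x + alpha y.
Hypothesis gap_sform : forall b, g / A * sform alpha b <=
  \sum_(p | ordered p) c p.1 p.2 * (edge_weight alpha p * (b p.1 - b p.2) ^+ 2).

Let rt := gap_rate alpha a2 g.

Let rt_ge0 : 0 <= rt.
Proof.
have A0 := alpha_sum_gt0 cardV alpha_gt0.
by rewrite /rt /gap_rate !mulr_ge0// ?invr_ge0 ?addr_ge0// invr_ge0 ltW.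
Qed.

Lemma almost_affine_cst (k : R) : almost_affine (cst k : config R V -> R).
Proof. exact/smooth_almost_affine/smooth_cst. Qed.

(** Recentering the approximation H by k = E H changes the squared distance to f by -k^2, because f
    has mean 0; centering costs nothing. *)
Lemma centered_approx f (e : R) : measurable_fun setT f ->
  mu.-integrable setT (fun eta => (f eta ^+ 2)%:E) -> \int[mu]_eta f eta = 0 -> 0 < e ->
  exists F, [/\ almost_affine F, E F = 0 & (dist_sq mu f F <= e%:E)%E].
Proof.
move=> mf if2 f0 e0; have [H aH fH] := Lfun2_almost_affine mf if2 e0.
have [L _ [bH _]] := aH; have [mH _] := bH.
exists (fun eta => H eta + cst (- E H) eta); split.
- exact: (almost_affineD aH (almost_affine_cst _)).
- rewrite (expectD cardV alpha_gt0 bH (bounded_on_cst _ _)).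
  by rewrite (expect_cst cardV alpha_gt0) subrr.
pose h eta := f eta - H eta; have mh : measurable_fun setT h := measurable_funB mf mH.
have ih2 : mu.-integrable setT (fun eta => (h eta ^+ 2)%:E).
  by apply/square_integrableP => //; exact: le_lt_trans fH (ltry _).
have h1 : \int[mu]_eta h eta = - E H.
  rewrite (RintegralB measurableT (integrable_of_sq mf if2)) ?f0 ?sub0r.
    by congr (- _); rewrite -mean_expect.
  apply: integrable_of_sq => //; apply/square_integrableP => //.
  have := integral_expect cardV alpha_gt0 (bounded_onM bH bH).
  under eq_integral do rewrite /= -expr2.
  by move=> ->; rewrite ltry.
apply: le_trans fH.
rewrite /dist_sq (_ : (\int[mu]_t _)%E = \int[mu]_t ((h t - - E H) ^+ 2)%:E)%E; last first.
  by apply: eq_integral => eta _; congr (_ ^+ 2)%:E; rewrite /h /=; ring.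
rewrite integral_centered_sq// h1.
rewrite -[leRHS]fineK; last exact: (integrable_fin_num measurableT ih2).
rewrite lee_fin /Rintegral; move: (fine _) (E H) => I k.
by have := sqr_ge0 k; nra.
Qed.

(** [spectral_bound] holds for an almost affine approximation F. Norm and energy of f and F are
    compared by Young's inequality with parameter d, which then tends to 0. *)
Lemma gap_rate_le f : measurable_fun setT f ->
  mu.-integrable setT (fun eta => (f eta ^+ 2)%:E) -> \int[mu]_eta f eta = 0 ->
  (\int[mu]_eta (f eta ^+ 2)%:E = 1)%E -> (rt%:E <= jump_form f)%E.
Proof.
move=> mf if2 f0 f1; have := jump_form_le mf; rewrite f1 mule1.
have := jump_form_ge0 f; case JE: (jump_form f) => [D| |] //; rewrite !lee_fin => D0 _.
pose T := total_rate c.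
(* Total error per unit of d, using d^2 <= d: 3 D and 8 T come from expanding (1 + d) ((1 + d) D + 4
   T d), and 2 rt from the comparison of norms. *)
have M0 : 0 <= 3 * D + 8 * T + 2 * rt.
  have T0 : 0 <= T := ltW total_rate_gt0.
  by apply: addr_ge0; [apply: addr_ge0|]; apply: mulr_ge0.
(* An approximation within d^2 absorbs the factor 1 + 1/d on the error: the product is at most 2
   d. *)
apply: (ler_add_vanishing M0) => d d0 d1; have e0 : 0 < d ^+ 2 by exact: exprn_gt0.
have [F [aF F0 fF]] := centered_approx mf if2 f0 e0.
have [L L0 FL] := aF; have [bF _] := FL; have [mF _] := bF.
have sb := spectral_bound cardV alpha_gt0 c_ge0 total_rate_gt0 a2_ge0 g_ge0 a2_leA a2_le gap_sform L0 FL F0.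
have dd : (1 + d^-1) * d ^+ 2 <= 2 * d.
  have -> : (1 + d^-1) * d ^+ 2 = d ^+ 2 + d by field; rewrite gt_eqF.
  by nra.
have l0 : 0 <= 1 + d^-1 by rewrite addr_ge0// invr_ge0 ltW.
have k0 : 0 <= 1 + d by rewrite addr_ge0// ltW.
have FFe : (\int[mu]_eta (F eta ^+ 2)%:E = (E (F \* F))%:E)%E.
  rewrite -(integral_expect cardV alpha_gt0 (bounded_onM bF bF)).
  by apply: eq_integral => eta _; rewrite /= expr2.
set N := E (F \* F) in sb FFe.
have energy : T * (N - E (F \* K F)) <= (1 + d) * D + 4 * T * d.
  have := jump_form_split d0 mF mf; rewrite jump_form_bdd// JE => h.
  rewrite -lee_fin; apply: le_trans h _; rewrite [leRHS]EFinD; apply: leeD => //.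
  have mFf := measurable_funB mF mf.
  apply: le_trans (lee_wpmul2l _ (jump_form_le mFf)) _; first by rewrite lee_fin.
  rewrite muleA -EFinM.
  apply: (@le_trans _ _ (((1 + d^-1) * (2 * T))%:E * (d ^+ 2)%:E)%E).
    apply: lee_wpmul2l; first by rewrite lee_fin !mulr_ge0// ltW.
    apply: le_trans fF; rewrite le_eqVlt; apply/orP; left; apply/eqP.
    by apply: eq_integral => eta _; congr EFin; rewrite -sqrrN opprB.
  rewrite -EFinM lee_fin mulrAC (_ : 4 * T * d = (2 * d) * (2 * T)); last by ring.
  by apply: ler_wpM2r => //; rewrite mulr_ge0// ltW.
have norm : 1 <= (1 + d) * N + 2 * d.
  rewrite -lee_fin -f1.
  apply: (@le_trans _ _ ((1 + d)%:E * \int[mu]_eta (F eta ^+ 2)%:E +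
     (1 + d^-1)%:E * dist_sq mu f F)%E); last first.
    rewrite FFe [leRHS]EFinD; apply: leeD => //.
    apply: le_trans (lee_wpmul2l _ fF) _; first by rewrite lee_fin.
    by rewrite -EFinM lee_fin.
  have mF2 : measurable_fun setT (fun eta => (F eta ^+ 2)%:E).
    by apply/measurable_EFinP; exact: measurable_funX.
  have mfF : measurable_fun setT (fun eta => ((f eta - F eta) ^+ 2)%:E).
    by apply/measurable_EFinP; apply: measurable_funX; exact: measurable_funB.
  have F20 eta : (0 <= (F eta ^+ 2)%:E)%E by rewrite lee_fin sqr_ge0.
  have fF0 eta : (0 <= ((f eta - F eta) ^+ 2)%:E)%E by rewrite lee_fin sqr_ge0.
  rewrite -(ge0_integral_comb mu k0 l0 mF2 F20 mfF fF0).
  apply: ge0_le_integral => //.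
  - by move=> eta _; rewrite lee_fin sqr_ge0.
  - by apply/measurable_EFinP; exact: measurable_funX.
  - by apply: emeasurable_funD; exact: measurable_funeM.
  move=> eta _; have := young_sqr (f eta) 0 (F eta) 0 d0.
  by rewrite !subr0.
have h1 : rt * N <= (1 + d) * D + 4 * T * d by exact: le_trans sb energy.
have h2 : rt <= (1 + d) * (rt * N) + 2 * d * rt.
  have := ler_wpM2l rt_ge0 norm; rewrite mulr1 => /le_trans; apply.
  by rewrite le_eqVlt; apply/orP; left; apply/eqP; ring.
apply: (le_trans h2); have := ler_wpM2l k0 h1 => h3.
apply: le_trans (lerD h3 (lexx _)) _; rewrite -subr_ge0.
rewrite (_ : _ - _ = (d - d ^+ 2) * D + (d - d ^+ 2) * (4 * T)); last by ring.
have dd2 : 0 <= d - d ^+ 2 by rewrite subr_ge0 expr2 ler_piMl// ltW.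
by rewrite addr_ge0// mulr_ge0// mulr_ge0// ltW.
Qed.

End JumpForm.

(** * Comparison of the two gaps *)

Section Gap.
Context {R : realType} {V : finType} (c : V -> V -> R) (alpha : V -> R).
Hypotheses (cardV : (2 <= #|V|)%N) (alpha_gt0 : forall x, 0 < alpha x).
Hypotheses (c_ge0 : forall x y, 0 <= c x y) (c_sym : forall x y, c x y = c y x).
Hypothesis c_diag : forall x, c x x = 0.
Hypothesis c_connected : forall x y, connect (fun a b => 0 < c a b) x y.
Local Notation mu := (dirichlet alpha).
Local Notation A := (alpha_sum alpha).
Local Notation E := (expect alpha).
Implicit Types (f : config R V -> R) (b : V -> R) (p : V * V).

Let A_gt0 : 0 < A := alpha_sum_gt0 cardV alpha_gt0.

(** Two distinct vertices are joined by a path; its first step is an edge, whose ends differ by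
    [c_diag]. *)
Lemma exists_edge : exists x y, x != y /\ 0 < c x y.
Proof.
have /card_gt1P[x [y [_ _ xy]]] := cardV.
have /connectP[[|z s] /= ps ys] := c_connected x y; first by rewrite ys eqxx in xy.
have /andP[xz _] := ps; exists x, z; split => //.
by apply: contraTneq xz => ->; rewrite c_diag ltxx.
Qed.

Lemma total_rate_gt0 : 0 < total_rate c.
Proof.
have [x [y [xy cxy]]] := exists_edge.
have [p op cp] : exists2 p, ordered p & 0 < c p.1 p.2.
  have : enum_rank x != enum_rank y by rewrite (inj_eq enum_rank_inj).
  rewrite -val_eqE neq_ltn => /orP[xy'|yx]; first by exists (x, y).
  by exists (y, x) => //=; rewrite c_sym.
by rewrite /total_rate (bigD1 p)//= ltr_pwDl// sumr_ge0.
Qed.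

Let edge_sums := [set alpha p.1 + alpha p.2 | p in [set p : V * V | p.1 != p.2 /\ 0 < c p.1 p.2]].

Let edge_sums_lbound : lbound edge_sums 0.
Proof. by move=> _ [p _ <-]; rewrite addr_ge0// ltW. Qed.

Lemma alpha2_min_ge0 : 0 <= alpha2_min c alpha.
Proof.
have [x [y [xy cxy]]] := exists_edge.
by apply: lb_le_inf edge_sums_lbound; exists (alpha x + alpha y); exists (x, y).
Qed.

Lemma alpha2_min_le x y : x != y -> 0 < c x y -> alpha2_min c alpha <= alpha x + alpha y.
Proof.
by move=> xy cxy; apply: ge_inf; [exists 0; exact: edge_sums_lbound|exists (x, y)].
Qed.

Lemma alpha2_min_le_sum : alpha2_min c alpha <= A.
Proof.
have [x [y [xy cxy]]] := exists_edge; apply: le_trans (alpha2_min_le xy cxy) _.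
rewrite /alpha_sum (bigD1 x)//= (bigD1 y)//=; last by rewrite eq_sym.
by rewrite addrA lerDl sumr_ge0// => z _; exact: ltW.
Qed.

Let EB b : R := \sum_(p | ordered p) c p.1 p.2 * (edge_weight alpha p * (b p.1 - b p.2) ^+ 2).

Let affine (a : R) b : config R V -> R := fun eta => a + lin b eta.

Let bdd_affine a b : bdd (affine a b).
Proof. exact: (bounded_onD (bounded_on_cst _ a) (bdd_lin b)). Qed.

Let bdd_sq f : bdd f -> (\int[mu]_eta (f eta ^+ 2)%:E = (E (f \* f))%:E)%E.
Proof.
move=> bf; rewrite -(integral_expect cardV alpha_gt0 (bounded_onM bf bf)).
by apply: eq_integral => eta _; rewrite /= expr2.
Qed.

Lemma bdd_Lfun2 f : bdd f -> f \in Lfun mu 2%:E.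
Proof.
move=> bf; have [mf _] := bf; apply/Lfun2P; split => //.
by apply/square_integrableP => //; rewrite (bdd_sq bf) ltry.
Qed.

Lemma normalizedE f : normalized alpha f <->
  (\int[mu]_eta ((f eta - mean alpha f) ^+ 2)%:E = 1)%E.
Proof. exact: Lnorm2_eq1. Qed.

Lemma normalized_affine a b : normalized alpha (affine a b) <-> sform alpha b = A ^+ 2 * (A + 1).
Proof.
have ba := bdd_affine a b; have [ma _] := ba; have bl := bdd_lin b.
have A1 : 0 < A + 1 by rewrite addr_gt0.
rewrite normalizedE (mean_expect cardV alpha_gt0 ma).
have Ea : E (affine a b) = a + E (lin b).
  rewrite (expectD cardV alpha_gt0 (bounded_on_cst _ a) bl).
  by congr (_ + _); exact: expect_cst.
pose m := E (lin b).
have -> : (\int[mu]_eta ((affine a b eta - E (affine a b)) ^+ 2)%:E =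
    (sform alpha b / (A ^+ 2 * (A + 1)))%:E)%E.
  rewrite -variance_lin//.
  transitivity (\int[mu]_eta ((lin b eta - m) ^+ 2)%:E)%E.
    by apply: eq_integral => eta _; rewrite Ea /affine /m; congr (_ ^+ 2)%:E; ring.
  have [ml _] := bl.
  rewrite integral_centered_sq//; last first.
    by apply/square_integrableP => //; rewrite (bdd_sq bl) ltry.
  rewrite (_ : \int[mu]_t lin b t = m); last by rewrite /m -mean_expect.
  rewrite (_ : \int[mu]_t lin b t ^+ 2 = E (lin b \* lin b)); last first.
    by apply: EFin_inj; rewrite -(bdd_sq bl) /Rintegral (bdd_sq bl).
  by congr EFin; rewrite -/m /=; move: (E _) m => u v; ring.
have D0 : A ^+ 2 * (A + 1) != 0 by rewrite gt_eqF// mulr_gt0// exprn_gt0.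
split=> [[/divr1_eq]|->] //; by rewrite divff.
Qed.

Lemma dirichlet_form_affine a b : dirichlet_form c alpha (affine a b) = (EB b / (A * (A + 1)))%:E.
Proof.
have ba := bdd_affine a b; have [ma _] := ba; have bl := @bdd_lin R V b.
rewrite dirichlet_form_jump//; last by apply/square_integrableP => //; rewrite (bdd_sq ba) ltry.
rewrite mulr_suml -sumEFin; apply: eq_bigr => p /ordered_neq pn.
rewrite (_ : jump_energy _ _ _ _ = jump_energy alpha p.1 p.2 (lin b)); last first.
  rewrite -(jump_energyB alpha p.1 p.2 (lin b) (- a)).
  by congr jump_energy; apply/funext => eta; rewrite opprK addrC.
rewrite (jump_energy_bdd cardV alpha_gt0 pn bl) -EFinM; congr EFin.
have -> : E (lin b \* resample alpha p.1 p.2 (lin b)) =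
    E (resample alpha p.1 p.2 (lin b) \* resample alpha p.1 p.2 (lin b)).
  exact: expect_mul_resample.
rewrite expect_lin_resample// -/(edge_weight alpha p) /=; move: (edge_weight _ _) => w.
by field; rewrite !gt_eqF// addr_gt0.
Qed.

Lemma poly1_Lfun2 f : poly1 f -> f \in Lfun mu 2%:E.
Proof.
move=> [a [b fE]]; have -> : f = affine a b by apply/funext => eta; exact: fE.
exact/bdd_Lfun2/bdd_affine.
Qed.

Lemma gap_le_gap1 : (gap c alpha <= gap1 c alpha)%E.
Proof.
apply: le_ereal_inf => _ [f [pf nf] <-]; exists f => //; split => //.
exact: poly1_Lfun2.
Qed.

Lemma dirichlet_formE f : f \in Lfun mu 2%:E ->
  dirichlet_form c alpha f = jump_form c alpha f.
Proof. by move=> /Lfun2P[mf if2]; exact: dirichlet_form_jump. Qed.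

Lemma gap1_ge0 : (0 <= gap1 c alpha)%E.
Proof.
apply: le_ereal_inf_tmp => _ [f [/poly1_Lfun2 fL _] <-].
by rewrite dirichlet_formE//; exact: jump_form_ge0.
Qed.

Lemma gap1_le b : sform alpha b = A ^+ 2 * (A + 1) -> (gap1 c alpha <= (EB b / (A * (A + 1)))%:E)%E.
Proof.
move=> sb; rewrite -(dirichlet_form_affine 0); apply: ereal_inf_lbound.
by exists (affine 0 b) => //; split; [exists 0, b|exact/normalized_affine].
Qed.

(** [gap1] only tests normalized functions; rescaling b brings the variance of lin b to 1, that is
    [sform] to A^2 (A + 1). *)
Lemma normalized_direction b : 0 < sform alpha b -> exists t,
  t ^+ 2 = A ^+ 2 * (A + 1) / sform alpha b /\
  sform alpha (fun x => t * b x) = A ^+ 2 * (A + 1).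
Proof.
move=> sb; have A1 : 0 < A + 1 by rewrite addr_gt0.
exists (Num.sqrt (A ^+ 2 * (A + 1) / sform alpha b)).
have tE : Num.sqrt (A ^+ 2 * (A + 1) / sform alpha b) ^+ 2 = A ^+ 2 * (A + 1) / sform alpha b.
  by rewrite sqr_sqrtr// divr_ge0// ltW// mulr_gt0// exprn_gt0.
split => //; move: (Num.sqrt _) tE => t tE.
transitivity (t ^+ 2 * sform alpha b); last by rewrite tE mulfVK// gt_eqF.
rewrite /sform (_ : \sum_z alpha z * (t * b z) ^+ 2 = t ^+ 2 * \sum_z alpha z * b z ^+ 2).
  rewrite (_ : \sum_z alpha z * (t * b z) = t * \sum_z alpha z * b z); first ring.
  by rewrite mulr_sumr; apply: eq_bigr => z _; ring.
by rewrite mulr_sumr; apply: eq_bigr => z _; ring.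
Qed.

(** The infimum is nonnegative, and it runs over a nonempty family: the rescaled indicator of a
    vertex gives a normalized function of finite energy. *)
Lemma gap1_fin_num : gap1 c alpha \is a fin_num.
Proof.
rewrite ge0_fin_numE ?gap1_ge0//; have [x [y [xy _]]] := exists_edge.
pose b z : R := (z == x)%:R.
have sb : 0 < sform alpha b.
  rewrite -(pmulr_rgt0 _ (ltr0Sn R 1)); apply: lt_le_trans (sform_ge alpha_gt0 b x y).
  by rewrite /b eqxx eq_sym (negbTE xy) subr0 expr1n mulr1 mulr_gt0.
have [t [_ /gap1_le h]] := normalized_direction sb.
exact: le_lt_trans h (ltry _).
Qed.

(** The definition of gap_1 made homogeneous: b is rescaled to a normalized function when [sform] is
    positive, and the left side vanishes otherwise. *)
Lemma gap1_sform b : fine (gap1 c alpha) / A * sform alpha b <= EB b.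
Proof.
have EB0 b' : 0 <= EB b'.
  apply: sumr_ge0 => p _; apply: mulr_ge0 => //; apply: mulr_ge0; last exact: sqr_ge0.
  by rewrite divr_ge0 ?mulr_ge0 ?addr_ge0// ltW.
have := sform_ge0 alpha_gt0 b; rewrite le_eqVlt => /orP[/eqP <-|sb]; first by rewrite mulr0.
have A1 : 0 < A + 1 by rewrite addr_gt0.
have [t [tE /gap1_le]] := normalized_direction sb.
rewrite -(fineK gap1_fin_num) lee_fin (_ : EB _ = t ^+ 2 * EB b); last first.
  by rewrite mulr_sumr; apply: eq_bigr => p _; ring.
rewrite tE => h.
have : fine (gap1 c alpha) <= A / sform alpha b * EB b.
  apply: le_trans h _; rewrite le_eqVlt; apply/orP; left; apply/eqP.
  by move: (EB b) => e; field; rewrite !gt_eqF.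
have sA : 0 < sform alpha b / A by rewrite divr_gt0.
rewrite -(ler_pM2r sA) => h2; apply: le_trans (le_trans _ h2) _.
  by rewrite le_eqVlt; apply/orP; left; apply/eqP; ring.
rewrite le_eqVlt; apply/orP; left; apply/eqP.
by move: (EB b) => e; field; rewrite !gt_eqF.
Qed.

Lemma gap_ge_gamma : ((gamma_KMP c alpha)%:E * gap1 c alpha <= gap c alpha)%E.
Proof.
rewrite -(fineK gap1_fin_num) -EFinM -/(gap_rate alpha (alpha2_min c alpha) (fine (gap1 c alpha))).
apply: le_ereal_inf_tmp => _ [f [fL fn] <-]; rewrite dirichlet_formE//.
have /Lfun2P[mf if2] := fL; have if1 := integrable_of_sq mf if2.
pose m := mean alpha f.
(* Jumps do not see constants, so f may be centered. *)
rewrite -(jump_formB c alpha f m).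
have mfm : measurable_fun setT (fun eta => f eta - m) by exact: measurable_funB.
have := fn; rewrite normalizedE -/m => n1.
apply: gap_rate_le => //.
- exact: total_rate_gt0.
- exact: alpha2_min_ge0.
- by rewrite fine_ge0// gap1_ge0.
- exact: alpha2_min_le_sum.
- exact: alpha2_min_le.
- exact: gap1_sform.
- by apply/square_integrableP => //; rewrite n1 ltry.
have ik : mu.-integrable setT (EFin \o (fun=> m)) := finite_measure_integrable_cst mu m measurableT.
rewrite (RintegralB measurableT if1 ik) -/(mean alpha f) -/m.
rewrite /Rintegral (integral_cst mu measurableT m%:E).
by have := probability_setT mu; rewrite /= => ->; rewrite mule1 subrr.
Qed.

End Gap.

Theorem theorem1p1 (R : realType) (V : finType) (c : V -> V -> R)
    (alpha : V -> R)
    (cardV : (2 <= #|V|)%N)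
    (c_sym : forall x y, c x y = c y x)
    (c_ge0 : forall x y, 0 <= c x y)
    (c_diag : forall x, c x x = 0)
    (c_connected : forall x y, connect (fun a b => 0 < c a b) x y)
    (alpha_gt0 : forall x, 0 < alpha x) :
  ((gamma_KMP c alpha)%:E * gap1 c alpha <= gap c alpha <= gap1 c alpha)%E.
Proof. by rewrite gap_ge_gamma// gap_le_gap1. Qed.
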